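(* There is a polynomial-time $O(q\log n)$-approximation algorithm for the $(p,q)$-Flexible Graph Connectivity problem: given any feasible instance with $n=|V|$ vertices and integers $p\ge1$, $q\ge0$, it outputs a feasible edge-set whose cost is at most $O(q\log n)$ times the minimum cost of a feasible edge-set.
   Context: An instance of the $(p,q)$-Flexible Graph Connectivity problem $(p,q)$-FGC, for integers $p\ge1$, $q\ge0$, consists of an undirected connected graph $G=(V,E)$ (multiedges allowed, no self-loops), a partition $E=\mathscr{S}\,\dot\cup\,\mathscr{U}$ into safe edges and unsafe edges, and nonnegative costs $c:E\to\mathbb{R}_{\ge0}$. An edge-set $F\subseteq E$ (a sub-multiset of $E$) is feasible if for every $F'\subseteq\mathscr{U}$ with $|F'|\le q$, the subgraph $(V,F\setminus F')$ is $p$-edge connected. The goal is to minimize $c(F)=\sum_{e\in F}c_e$ over feasible $F$.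
   Formalization: The factor O(q log n) is read as O(max(q,1) log n), since for q = 0 it would literally be 0 (false already for one edge of cost 1 on two vertices); polynomial time is in a model with exact addition, subtraction and comparison of real costs. *)

(* Defs.v *)
From HB Require Import structures.
From Corelib Require Import BinNums.
From mathcomp Require Import all_boot all_order all_algebra.
From mathcomp Require Import reals exp.

Set Implicit Arguments.
Unset Strict Implicit.
Unset Printing Implicit Defensive.

Import Order.TTheory GRing.Theory Num.Theory.

Local Open Scope ring_scope.

(** * Flexible graph connectivity *)

(* A multigraph is given by labelled edges with endpoints [src e], [dst e]
   (their order is irrelevant), so parallel edges are distinct labels and a
   sub-multiset of the edges is a set of labels. *)

Definition adj (n m : nat) (src dst : 'I_m -> 'I_n) (F : {set 'I_m}) :
    rel 'I_n :=
  fun x y => [exists e in F, ((src e == x) && (dst e == y)) ||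
                             ((src e == y) && (dst e == x))].

Definition connected (n m : nat) (src dst : 'I_m -> 'I_n) (F : {set 'I_m}) :
    Prop :=
  forall x y : 'I_n, connect (adj src dst F) x y.

Definition edge_connected (n m : nat) (src dst : 'I_m -> 'I_n) (p : nat)
    (F : {set 'I_m}) : Prop :=
  forall D : {set 'I_m}, D \subset F -> (#|D| < p)%N ->
    connected src dst (F :\: D).

Record instance (R : realType) := Instance {
  nv : nat;
  ne : nat;
  src : 'I_ne -> 'I_nv;
  dst : 'I_ne -> 'I_nv;
  safe : {set 'I_ne};
  cost : 'I_ne -> R;
  nv_gt0 : (0 < nv)%N;
  loopless : forall e, src e != dst e;
  whole_connected : connected src dst [set: 'I_ne];
  cost_ge0 : forall e, 0 <= cost e }.

Definition unsafe (R : realType) (I : instance R) : {set 'I_(ne I)} :=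
  ~: safe I.

Definition feasible (R : realType) (I : instance R) (p q : nat)
    (F : {set 'I_(ne I)}) : Prop :=
  forall F' : {set 'I_(ne I)}, F' \subset unsafe I -> (#|F'| <= q)%N ->
    edge_connected (@src R I) (@dst R I) p (F :\: F').
Arguments feasible {R} I p q F.

Definition total_cost (R : realType) (I : instance R) (F : {set 'I_(ne I)}) :
    R :=
  \sum_(e in F) cost e.
Arguments total_cost {R} I F.

(** * Model of computation *)

(* N. D. Jones' language WHILE over binary trees ("Computability and
   Complexity", MIT Press 1997), whose polynomial time coincides with that of
   Turing machines, extended with tree leaves that carry real numbers so that
   real edge costs can be input data. A real can only be added to, subtracted
   from, or compared with another real. Without multiplication, unit cost for
   these operations is harmless: on rational inputs, after t steps every stored
   number is an integer combination of input numbers with coefficients at most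
   2^t, so a polynomial number of steps is polynomial time on bits as well. *)

Inductive tree (R : Type) :=
  | TNil
  | TCons of tree R & tree R
  | TNum of R.
Arguments TNil {R}.

Inductive expr :=
  | Var of nat
  | Nil
  | Cons of expr & expr
  | Hd of expr
  | Tl of expr
  | Zero
  | Add of expr & expr
  | Sub of expr & expr
  | Le of expr & expr.

Inductive cmd :=
  | Assign of nat & expr
  | Seq of cmd & cmd
  | If of expr & cmd & cmd
  | While of expr & cmd.

Definition of_bool (R : Type) (b : bool) : tree R :=
  if b then TCons TNil TNil else TNil.

Definition truthy (R : Type) (v : tree R) : bool :=
  if v is TNil then false else true.

Definition store (R : Type) := nat -> tree R.

Definition update (R : Type) (s : store R) (x : nat) (v : tree R) : store R :=
  fun y => if y == x then v else s y.

(* Ill-typed operations return [TNil]. *)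
Fixpoint eval (R : realType) (s : store R) (e : expr) : tree R :=
  match e with
  | Var x => s x
  | Nil => TNil
  | Cons e1 e2 => TCons (eval s e1) (eval s e2)
  | Hd e1 => if eval s e1 is TCons v _ then v else TNil
  | Tl e1 => if eval s e1 is TCons _ v then v else TNil
  | Zero => TNum 0
  | Add e1 e2 =>
      match eval s e1, eval s e2 with
      | TNum x, TNum y => TNum (x + y)
      | _, _ => TNil
      end
  | Sub e1 e2 =>
      match eval s e1, eval s e2 with
      | TNum x, TNum y => TNum (x - y)
      | _, _ => TNil
      end
  | Le e1 e2 =>
      match eval s e1, eval s e2 with
      | TNum x, TNum y => of_bool R (x <= y)
      | _, _ => TNil
      end
  end.

Fixpoint etime (e : expr) : nat :=
  match e with
  | Var _ | Nil | Zero => 1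
  | Hd e1 | Tl e1 => (etime e1).+1
  | Cons e1 e2 | Add e1 e2 | Sub e1 e2 | Le e1 e2 => (etime e1 + etime e2).+1
  end.

(* [exec c s t s']: started in [s], [c] halts in [s'] after time [t]. *)
Inductive exec (R : realType) : cmd -> store R -> nat -> store R -> Prop :=
  | ExecAssign x e s :
      exec (Assign x e) s (etime e).+1 (update s x (eval s e))
  | ExecSeq c1 c2 s1 t1 s2 t2 s3 :
      exec c1 s1 t1 s2 -> exec c2 s2 t2 s3 ->
      exec (Seq c1 c2) s1 (t1 + t2)%N s3
  | ExecIfTrue e c1 c2 s t s' :
      truthy (eval s e) -> exec c1 s t s' ->
      exec (If e c1 c2) s (etime e + t).+1 s'
  | ExecIfFalse e c1 c2 s t s' :
      ~~ truthy (eval s e) -> exec c2 s t s' ->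
      exec (If e c1 c2) s (etime e + t).+1 s'
  | ExecWhileFalse e c s :
      ~~ truthy (eval s e) -> exec (While e c) s (etime e).+1 s
  | ExecWhileTrue e c s1 t1 s2 t2 s3 :
      truthy (eval s1 e) -> exec c s1 t1 s2 -> exec (While e c) s2 t2 s3 ->
      exec (While e c) s1 (etime e + t1 + t2).+1 s3.

(* Input and output are both in variable 0. *)
Definition computes_in (R : realType) (A : cmd) (input : tree R) (t : nat)
    (output : tree R) : Prop :=
  exists2 s : store R,
    exec A (update (fun=> TNil) 0 input) t s & s 0%N = output.

(** * Encodings *)

Fixpoint tree_size (R : Type) (v : tree R) : nat :=
  if v is TCons v1 v2 then (tree_size v1 + tree_size v2).+1 else 1.

Definition enc_seq (R : Type) (s : seq (tree R)) : tree R :=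
  foldr (@TCons R) TNil s.

(* Binary, least significant bit first. *)
Fixpoint enc_pos (R : Type) (b : positive) : tree R :=
  match b with
  | xH => TCons (of_bool R true) TNil
  | xO b' => TCons (of_bool R false) (enc_pos R b')
  | xI b' => TCons (of_bool R true) (enc_pos R b')
  end.

Definition enc_nat (R : Type) (k : nat) : tree R :=
  if bin_of_nat k is Npos b then enc_pos R b else TNil.

Definition enc_edge (R : realType) (I : instance R) (e : 'I_(ne I)) : tree R :=
  enc_seq [:: enc_nat R (src e); enc_nat R (dst e);
              of_bool R (e \in safe I); TNum (cost e)].

Definition enc_instance (R : realType) (I : instance R) (p q : nat) : tree R :=
  enc_seq [:: enc_nat R (nv I); enc_nat R p; enc_nat R q;
              enc_seq [seq enc_edge e | e <- enum 'I_(ne I)]].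

(* The characteristic bit vector, in the order of the edges in the input. *)
Definition enc_edge_set (R : Type) (m : nat) (F : {set 'I_m}) : tree R :=
  enc_seq [seq of_bool R (e \in F) | e <- enum 'I_m].

(* Main.v *)
Require Import Defs.
From HB Require Import structures.
From Corelib Require Import BinNums.
From mathcomp Require Import all_boot all_order all_algebra.
From mathcomp Require Import reals sequences exp.
From mathcomp Require Import zify ring lra.

Set Implicit Arguments.
Unset Strict Implicit.
Unset Printing Implicit Defensive.

Import Order.TTheory GRing.Theory Num.Theory.

Local Open Scope ring_scope.

(** An edge set F is (p,q)-feasible iff every cut has at least p safe F-edges or
    at least p+q F-edges; call F good for T if every cut has p safe F-edges or T
    F-edges. Starting from a minimum spanning tree (T = 1), the algorithm raises
    T to 2, 4, 8, ..., p and then one by one to p+q. To go from T0 to T, give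
    every safe edge of F multiplicity max(T0,p) and every unsafe one multiplicity
    p: all cuts then have at least p*T0 edges, and a cut that still has to be
    augmented has fewer than twice as many. Such near-minimum cuts are enumerated
    through a greedy tree packing (repeatedly a spanning tree of minimum load):
    a multiplicative-weights argument shows that each of them crosses at least
    half of the trees at most 20 times, so it is found by branching along a tree,
    and double counting bounds their number by 2 n^20. Greedy multicover, analysed
    by dual fitting, then augments the cuts at cost O(log n) min(1, T/p) OPT. The
    factors T/p of the doubling phases form a geometric series, and the remaining
    q phases cost O(log n) OPT each.

    Polynomial running time is obtained from a relation [pt] between an input and
    an output, both depending on a parameter, that holds if a program computes
    the second from the first in time polynomial in the parameter; it is closed
    under pairing, case distinction and folding over lists. *)

(** * Polynomial-time computability *)

Section PolynomialBounds.
Local Open Scope nat_scope.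

(** The sets F' are exponentially many, and whether a cut needs more edges is not a matter of its
    size: p safe edges suffice, while p+q-1 edges with too few safe ones do not. Working in stages
    turns the violated cuts into near-minimum cuts of one multigraph. Its multiplicities balance the
    two alternatives: p safe edges at weight T0 and T0 edges at weight p both give p T0. Starting at
    T = 1 keeps p T0 positive. The model of computation has no randomness and does not multiply
    reals. The packing therefore chooses trees by comparing integer loads; exponential weights occur
    only in its analysis. The loads across a near-minimum cut add up to at most 10 times the number
    of trees, so Markov's inequality gives the threshold 20, which is also the exponent in the
    number of cuts. The factor T/p arises because every cut has at least p edges of a feasible set,
    so scaling that set by T/p leaves T units on the cut. Since p and q are given in binary, they
    are first cut down to the number of edges. *)

Definition polyb (f : nat -> nat) := exists a k, forall N, f N <= a * N.+1 ^ k.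

Lemma polyb_const a : polyb (fun=> a).
Proof. by exists a, 0 => N; rewrite expn0 muln1. Qed.

Lemma polyb_id : polyb id.
Proof. by exists 1, 1 => N; rewrite mul1n expn1. Qed.

Lemma polyb_add f g : polyb f -> polyb g -> polyb (fun N => f N + g N).
Proof.
move=> [a [k fP]] [b [l gP]]; exists (a + b), (k + l) => N.
rewrite mulnDl leq_add // ?(leq_trans (fP N)) ?(leq_trans (gP N)) //.
  by rewrite leq_mul2l leq_pexp2l ?leq_addr ?orbT.
by rewrite leq_mul2l leq_pexp2l ?leq_addl ?orbT.
Qed.

Lemma polyb_mul f g : polyb f -> polyb g -> polyb (fun N => f N * g N).
Proof.
move=> [a [k fP]] [b [l gP]]; exists (a * b), (k + l) => N.
by rewrite expnD mulnACA leq_mul.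
Qed.

Definition bnd (J : Type) (P : nat -> J -> Prop) (f : J -> nat) :=
  exists2 L, polyb L & forall N j, P N j -> f j <= L N.

Section Bnd.
Variables (J : Type) (P : nat -> J -> Prop).
Implicit Types f g : J -> nat.

Lemma bnd_const a : bnd P (fun=> a).
Proof. by exists (fun=> a) => //; apply: polyb_const. Qed.

Lemma bnd_size f : (forall N j, P N j -> f j <= N) -> bnd P f.
Proof. by move=> fP; exists id => //; apply: polyb_id. Qed.

Lemma bnd_add f g : bnd P f -> bnd P g -> bnd P (fun j => f j + g j).
Proof.
move=> [L Lp fP] [M Mp gP]; exists (fun N => L N + M N); first exact: polyb_add.
by move=> N j Pj; rewrite leq_add ?fP ?gP.
Qed.

Lemma bnd_mul f g : bnd P f -> bnd P g -> bnd P (fun j => f j * g j).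
Proof.
move=> [L Lp fP] [M Mp gP]; exists (fun N => L N * M N); first exact: polyb_mul.
by move=> N j Pj; rewrite leq_mul ?fP ?gP.
Qed.

Lemma bnd_exp f k : bnd P f -> bnd P (fun j => f j ^ k).
Proof.
move=> fP; elim: k => [|k IH].
  by exists (fun=> 1) => //; apply: polyb_const.
have [L Lp LP] := bnd_mul fP IH.
by exists L => // N j Pj; rewrite expnS LP.
Qed.

Lemma bnd_le f g : bnd P g -> (forall N j, P N j -> f j <= g j) -> bnd P f.
Proof.
move=> [L Lp gP] fg; exists L => // N j Pj.
exact: leq_trans (fg _ _ Pj) (gP _ _ Pj).
Qed.

Lemma bnd_reindex (J' : Type) (P' : nat -> J' -> Prop) (h : J' -> J) f :
  (forall N q, P' N q -> P N (h q)) -> bnd P f -> bnd P' (fun q => f (h q)).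
Proof. by move=> hP [L Lp fP]; exists L => // N q /hP/fP. Qed.

End Bnd.
End PolynomialBounds.

(** * Composition rules for polynomial-time programs *)

Section Ptime.
Variable R : realType.
Local Open Scope nat_scope.
Local Notation tree := (tree R).

(* A family of programs, uniform in the variable [d] that holds the input: the
   output goes to [d.+1], and only variables above [d] are overwritten, so
   programs compose without renaming. [P N j] reads: [j] is a legal parameter
   and its size is at most [N]. *)
Definition pt (J : Type) (P : nat -> J -> Prop) (ctx res : J -> tree) : Prop :=
  exists2 c : nat -> cmd, True & exists2 T, polyb T &
  forall N j d s, P N j -> s d = ctx j ->
  exists t s', [/\ exec (c d) s t s', t <= T N, s' d.+1 = res j &
                   forall x, x <= d -> s' x = s x].

Lemma updateE (s : store R) x v : update s x v x = v.
Proof. by rewrite /update eqxx. Qed.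

Lemma update_neq (s : store R) x v y : y != x -> update s x v y = s y.
Proof. by rewrite /update => /negbTE->. Qed.

Lemma update_lt (s : store R) x v y : y < x -> update s x v y = s y.
Proof. by move=> lt; rewrite update_neq // neq_ltn lt. Qed.

Lemma pt_restrict (J : Type) (P P' : nat -> J -> Prop) (ctx r : J -> tree) :
  (forall N j, P' N j -> P N j) -> pt P ctx r -> pt P' ctx r.
Proof.
move=> sub [c _ [T Tp cP]]; exists c => //; exists T => // N j d s /sub.
exact: cP.
Qed.

Lemma pt_ext (J : Type) (P : nat -> J -> Prop) (ctx r r' : J -> tree) :
  (forall N j, P N j -> r j = r' j) -> pt P ctx r -> pt P ctx r'.
Proof.
move=> rr' [c _ [T Tp cP]]; exists c => //; exists T => // N j d s Pj sd.
have [t [s' [? ? ? ?]]] := cP N j d s Pj sd.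
by exists t, s'; split => //; rewrite -(rr' N).
Qed.

Section Rules.
Variables (J : Type) (P : nat -> J -> Prop) (ctx : J -> tree).

Lemma pt_expr (e : nat -> expr) (t : nat) (res : J -> tree) :
  (forall d, etime (e d) <= t) ->
  (forall N j d s, P N j -> s d = ctx j -> eval s (e d) = res j) ->
  pt P ctx res.
Proof.
move=> et ev; exists (fun d => Assign d.+1 (e d)) => //.
exists (fun=> t.+1); first exact: polyb_const.
move=> N j d s Pj sd; exists (etime (e d)).+1, (update s d.+1 (eval s (e d))).
split; [exact: ExecAssign | by rewrite ltnS | by rewrite updateE; apply: ev Pj sd|].
by move=> x xd; rewrite update_lt.
Qed.

Lemma pt_ctx : pt P ctx ctx.
Proof. by apply: (@pt_expr (fun d => Var d) 1). Qed.

Lemma pt_nil : pt P ctx (fun=> TNil).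
Proof. by apply: (@pt_expr (fun=> Defs.Nil) 1). Qed.

Lemma pt_zero : pt P ctx (fun=> TNum 0%R).
Proof. by apply: (@pt_expr (fun d => Zero) 1). Qed.

(** No bound on the size of the intermediate value enters: both programs are timed in the same
    parameter [N], not in the size of what they read, and an assignment copies a tree in constant
    time. Only numbers of iterations ever have to be bounded. *)
Lemma pt_bind (J1 : Type) (P1 : nat -> J1 -> Prop) (ctx1 res1 : J1 -> tree)
    (r res : J -> tree) :
  pt P ctx r -> pt P1 ctx1 res1 ->
  (forall N j, P N j ->
    exists j1, [/\ P1 N j1, ctx1 j1 = r j & res1 j1 = res j]) ->
  pt P ctx res.
Proof.
move=> [c _ [T Tp cP]] [c1 _ [T1 T1p c1P]] hP.
exists (fun d => Seq (c d) (Seq (c1 d.+1) (Assign d.+1 (Var d.+2)))) => //.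
exists (fun N => T N + (T1 N + 2)).
  by do 2!apply: polyb_add => //; apply: polyb_const.
move=> N j d s Pj sd.
have [t [s' [ex tT s'r s'd]]] := cP N j d s Pj sd.
have [j1 [Pj1 cj1 rj1]] := hP N j Pj; rewrite -cj1 in s'r.
have [t1 [s1 [ex1 t1T s1r s1d]]] := c1P N j1 d.+1 s' Pj1 s'r.
exists (t + (t1 + 2)), (update s1 d.+1 (eval s1 (Var d.+2))); split.
- by apply: ExecSeq ex _; apply: ExecSeq ex1 _; apply: ExecAssign.
- by rewrite !leq_add.
- by rewrite updateE /= s1r.
- by move=> x xd; rewrite update_lt // s1d ?s'd // leqW.
Qed.

Lemma pt_call (J1 : Type) (P1 : nat -> J1 -> Prop) (ctx1 res1 : J1 -> tree)
    (h : J -> J1) :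
  (forall N j, P N j -> P1 N (h j)) -> pt P ctx (fun j => ctx1 (h j)) ->
  pt P1 ctx1 res1 -> pt P ctx (fun j => res1 (h j)).
Proof. by move=> hP pc p1; apply: pt_bind pc p1 _ => N j /hP; exists (h j). Qed.

Lemma pt_unop (op : expr -> expr) (o : tree -> tree) r :
  (forall s e, eval s (op e) = o (eval s e)) ->
  (forall x, etime (op (Var x)) = 2) ->
  pt P ctx r -> pt P ctx (fun j => o (r j)).
Proof.
move=> ev et [c _ [T Tp cP]].
exists (fun d => Seq (c d) (Assign d.+1 (op (Var d.+1)))) => //.
exists (fun N => T N + 3); first by apply: polyb_add => //; apply: polyb_const.
move=> N j d s Pj sd.
have [t [s' [ex tT s'r s'd]]] := cP N j d s Pj sd.
exists (t + 3), (update s' d.+1 (eval s' (op (Var d.+1)))); split.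
- apply: ExecSeq ex _.
  by have := @ExecAssign R d.+1 (op (Var d.+1)) s'; rewrite et.
- by rewrite leq_add.
- by rewrite updateE ev /= s'r.
- by move=> x xd; rewrite update_lt // s'd.
Qed.

Lemma pt_binop (op : expr -> expr -> expr) (o : tree -> tree -> tree) r1 r2 :
  (forall s e1 e2, eval s (op e1 e2) = o (eval s e1) (eval s e2)) ->
  (forall x y, etime (op (Var x) (Var y)) = 3) ->
  pt P ctx r1 -> pt P ctx r2 -> pt P ctx (fun j => o (r1 j) (r2 j)).
Proof.
move=> ev et [c1 _ [T1 T1p c1P]] [c2 _ [T2 T2p c2P]].
(* The second program runs on a copy of the input at [d.+2]; run at [d], it would overwrite the
   first result in [d.+1]. *)
exists (fun d => Seq (c1 d) (Seq (Assign d.+2 (Var d))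
   (Seq (c2 d.+2) (Assign d.+1 (op (Var d.+1) (Var d.+3)))))) => //.
exists (fun N => T1 N + (2 + (T2 N + 4))).
  apply: polyb_add => //; apply: polyb_add; first exact: polyb_const.
  by apply: polyb_add => //; apply: polyb_const.
move=> N j d s Pj sd.
have [t1 [s1 [ex1 t1T s1r s1d]]] := c1P N j d s Pj sd.
pose s2 := update s1 d.+2 (eval s1 (Var d)).
have s2d : s2 d.+2 = ctx j by rewrite /s2 updateE /= s1d // sd.
have [t3 [s3 [ex3 t3T s3r s3d]]] := c2P N j d.+2 s2 Pj s2d.
exists (t1 + (2 + (t3 + 4))),
  (update s3 d.+1 (eval s3 (op (Var d.+1) (Var d.+3)))); split.
- apply: ExecSeq ex1 _; apply: ExecSeq (ExecAssign _ _ _) _.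
  apply: ExecSeq ex3 _.
  by have := @ExecAssign R d.+1 (op (Var d.+1) (Var d.+3)) s3; rewrite et.
- by rewrite !leq_add.
- rewrite updateE ev /= s3r; congr o.
  by rewrite s3d // /s2 update_lt // s1r.
- move=> x xd; rewrite update_lt // s3d ?(leq_trans xd) //; last lia.
  by rewrite /s2 update_lt ?s1d // ltnS leqW.
Qed.

Lemma pt_cons r1 r2 :
  pt P ctx r1 -> pt P ctx r2 -> pt P ctx (fun j => TCons (r1 j) (r2 j)).
Proof. exact: (@pt_binop Defs.Cons (@TCons R)). Qed.

Lemma pt_hd r1 r2 : pt P ctx (fun j => TCons (r1 j) (r2 j)) -> pt P ctx r1.
Proof. exact: (@pt_unop Hd (fun v => if v is TCons w _ then w else TNil)). Qed.

Lemma pt_tl r1 r2 : pt P ctx (fun j => TCons (r1 j) (r2 j)) -> pt P ctx r2.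
Proof. exact: (@pt_unop Tl (fun v => if v is TCons _ w then w else TNil)). Qed.

Lemma pt_tail r :
  pt P ctx r -> pt P ctx (fun j => if r j is TCons _ w then w else TNil).
Proof. exact: (@pt_unop Tl (fun v => if v is TCons _ w then w else TNil)). Qed.

Lemma pt_head r :
  pt P ctx r -> pt P ctx (fun j => if r j is TCons w _ then w else TNil).
Proof. exact: (@pt_unop Hd (fun v => if v is TCons w _ then w else TNil)). Qed.

Lemma pt_plus (x y : J -> R) :
  pt P ctx (fun j => TNum (x j)) -> pt P ctx (fun j => TNum (y j)) ->
  pt P ctx (fun j => TNum (x j + y j)%R).
Proof.
exact: (@pt_binop Add (fun v w =>
  match v, w with TNum x, TNum y => TNum (x + y)%R | _, _ => TNil end)).
Qed.

Lemma pt_le (x y : J -> R) :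
  pt P ctx (fun j => TNum (x j)) -> pt P ctx (fun j => TNum (y j)) ->
  pt P ctx (fun j => of_bool R (x j <= y j)%R).
Proof.
exact: (@pt_binop Le (fun v w =>
  match v, w with TNum x, TNum y => of_bool R (x <= y)%R | _, _ => TNil end)).
Qed.

(** Each branch has to be correct only for the parameters that reach it, so case distinctions can be
    made on facts that the programs do not test again. *)
Lemma pt_case_truthy (b r : J -> tree) :
  pt P ctx b -> pt (fun N j => P N j /\ truthy (b j)) ctx r ->
  pt (fun N j => P N j /\ ~~ truthy (b j)) ctx r -> pt P ctx r.
Proof.
move=> [c _ [T Tp cP]] [c1 _ [T1 T1p c1P]] [c2 _ [T2 T2p c2P]].
exists (fun d => Seq (c d) (If (Var d.+1) (c1 d) (c2 d))) => //.
exists (fun N => T N + (2 + (T1 N + T2 N))).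
  by do !apply: polyb_add => //; apply: polyb_const.
move=> N j d s Pj sd.
have [t [s' [ex tT s'r s'd]]] := cP N j d s Pj sd.
have s'c : s' d = ctx j by rewrite s'd.
have [bt|bf] := boolP (truthy (b j)).
  have [t1 [s1 [ex1 t1T s1r s1d]]] := c1P N j d s' (conj Pj bt) s'c.
  exists (t + (2 + t1)), s1; split => //.
  - by apply: ExecSeq ex _; apply: ExecIfTrue ex1; rewrite /= s'r.
  - by rewrite !leq_add // (leq_trans t1T) ?leq_addr.
  - by move=> x xd; rewrite s1d ?s'd.
have [t1 [s1 [ex1 t1T s1r s1d]]] := c2P N j d s' (conj Pj bf) s'c.
exists (t + (2 + t1)), s1; split => //.
- by apply: ExecSeq ex _; apply: ExecIfFalse ex1; rewrite /= s'r.
- by rewrite !leq_add // (leq_trans t1T) ?leq_addl.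
- by move=> x xd; rewrite s1d ?s'd.
Qed.

Lemma truthy_of_bool b : truthy (of_bool R b) = b.
Proof. by case: b. Qed.

Lemma pt_case (b : J -> bool) (r : J -> tree) :
  pt P ctx (fun j => of_bool R (b j)) ->
  pt (fun N j => P N j /\ b j) ctx r ->
  pt (fun N j => P N j /\ ~~ b j) ctx r -> pt P ctx r.
Proof.
move=> pb p1 p2; apply: (pt_case_truthy pb).
  by apply: pt_restrict p1 => N j; rewrite truthy_of_bool.
by apply: pt_restrict p2 => N j; rewrite truthy_of_bool.
Qed.

Lemma pt_if (b : J -> bool) (r1 r2 : J -> tree) :
  pt P ctx (fun j => of_bool R (b j)) -> pt P ctx r1 -> pt P ctx r2 ->
  pt P ctx (fun j => if b j then r1 j else r2 j).
Proof.
move=> pb p1 p2.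
apply: (pt_case pb).
  apply: (pt_ext (r := r1)) => [N j [_ ->] //|];
  by apply: pt_restrict p1 => N j [].
apply: (pt_ext (r := r2)) => [N j [_ /negbTE->] //|];
  by apply: pt_restrict p2 => N j [].
Qed.

End Rules.

Definition elist (X : Type) (e : X -> tree) (l : seq X) : tree :=
  enc_seq [seq e x | x <- l].

Section Fold.
Variables (J : Type) (P : nat -> J -> Prop) (ctx : J -> tree).
Variables (X A : J -> Type) (eX : forall j, X j -> tree).
Variables (eA : forall j, A j -> tree) (f : forall j, A j -> X j -> A j).
Variables (a : forall j, A j) (l : forall j, seq (X j)).

(* Only states that actually occur in the fold have to be handled. *)
Definition foldP N (q : {j : J & (A j * X j)%type}) :=
  P N (tag q) /\ exists l1 l2, l (tag q) = l1 ++ (tagged q).2 :: l2 /\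
    (tagged q).1 = foldl (@f (tag q)) (a (tag q)) l1.

(** The context [ctx'] of the body is universally quantified: the body may recompute anything
    computable from [ctx] and read the current element and accumulator, without depending on how
    these three are laid out. *)
Lemma pt_foldl :
  bnd P (fun j => size (l j)) ->
  pt P ctx (fun j => elist (@eX j) (l j)) -> pt P ctx (fun j => eA (a j)) ->
  (forall ctx' : {j : J & (A j * X j)%type} -> tree,
    (forall r, pt P ctx r -> pt foldP ctx' (fun q => r (tag q))) ->
    pt foldP ctx' (fun q => eX (tagged q).2) ->
    pt foldP ctx' (fun q => eA (tagged q).1) ->
    pt foldP ctx' (fun q => eA (f (tagged q).1 (tagged q).2))) ->
  pt P ctx (fun j => eA (foldl (@f j) (a j) (l j))).
Proof.
move=> [L Lp lL] [cl _ [TL TLp clP]] [ca _ [Ta Tap caP]].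
pose ctx' (q : {j : J & (A j * X j)%type}) :=
  TCons (TCons (ctx (tag q)) (eX (tagged q).2)) (eA (tagged q).1).
have pc : pt foldP ctx' ctx' by apply: pt_ctx.
have pcx := pt_hd pc.
move=> /(_ ctx') []; [|exact: pt_tl pcx|exact: pt_tl pc|].
  move=> r pr; apply: (pt_call (h := tag)) pr; first by move=> N q [].
  exact: pt_hd pcx.
move=> cf _ [Tf Tfp cfP].
(* In the loop, [d.+1] holds the rest of the list, [d.+3] the accumulator, [d.+4] the input of the
   body and [d.+4.+1] its result. The list code is [TNil] exactly when the list is empty, so it
   serves as the loop test. *)
pose body d := Seq (Assign d.+4 (Defs.Cons (Defs.Cons (Var d) (Hd (Var d.+1)))
  (Var d.+3))) (Seq (cf d.+4) (Seq (Assign d.+3 (Var d.+4.+1))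
  (Assign d.+1 (Tl (Var d.+1))))).
exists (fun d => Seq (cl d) (Seq (Assign d.+2 (Var d)) (Seq (ca d.+2)
  (Seq (While (Var d.+1) (body d)) (Assign d.+1 (Var d.+3)))))) => //.
exists (fun N => TL N + (2 + (Ta N + ((L N * (16 + Tf N) + 2) + 2)))).
  by do !first [apply: polyb_add | apply: polyb_mul | apply: polyb_const | assumption].
move=> N j d s Pj sd.
have [t1 [s1 [ex1 t1T s1r s1d]]] := clP N j d s Pj sd.
pose s2 := update s1 d.+2 (eval s1 (Var d)).
have s2d : s2 d.+2 = ctx j by rewrite /s2 updateE /= s1d // sd.
have [t3 [s3 [ex3 t3T s3r s3d]]] := caP N j d.+2 s2 Pj s2d.
have loop l2 : forall l1 s4, l j = l1 ++ l2 ->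
  s4 d.+1 = elist (@eX j) l2 -> s4 d.+3 = eA (foldl (@f j) (a j) l1) ->
  (forall x, x <= d -> s4 x = s x) ->
  exists t5 s5, [/\ exec (While (Var d.+1) (body d)) s4 t5 s5,
   t5 <= size l2 * (16 + Tf N) + 2, s5 d.+3 = eA (foldl (@f j) (a j) (l j)) &
   forall x, x <= d -> s5 x = s x].
  elim: l2 => [|x l2 IH] l1 s4 lE s4l s4a s4s.
    exists 2, s4; split=> //; first by apply: ExecWhileFalse; rewrite /= s4l.
    by rewrite lE cats0.
  pose q : {j : J & (A j * X j)%type} := Tagged (fun j => (A j * X j)%type)
    (foldl (@f j) (a j) l1, x).
  pose s5 := update s4 d.+4 (TCons (TCons (ctx j) (eX x))
    (eA (foldl (@f j) (a j) l1))).
  have Pq : foldP N q by split=> //; exists l1, l2.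
  have s5d : s5 d.+4 = ctx' q by rewrite /s5 updateE.
  have [t6 [s6 [ex6 t6T s6r s6d]]] := cfP N q d.+4 s5 Pq s5d.
  pose s7 := update s6 d.+3 (s6 d.+4.+1).
  pose s8 := update s7 d.+1 (elist (@eX j) l2).
  have s6l : s6 d.+1 = s4 d.+1 by rewrite s6d ?/s5 ?update_lt //; lia.
  have s7l : s7 d.+1 = s4 d.+1 by rewrite /s7 update_lt.
  have [] := IH (rcons l1 x) s8.
  - by rewrite lE cat_rcons.
  - by rewrite /s8 updateE.
  - by rewrite /s8 update_neq ?/s7 ?updateE ?s6r ?foldl_rcons //; lia.
  - move=> y yd; rewrite /s8 update_lt // /s7 update_lt; last lia.
    by rewrite s6d ?/s5 ?update_lt ?s4s //; lia.
  move=> t9 [s9 [ex9 t9T s9r s9d]].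
  exists (1 + (7 + (t6 + (2 + 3))) + t9).+1, s9; split=> //; last first.
    by rewrite /= mulSn; lia.
  apply: ExecWhileTrue ex9; first by rewrite /= s4l.
  apply: ExecSeq; first exact: ExecAssign.
  rewrite /= s4s // sd s4a s4l /= -/s5.
  apply: ExecSeq ex6 _.
  apply: ExecSeq; first exact: ExecAssign.
  have := @ExecAssign R d.+1 (Tl (Var d.+1)) s7.
  by rewrite /= s7l s4l.
have s3s x : x <= d -> s3 x = s x.
  by move=> xd; rewrite s3d ?/s2 ?update_lt ?s1d //; lia.
have [] := loop (l j) [::] s3 => //.
  by rewrite s3d // /s2 update_lt.
move=> t5 [s5 [ex5 t5T s5r s5d]].
exists (t1 + (2 + (t3 + (t5 + 2)))), (update s5 d.+1 (eval s5 (Var d.+3))).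
split.
- apply: ExecSeq ex1 _; apply: ExecSeq; first exact: ExecAssign.
  by apply: ExecSeq ex3 _; apply: ExecSeq ex5 _; apply: ExecAssign.
- have : size (l j) * (16 + Tf N) <= L N * (16 + Tf N).
    by rewrite leq_mul2r lL ?orbT.
  lia.
- by rewrite updateE /= s5r.
- by move=> x xd; rewrite update_lt // s5d.
Qed.

End Fold.

Section Elements.
Variables (J : Type) (P : nat -> J -> Prop) (ctx : J -> tree).
Variables (X : J -> Type) (eX : forall j, X j -> tree).

(** Membership is expressed by splitting the list, since [X j] need not have decidable equality. *)
Definition memP (l : forall j, seq (X j)) N (q : {j : J & X j}) :=
  P N (tag q) /\ exists l1 l2, l (tag q) = l1 ++ tagged q :: l2.

(** A fold produces the images in reverse order; a second fold restores it. *)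
Lemma pt_map (l : forall j, seq (X j)) (g : forall j, X j -> tree) :
  bnd P (fun j => size (l j)) -> pt P ctx (fun j => elist (@eX j) (l j)) ->
  (forall ctx' : {j : J & X j} -> tree,
    (forall r, pt P ctx r -> pt (memP l) ctx' (fun q => r (tag q))) ->
    pt (memP l) ctx' (fun q => eX (tagged q)) ->
    pt (memP l) ctx' (fun q => g (tag q) (tagged q))) ->
  pt P ctx (fun j => elist (@g j) (l j)).
Proof.
move=> lb pl pg.
pose ctx' (q : {j : J & X j}) := TCons (ctx (tag q)) (eX (tagged q)).
have pc : pt (memP l) ctx' ctx' := pt_ctx _ _.
have {pg} pg : pt (memP l) ctx' (fun q => g (tag q) (tagged q)).
  apply: pg; last exact: pt_tl pc.
  move=> r pr; apply: (pt_call (h := tag)) pr; first by move=> N q [].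
  exact: pt_hd pc.
pose f j (acc : seq tree) (x : X j) := g j x :: acc.
have fE j k : foldl (@f j) [::] k = rev [seq g j x | x <- k].
  by elim/last_ind: k => //= k x IH; rewrite foldl_rcons IH map_rcons rev_rcons.
have pr : pt P ctx (fun j => enc_seq (rev [seq g j x | x <- l j])).
  apply: (@pt_ext _ _ _ (fun j => enc_seq (foldl (@f j) [::] (l j)))).
    by move=> N j _; rewrite fE.
  apply: (pt_foldl (A := fun=> seq tree) (eA := fun=> @enc_seq R)
    (a := fun=> [::]) lb pl (pt_nil _ _)) => c cw cx ca.
  apply: pt_cons ca.
  apply: (pt_call (h := fun q => Tagged X (tagged q).2)) pg.
    by move=> N q [Pq [l1 [l2 [lE _]]]]; split => //; exists l1, l2.
  by apply: pt_cons => //; apply: cw; apply: pt_ctx.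
pose f2 (acc : seq tree) x := x :: acc.
have f2E k : foldl f2 [::] k = rev k.
  by elim/last_ind: k => //= k x IH; rewrite foldl_rcons IH rev_rcons.
apply: (@pt_ext _ _ _
    (fun j => enc_seq (foldl f2 [::] (rev [seq g j x | x <- l j])))).
  by move=> N j _; rewrite f2E revK.
apply: (pt_foldl (A := fun=> seq tree) (eA := fun=> @enc_seq R)
  (X := fun=> tree) (f := fun=> f2) (eX := fun=> id) (a := fun=> [::])
  (l := fun j => rev [seq g j x | x <- l j])).
- by apply: bnd_le lb _ => N j _; rewrite size_rev size_map.
- by apply: pt_ext pr => N j _; rewrite /elist map_id.
- exact: pt_nil.
- by move=> c _ cx ca; apply: pt_cons.
Qed.

Lemma pt_rev (l : forall j, seq (X j)) :
  bnd P (fun j => size (l j)) -> pt P ctx (fun j => elist (@eX j) (l j)) ->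
  pt P ctx (fun j => elist (@eX j) (rev (l j))).
Proof.
move=> lb pl; pose f j (acc : seq (X j)) (x : X j) := x :: acc.
have fE j k : foldl (@f j) [::] k = rev k.
  by elim/last_ind: k => //= k x IH; rewrite foldl_rcons IH rev_rcons.
apply: (@pt_ext _ _ _ (fun j => elist (@eX j) (foldl (@f j) [::] (l j)))).
  by move=> N j _; rewrite fE.
apply: (pt_foldl (A := fun j => seq (X j)) (eA := fun j => elist (@eX j)) (f := f)
  (a := fun=> [::]) lb pl (pt_nil _ _)).
by move=> c _ cx ca; apply: pt_cons.
Qed.

Lemma pt_cat (k l : forall j, seq (X j)) :
  bnd P (fun j => size (k j)) -> pt P ctx (fun j => elist (@eX j) (k j)) ->
  pt P ctx (fun j => elist (@eX j) (l j)) ->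
  pt P ctx (fun j => elist (@eX j) (k j ++ l j)).
Proof.
move=> kb pk pl; pose f j (acc : seq (X j)) (x : X j) := x :: acc.
have fE j m n : foldl (@f j) m n = rev n ++ m.
  by elim/last_ind: n => //= n x IH; rewrite foldl_rcons IH rev_rcons.
apply: (@pt_ext _ _ _ (fun j => elist (@eX j) (foldl (@f j) (l j) (rev (k j))))).
  by move=> N j _; rewrite fE revK.
apply: (pt_foldl (A := fun j => seq (X j)) (eA := fun j => elist (@eX j)) (f := f)
  (a := l) _ (pt_rev kb pk) pl).
  by apply: bnd_le kb _ => N j _; rewrite size_rev.
by move=> c _ cx ca; apply: pt_cons.
Qed.

Lemma pt_filter (l : forall j, seq (X j)) (b : forall j, pred (X j)) :
  bnd P (fun j => size (l j)) -> pt P ctx (fun j => elist (@eX j) (l j)) ->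
  (forall ctx' : {j : J & X j} -> tree,
    (forall r, pt P ctx r -> pt (memP l) ctx' (fun q => r (tag q))) ->
    pt (memP l) ctx' (fun q => eX (tagged q)) ->
    pt (memP l) ctx' (fun q => of_bool R (b (tag q) (tagged q)))) ->
  pt P ctx (fun j => elist (@eX j) (filter (b j) (l j))).
Proof.
move=> lb pl pb.
pose ctx' (q : {j : J & X j}) := TCons (ctx (tag q)) (eX (tagged q)).
have pc : pt (memP l) ctx' ctx' := pt_ctx _ _.
have {pb} pb : pt (memP l) ctx' (fun q => of_bool R (b (tag q) (tagged q))).
  apply: pb; last exact: pt_tl pc.
  move=> r pr; apply: (pt_call (h := tag)) pr; first by move=> N q [].
  exact: pt_hd pc.
pose f j (acc : seq (X j)) (x : X j) := if b j x then x :: acc else acc.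
have fE j k : foldl (@f j) [::] k = rev (filter (b j) k).
  elim/last_ind: k => //= k x IH; rewrite foldl_rcons IH filter_rcons /f.
  by case: ifP; rewrite // rev_rcons.
apply: (@pt_ext _ _ _
    (fun j => elist (@eX j) (rev (foldl (@f j) [::] (l j))))).
  by move=> N j _; rewrite fE revK.
apply: pt_rev.
  apply: bnd_le lb _ => N j _; rewrite fE size_rev size_filter.
  exact: count_size.
apply: (pt_foldl (A := fun j => seq (X j)) (eA := fun j => elist (@eX j)) (f := f)
  (a := fun=> [::]) lb pl (pt_nil _ _)).
move=> c cw cx ca; rewrite /f.
apply: (@pt_ext _ _ _ (fun q => if b _ (tagged q).2 then
  TCons (eX (tagged q).2) (elist (@eX _) (tagged q).1)
  else elist (@eX _) (tagged q).1)).
  by move=> N q _; case: ifP.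
apply: pt_if => //; last exact: pt_cons.
apply: (pt_call (h := fun q => Tagged X (tagged q).2)) pb.
  by move=> N q [Pq [l1 [l2 [lE _]]]]; split => //; exists l1, l2.
by apply: pt_cons => //; apply: cw; apply: pt_ctx.
Qed.

End Elements.

(** Every concatenation walks through the accumulator, a prefix of the result; hence the bound on
    the length of the flattened list. *)
Lemma pt_flatten (J : Type) (P : nat -> J -> Prop) (ctx : J -> tree)
    (X : J -> Type) (eX : forall j, X j -> tree) (l : forall j, seq (seq (X j))) :
  bnd P (fun j => size (l j)) -> bnd P (fun j => size (flatten (l j))) ->
  pt P ctx (fun j => elist (elist (@eX j)) (l j)) ->
  pt P ctx (fun j => elist (@eX j) (flatten (l j))).
Proof.
move=> lb fb pl; pose f j (acc k : seq (X j)) := acc ++ k.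
have fE j k : foldl (@f j) [::] k = flatten k.
  by elim/last_ind: k => //= k x IH; rewrite foldl_rcons IH flatten_rcons.
apply: (@pt_ext _ _ _ (fun j => elist (@eX j) (foldl (@f j) [::] (l j)))).
  by move=> N j _; rewrite fE.
apply: (pt_foldl (X := fun j => seq (X j)) (eX := fun j => elist (@eX j))
  (A := fun j => seq (X j)) (eA := fun j => elist (@eX j)) (f := f)
  (a := fun=> [::]) lb pl (pt_nil _ _)).
move=> c cw cx ca; apply: (pt_cat (X := fun q => X (tag q))) => //.
apply: bnd_le (bnd_reindex (h := tag) _ fb) _; first by move=> N q [].
move=> N [j [acc x]] [/= _ [l1 [l2 [-> ->]]]].
by rewrite fE flatten_cat size_cat leq_addr.
Qed.

End Ptime.

(** * Booleans, unary arithmetic and list operations *)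

Section Unary.
Variable R : realType.
Local Open Scope nat_scope.
Local Notation tree := (tree R).

(** Counters are lists of nils, so that iterating over a number is folding over a list. This stays
    polynomial because every counter in use has a polynomial bound. *)
Definition eun (n : nat) : tree := iter n (TCons TNil) TNil.

Lemma eunE n : eun n = elist (fun=> TNil) (nseq n tt).
Proof. by elim: n => //= n ->. Qed.

Definition eopt (X : Type) (e : X -> tree) (o : option X) : tree :=
  if o is Some x then TCons (e x) TNil else TNil.

Definition epair (X Y : Type) (e : X -> tree) (f : Y -> tree) (x : X * Y) :
  tree := TCons (e x.1) (f x.2).

Section Iter.
Variables (J : Type) (P : nat -> J -> Prop) (ctx : J -> tree).
Variables (A : J -> Type) (eA : forall j, A j -> tree).
Variables (f : forall j, A j -> A j) (a : forall j, A j) (k : J -> nat).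

Definition iterP N (q : {j : J & A j}) :=
  P N (tag q) /\ exists2 i, i < k (tag q) &
    tagged q = iter i (@f (tag q)) (a (tag q)).

Lemma pt_iter :
  bnd P k -> pt P ctx (fun j => eun (k j)) -> pt P ctx (fun j => eA (a j)) ->
  (forall ctx' : {j : J & A j} -> tree,
    (forall r, pt P ctx r -> pt iterP ctx' (fun q => r (tag q))) ->
    pt iterP ctx' (fun q => eA (tagged q)) ->
    pt iterP ctx' (fun q => eA (f (tagged q)))) ->
  pt P ctx (fun j => eA (iter (k j) (@f j) (a j))).
Proof.
move=> kb pk pa pf.
pose ctx' (q : {j : J & A j}) := TCons (ctx (tag q)) (eA (tagged q)).
have pc : pt iterP ctx' ctx' := pt_ctx _ _.
have {pf} pf : pt iterP ctx' (fun q => eA (f (tagged q))).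
  apply: pf; last exact: pt_tl pc.
  move=> r pr; apply: (pt_call (h := tag)) pr; first by move=> N q [].
  exact: pt_hd pc.
pose g j (x : A j) (_ : unit) := f x.
have gE j (l : seq unit) : foldl (@g j) (a j) l = iter (size l) (@f j) (a j).
  by elim/last_ind: l => //= l x IH; rewrite foldl_rcons IH size_rcons.
apply: (@pt_ext _ _ _ _ (fun j => eA (foldl (@g j) (a j) (nseq (k j) tt)))).
  by move=> N j _; rewrite gE size_nseq.
apply: (pt_foldl (X := fun=> unit) (eX := fun j _ => TNil) (eA := eA) (f := g)
  (a := a)) => //.
- by apply: bnd_le kb _ => N j _; rewrite size_nseq.
- by apply: pt_ext pk => N j _; rewrite eunE.
move=> c cw cx ca.
apply: (pt_call (h := fun q => Tagged A (tagged q).1)) pf.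
  move=> N [j [b x]] [/= Pj [l1 [l2 [lE ->]]]]; split => //=.
  rewrite gE; exists (size l1) => //.
  by have := congr1 size lE; rewrite size_nseq size_cat /= => ->; lia.
by apply: pt_cons => //; apply: cw; apply: pt_ctx.
Qed.

End Iter.

Section Booleans.
Variables (J : Type) (P : nat -> J -> Prop) (ctx : J -> tree).
Implicit Types m n : J -> nat.

Lemma pt_true : pt P ctx (fun=> of_bool R true).
Proof. by apply: pt_cons; apply: pt_nil. Qed.

Lemma pt_false : pt P ctx (fun=> of_bool R false).
Proof. exact: pt_nil. Qed.

Lemma pt_not (b : J -> bool) :
  pt P ctx (fun j => of_bool R (b j)) -> pt P ctx (fun j => of_bool R (~~ b j)).
Proof.
move=> pb; apply: (pt_ext _ (pt_if pb pt_false pt_true)).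
by move=> N j _; case: (b j).
Qed.

Lemma pt_and (b c : J -> bool) :
  pt P ctx (fun j => of_bool R (b j)) -> pt P ctx (fun j => of_bool R (c j)) ->
  pt P ctx (fun j => of_bool R (b j && c j)).
Proof.
move=> pb pc; apply: (pt_ext _ (pt_if pb pc pt_false)).
by move=> N j _; case: (b j).
Qed.

Lemma pt_neqb (b c : J -> bool) :
  pt P ctx (fun j => of_bool R (b j)) -> pt P ctx (fun j => of_bool R (c j)) ->
  pt P ctx (fun j => of_bool R (b j != c j)).
Proof.
move=> pb pc; apply: (pt_ext _ (pt_if pb (pt_not pc) pc)).
by move=> N j _; case: (b j) (c j) => [] [].
Qed.

Lemma pt_un0 : pt P ctx (fun=> eun 0).
Proof. exact: pt_nil. Qed.

Lemma pt_unS n : pt P ctx (fun j => eun (n j)) ->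
  pt P ctx (fun j => eun (n j).+1).
Proof. by move=> pn; apply: pt_cons => //; apply: pt_nil. Qed.

Lemma pt_unP n : pt P ctx (fun j => eun (n j)) ->
  pt P ctx (fun j => eun (n j).-1).
Proof.
move=> pn; apply: (pt_ext _ (pt_tail pn)).
by move=> N j _; case: (n j).
Qed.

Lemma pt_const k : pt P ctx (fun=> eun k).
Proof. by elim: k => [|k IH]; [apply: pt_un0 | apply: pt_unS]. Qed.

End Booleans.

Section AddSub.
Variables (J : Type) (P : nat -> J -> Prop) (ctx : J -> tree).
Variables m n : J -> nat.
Hypotheses (pm : pt P ctx (fun j => eun (m j))).
Hypotheses (pn : pt P ctx (fun j => eun (n j))).

Lemma pt_pos : pt P ctx (fun j => of_bool R (0 < m j)).
Proof.
apply: (pt_case_truthy pm).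
  apply: (@pt_ext _ _ _ _ (fun=> of_bool R true)); last exact: pt_true.
  by move=> N j []; case: (m j).
apply: (@pt_ext _ _ _ _ (fun=> of_bool R false)); last exact: pt_false.
by move=> N j []; case: (m j).
Qed.

Lemma pt_addn : bnd P n -> pt P ctx (fun j => eun (m j + n j)).
Proof.
move=> nb; apply: (@pt_ext _ _ _ _ (fun j => eun (iter (n j) succn (m j)))).
  by move=> N j _; rewrite iter_succn addnC.
by apply: (pt_iter (eA := fun=> eun) nb pn pm) => c _; apply: pt_unS.
Qed.

Lemma pt_subn : bnd P n -> pt P ctx (fun j => eun (m j - n j)).
Proof.
move=> nb; apply: (@pt_ext _ _ _ _ (fun j => eun (iter (n j) predn (m j)))).
  by move=> N j _; rewrite iter_predn.
by apply: (pt_iter (eA := fun=> eun) nb pn pm) => c _; apply: pt_unP.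
Qed.
End AddSub.

Section LeqMul.
Variables (J : Type) (P : nat -> J -> Prop) (ctx : J -> tree).
Variables m n : J -> nat.
Hypotheses (pm : pt P ctx (fun j => eun (m j))).
Hypotheses (pn : pt P ctx (fun j => eun (n j))).

Lemma pt_leq : bnd P n -> pt P ctx (fun j => of_bool R (m j <= n j)).
Proof.
move=> nb; apply: (@pt_ext _ _ _ _ (fun j => of_bool R (~~ (0 < m j - n j)))).
  by move=> N j _; rewrite subn_gt0 -leqNgt.
by apply: pt_not; apply: pt_pos; apply: pt_subn.
Qed.

Lemma pt_muln : bnd P m -> bnd P n -> pt P ctx (fun j => eun (m j * n j)).
Proof.
move=> mb nb.
apply: (@pt_ext _ _ _ _ (fun j => eun (iter (m j) (fun x => x + n j) 0))).
  by move=> N j _; congr eun; elim: (m j) => //= k ->; rewrite mulSn addnC.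
apply: (pt_iter (eA := fun=> eun) (f := fun j x => x + n j) (a := fun=> 0)
  mb pm (pt_un0 _ _)) => c cw ca.
apply: pt_addn => //; first exact: (cw (fun j => eun (n j))).
by apply: (bnd_reindex _ nb) => N q [].
Qed.
End LeqMul.

Lemma pt_eqn (J : Type) (P : nat -> J -> Prop) (ctx : J -> tree)
    (m n : J -> nat) :
  bnd P m -> bnd P n ->
  pt P ctx (fun j => eun (m j)) -> pt P ctx (fun j => eun (n j)) ->
  pt P ctx (fun j => of_bool R (m j == n j)).
Proof.
move=> mb nb pm pn.
apply: (@pt_ext _ _ _ _ (fun j => of_bool R ((m j <= n j) && (n j <= m j)))).
  by move=> N j _; rewrite eqn_leq.
by apply: pt_and; apply: pt_leq.
Qed.

Lemma pt_minn (J : Type) (P : nat -> J -> Prop) (ctx : J -> tree)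
    (m n : J -> nat) :
  bnd P n ->
  pt P ctx (fun j => eun (m j)) -> pt P ctx (fun j => eun (n j)) ->
  pt P ctx (fun j => eun (minn (m j) (n j))).
Proof.
move=> nb pm pn; apply: (pt_ext _ (pt_if (pt_leq pm pn nb) pm pn)) => N j _.
by rewrite minnE; case: ifP => mn; congr eun; lia.
Qed.

Lemma pt_maxn (J : Type) (P : nat -> J -> Prop) (ctx : J -> tree)
    (m n : J -> nat) :
  bnd P n ->
  pt P ctx (fun j => eun (m j)) -> pt P ctx (fun j => eun (n j)) ->
  pt P ctx (fun j => eun (maxn (m j) (n j))).
Proof.
move=> nb pm pn; apply: (pt_ext _ (pt_if (pt_leq pm pn nb) pn pm)) => N j _.
by rewrite maxnE; case: ifP => mn; congr eun; lia.
Qed.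

(** Repeated addition replaces the product, as the language cannot multiply reals. The greedy rule
    compares such multiples instead of quotients. *)
Lemma pt_scale (J : Type) (P : nat -> J -> Prop) (ctx : J -> tree)
    (x : J -> R) (n : J -> nat) :
  bnd P n ->
  pt P ctx (fun j => TNum (x j)) -> pt P ctx (fun j => eun (n j)) ->
  pt P ctx (fun j => TNum (x j *+ n j)%R).
Proof.
move=> nb px pn.
apply: (@pt_ext _ _ _ _
    (fun j => TNum (iter (n j) (fun y => x j + y)%R 0%R))).
  by move=> N j _; congr TNum; elim: (n j) => //= k ->; rewrite mulrS.
apply: (pt_iter (eA := fun=> @TNum R) (f := fun j y => (x j + y)%R)
  (a := fun=> 0%R) nb pn (pt_zero _ _)) => c cw ca.
by apply: pt_plus => //; apply: (cw (fun j => TNum (x j))).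
Qed.

Section Lists.
Variables (J : Type) (P : nat -> J -> Prop) (ctx : J -> tree).
Variables (X : J -> Type) (eX : forall j, X j -> tree).

Lemma pt_size (l : forall j, seq (X j)) :
  bnd P (fun j => size (l j)) -> pt P ctx (fun j => elist (@eX j) (l j)) ->
  pt P ctx (fun j => eun (size (l j))).
Proof.
move=> lb pl.
apply: (@pt_ext _ _ _ _ (fun j => elist (fun=> TNil) (l j))).
  by move=> N j _; rewrite /elist; elim: (l j) => //= x k ->.
by apply: (pt_map lb pl) => c _ _; apply: pt_nil.
Qed.

Section Pred.
Variables (l : forall j, seq (X j)) (b : forall j, pred (X j)).
Hypotheses (lb : bnd P (fun j => size (l j))).
Hypotheses (pl : pt P ctx (fun j => elist (@eX j) (l j))).
Hypothesis pb : forall ctx' : {j : J & X j} -> tree,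
    (forall r, pt P ctx r -> pt (memP P l) ctx' (fun q => r (tag q))) ->
    pt (memP P l) ctx' (fun q => eX (tagged q)) ->
    pt (memP P l) ctx' (fun q => of_bool R (b (tagged q))).

Lemma pt_has : pt P ctx (fun j => of_bool R (has (@b j) (l j))).
Proof.
apply: (pt_case_truthy (pt_filter lb pl pb)).
  apply: (@pt_ext _ _ _ _ (fun=> of_bool R true)); last exact: pt_true.
  by move=> N j [_]; rewrite has_count -size_filter; case: filter.
apply: (@pt_ext _ _ _ _ (fun=> of_bool R false)); last exact: pt_false.
by move=> N j [_]; rewrite has_count -size_filter; case: filter.
Qed.

End Pred.

End Lists.

Lemma pt_count (J : Type) (P : nat -> J -> Prop) (ctx : J -> tree)
    (X : J -> Type) (eX : forall j, X j -> tree)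
    (l : forall j, seq (X j)) (b : forall j, pred (X j)) :
  bnd P (fun j => size (l j)) -> pt P ctx (fun j => elist (@eX j) (l j)) ->
  (forall ctx' : {j : J & X j} -> tree,
    (forall r, pt P ctx r -> pt (memP P l) ctx' (fun q => r (tag q))) ->
    pt (memP P l) ctx' (fun q => eX _ (tagged q)) ->
    pt (memP P l) ctx' (fun q => of_bool R (b (tag q) (tagged q)))) ->
  pt P ctx (fun j => eun (count (b j) (l j))).
Proof.
move=> lb pl pb.
apply: (@pt_ext _ _ _ _ (fun j => eun (size (filter (b j) (l j))))).
  by move=> N j _; rewrite size_filter.
apply: (pt_size (eX := eX)); last exact: pt_filter.
by apply: bnd_le lb _ => N j _; rewrite size_filter count_size.
Qed.

Section Option.
Variables (J : Type) (P : nat -> J -> Prop) (ctx : J -> tree).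
Variables (X : J -> Type) (eX : forall j, X j -> tree).
Variables (o : forall j, option (X j)) (rS : forall j, X j -> tree).
Variable (rN : J -> tree).

Definition someP N (q : {j : J & X j}) :=
  P N (tag q) /\ o (tag q) = Some (tagged q).

Lemma pt_option :
  pt P ctx (fun j => eopt (@eX j) (o j)) -> pt P ctx rN ->
  (forall ctx' : {j : J & X j} -> tree,
    (forall r, pt P ctx r -> pt someP ctx' (fun q => r (tag q))) ->
    pt someP ctx' (fun q => eX (tagged q)) ->
    pt someP ctx' (fun q => rS (tagged q))) ->
  pt P ctx (fun j => if o j is Some x then rS x else rN j).
Proof.
move=> po pN pS.
pose ctx' (q : {j : J & X j}) := TCons (ctx (tag q)) (eX (tagged q)).
have pc : pt someP ctx' ctx' := pt_ctx _ _.
have {pS} pS : pt someP ctx' (fun q => rS (tagged q)).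
  apply: pS; last exact: pt_tl pc.
  move=> r pr; apply: (pt_call (h := tag)) pr; first by move=> N q [].
  exact: pt_hd pc.
apply: (pt_case_truthy po); last first.
  apply: (@pt_ext _ _ _ _ rN).
    by move=> N j []; case: (o j).
  by apply: pt_restrict pN => N j [].
have po' : pt (fun N j => P N j /\ truthy (eopt (@eX j) (o j))) ctx
  (fun j => if eopt (@eX j) (o j) is TCons w _ then w else TNil).
  by apply: pt_restrict (pt_head po) => N j [].
apply: pt_bind (pt_cons (pt_ctx _ _) po') pS _ => N j [Pj].
case oj: (o j) => [x|] //= _; exists (Tagged X x); split=> //.
Qed.

End Option.
End Unary.

(** * Minimum spanning trees *)

Definition argmin (X : Type) (C : pred X) (le : rel X) (l : seq X) : option X :=
  foldl (fun b x => if C x then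
                      if b is Some y then if le y x then b else Some x
                      else Some x
                    else b) None l.

(** Totality and transitivity are restricted to the candidates: [cheaper], the comparison of cost
    per gain, can fail to be transitive at elements of gain 0. *)
Lemma argminP (X : eqType) (C : pred X) (le : rel X) (l : seq X) :
  {in C &, total le} -> {in C & &, transitive le} ->
  if argmin C le l is Some x then
    [/\ x \in l, C x & forall y, y \in l -> C y -> le x y]
  else forall y, y \in l -> ~~ C y.
Proof.
move=> le_tot le_tr; elim/last_ind: l => //= l x; rewrite /argmin foldl_rcons.
case: foldl => [y [yl Cy ymin]|none]; case: ifP => Cx.
- case: ifP => yx.
    split=> //; first by rewrite mem_rcons inE yl orbT.
    by move=> z; rewrite mem_rcons inE => /orP[/eqP-> //|]; apply: ymin.
  have xy : le x y by have := le_tot x y Cx Cy; rewrite yx orbF.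
  split=> //; first by rewrite mem_rcons inE eqxx.
  move=> z; rewrite mem_rcons inE => /orP[/eqP->|zl] Cz.
    by have := le_tot x x Cx Cx; rewrite orbb.
  exact: (le_tr _ _ _ Cy Cx Cz xy (ymin z zl Cz)).
- split=> //; first by rewrite mem_rcons inE yl orbT.
  by move=> z; rewrite mem_rcons inE => /orP[/eqP->|]; [rewrite Cx|apply: ymin].
- split=> //; first by rewrite mem_rcons inE eqxx.
  move=> z; rewrite mem_rcons inE => /orP[/eqP->|zl] Cz.
    by have := le_tot x x Cx Cx; rewrite orbb.
  by have := none z zl; rewrite Cz.
- by move=> z; rewrite mem_rcons inE => /orP[/eqP->|/none//]; rewrite Cx.
Qed.

Section LayerCake.
Variable R : realDomainType.

(** A sum of nonnegative numbers is the integral over u of the number of terms above u. Integrals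
    are avoided by subtracting the least positive term z of both lists from all their positive
    terms: fewer positive terms remain, and the hypothesis at level u + z becomes the one at level
    u. *)
Lemma layer_cake (a b : seq R) (k m : nat) :
  all (>= 0) a -> all (>= 0) b ->
  (forall u : R, (0 <= u)%R ->
    k * count (fun x => u < x)%R a <= m * count (fun x => u < x)%R b)%N ->
  (\sum_(x <- a) x) *+ k <= (\sum_(x <- b) x) *+ m.
Proof.
have [n] := ubnP (count (fun x => 0 < x) (a ++ b)).
elim: n a b => // n IH a b lt_n a0 b0 ab.
pose pos (x : R) := 0 < x.
have := @argminP _ pos <=%O (a ++ b) (in2W le_total) (in3W le_trans).
case: argmin => [z [zab z0 zmin]|none]; last first.
  rewrite !big_seq !big1 ?mul0rn // => x xs; apply/eqP; rewrite eq_le leNgt none.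
  - by rewrite (allP b0).
  - by rewrite mem_cat xs orbT.
  - by rewrite (allP a0).
  - by rewrite mem_cat xs.
pose sh x := if pos x then x - z else x.
have sh0 l : {subset l <= a ++ b} -> all (>= 0) l -> all (>= 0) (map sh l).
  move=> sub /allP l0; rewrite all_map; apply/allP => x xl /=.
  rewrite /sh; case: ifP => px; last by rewrite l0.
  by rewrite subr_ge0 zmin // sub.
have shS l : \sum_(x <- l) x = \sum_(x <- map sh l) x + z *+ count pos l.
  elim: l => [|x l IHl]; first by rewrite !big_nil addr0.
  rewrite /= !big_cons IHl mulrnDr /sh; case: ifP => _ /=; last first.
    by rewrite mulr0n add0r addrA.
  by rewrite mulr1n; ring.
have shC l u : 0 <= u -> {subset l <= a ++ b} ->
  count (fun x => u < x) (map sh l) = count (fun x => u + z < x) l.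
  move=> u0 sub; rewrite count_map; apply: eq_in_count => x xl /=.
  rewrite /sh; case: ifP => px; first by rewrite ltrBrDr.
  move/negbT: px; rewrite /pos -leNgt => x0.
  by rewrite !ltNge (le_trans x0) // (le_trans x0) // addr_ge0 // ltW.
have suba : {subset a <= a ++ b} by move=> x xa; rewrite mem_cat xa.
have subb : {subset b <= a ++ b} by move=> x xb; rewrite mem_cat xb orbT.
rewrite (shS a) (shS b) !mulrnDl lerD //.
  apply: IH; [|exact: sh0|exact: sh0|].
    apply: (leq_trans _ (lt_n : (_ <= n)%N)); rewrite -map_cat shC // add0r.
    have cE : count (fun x => z < x) (a ++ b) =
        count (predI (fun x => 0 < x) (fun x => z < x)) (a ++ b).
      apply: eq_count => x /=; case: (ltP z x); rewrite ?andbF ?andbT // => zx.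
      by rewrite (lt_trans z0).
    rewrite cE.
    have := count_predC (fun x => z < x) (filter (fun x => 0 < x) (a ++ b)).
    rewrite !count_filter size_filter => <-.
    rewrite (eq_count (a2 := predI (fun x => 0 < x) (fun x => z < x))); last first.
      by move=> x /=; rewrite andbC.
    rewrite -addn1 leq_add2l -has_count; apply/hasP; exists z => //=.
    by rewrite ltxx.
  move=> u u0; rewrite !shC //; apply: ab.
  by rewrite addr_ge0 // ltW.
(* The slice of height z that was cut off is the hypothesis at level 0. *)
rewrite -!mulrnA (ler_pMn2l z0).
by rewrite mulnC [X in (_ <= X)%N]mulnC ab.
Qed.

End LayerCake.

Section Prim.
Variables (V X : eqType) (s t : X -> V) (le : rel X) (r : V) (G : seq X).
Local Open Scope nat_scope.

(** Generic in the representation of the side, since sides occur as finite sets, as lists in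
    programs and as predicates. *)
Definition crosses (pT : predType V) (U : pT) (x : X) := (s x \in U) != (t x \in U).

Lemma eq_crosses (pT qT : predType V) (U : pT) (W : qT) :
  U =i W -> crosses U =1 crosses W.
Proof. by move=> UW x; rewrite /crosses !UW. Qed.

(* A tree is a list of triples (parent, child, edge), latest edge first. *)
Definition visited (st : seq (V * V * X)) := r :: [seq y.1.2 | y <- st].

Definition orient (U : seq V) (x : X) : V * V * X :=
  if s x \in U then (s x, t x, x) else (t x, s x, x).

Definition prim_step (st : seq (V * V * X)) :=
  if argmin (crosses (visited st)) le G is Some x
  then orient (visited st) x :: st else st.

Definition prim k := iter k prim_step [::].

Definition is_end (y : V * V * X) :=
  ((y.1.1 == s y.2) && (y.1.2 == t y.2)) ||
  ((y.1.1 == t y.2) && (y.1.2 == s y.2)).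

Fixpoint prim_ok (st : seq (V * V * X)) : Prop :=
  if st is y :: st' then
    [/\ y.1.1 \in visited st', y.1.2 \notin visited st', y.2 \in G, is_end y &
        forall x, x \in G -> crosses (visited st') x -> le y.2 x] /\ prim_ok st'
  else True.

Hypotheses (le_tot : total le) (le_tr : transitive le).

Lemma prim_okP k : prim_ok (prim k).
Proof.
elim: k => //= k IH; rewrite /prim_step.
have := @argminP _ (crosses (visited (prim k))) le G (in2W le_tot)
  (in3W le_tr).
rewrite -/(prim k).
case: argmin => [x [xG xU xmin]|//] /=; split=> //.
rewrite /orient /is_end; move: xU; rewrite /crosses.
case sU: (s x \in _); case tU: (t x \in _) => //= _; split=> //=;
  by rewrite ?sU ?tU ?eqxx ?orbT.
Qed.

Lemma size_prim k : size (prim k) <= k.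
Proof.
elim: k => //= k; rewrite /prim_step -/(prim k).
by case: argmin => //= [x]; lia.
Qed.

Lemma prim_saturated k :
  size (prim k) = k \/ {in G, forall x, ~~ crosses (visited (prim k)) x}.
Proof.
elim: k => [|k]; first by left.
rewrite /= -/(prim k) /prim_step.
have := @argminP _ (crosses (visited (prim k))) le G (in2W le_tot)
  (in3W le_tr).
case: argmin => [x [xG xU _]|none _]; last by right.
case=> [sz|/(_ x xG)]; first by left; rewrite /= sz.
by rewrite xU.
Qed.

Lemma uniq_visited st : prim_ok st -> uniq (visited st).
Proof.
elim: st => //= y st IH [[_ yU _ _ _] /IH].
move=> /= /andP[rs us]; move: yU.
rewrite /visited !inE !negb_or => /andP[yr ym].
by rewrite rs us ym eq_sym yr.
Qed.

Lemma ends_visited st y : prim_ok st -> y \in st ->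
  (s y.2 \in visited st) && (t y.2 \in visited st).
Proof.
have sub z st' x : x \in visited st' -> x \in visited (z :: st').
  by rewrite /visited /= !inE => /orP[->|->]; rewrite ?orbT.
elim: st => // z st IH [[uU _ _ ze _] ok]; rewrite inE => /orP[/eqP->|/(IH ok)].
  have z2 : z.1.2 \in visited (z :: st) by rewrite /visited /= !inE eqxx orbT.
  case/orP: ze => /andP[/eqP<- /eqP<-]; rewrite ?z2 ?(sub _ _ _ uU) //.
by case/andP=> *; rewrite !sub.
Qed.

(** A new edge has an end that is not yet visited, whereas both ends of all earlier edges are. *)
Lemma uniq_prim_edges st : prim_ok st -> uniq [seq y.2 | y <- st].
Proof.
elim: st => //= y st IH [[_ yU _ ye _] ok]; rewrite IH // andbT.
apply/negP => /mapP[z zs yz]; have := ends_visited ok zs; rewrite -yz.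
by case/orP: ye => /andP[_ /eqP yE]; move: yU; rewrite yE => /negbTE->;
  rewrite ?andbF.
Qed.

Lemma prim_sub st : prim_ok st -> {subset [seq y.2 | y <- st] <= G}.
Proof.
elim: st => //= y st IH [[_ _ yG _ _] ok] x; rewrite inE => /orP[/eqP-> //|].
exact: IH.
Qed.

End Prim.

(** * Weight of a minimum spanning tree against an edge set with large cuts *)

Section PrimWeight.
Variables (V : finType) (X : eqType) (s t : X -> V) (le : rel X) (r : V).
Variables (G H : seq X) (R : realDomainType) (w : X -> R) (lam : nat).
Local Open Scope nat_scope.

Hypothesis le_w : forall x y, le x y -> (w x <= w y)%R.
Hypothesis sub_HG : {subset H <= G}.
Hypothesis lam_cut : forall S : {set V}, S != set0 -> r \notin S ->
  lam <= count (crosses s t S) H.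

Section Level.
Variable u : R.
Let low (a b : V) := has (fun x => (w x <= u)%R &&
  (((s x == a) && (t x == b)) || ((s x == b) && (t x == a)))) G.
Let C (v : V) := [set y | connect low v y].

Let low_sym : symmetric low.
Proof. by move=> a b; apply: eq_has => x; rewrite [X in _ && X]orbC. Qed.

Let C_sym v y : (y \in C v) = (v \in C y).
Proof. by rewrite !inE (sym_connect_sym low_sym). Qed.

(** Prim's rule took an edge heavier than [u], so no edge of weight at most [u] leaves the visited
    set. That set is a union of components of the light graph, and the component of the new vertex
    is disjoint from it. *)
Let C_visited st y : prim_ok s t le r G (y :: st) -> (u < w y.2)%R ->
  {in visited r st, forall z, z \notin C y.1.2}.
Proof.
move=> [[_ yU _ _ ymin] ok] uy z zU; rewrite inE; apply/negP => yz.
have cl : closed low (mem (visited r st)).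
  move=> a b /hasP[x xG /andP[xu ab]].
  apply/eqP; apply/negPn/negP => abU.
  have /(ymin x xG)/le_w : crosses s t (visited r st) x.
    by rewrite /crosses; case/orP: ab => /andP[/eqP-> /eqP->] //; rewrite eq_sym.
  by rewrite leNgt (le_lt_trans xu).
by have := closed_connect cl yz; rewrite zU (negbTE yU).
Qed.

Let C_cross v x : x \in G -> crosses s t (C v) x -> (u < w x)%R.
Proof.
move=> xG; rewrite ltNge; apply: contraL => xu; apply/negPn/eqP; rewrite !inE.
have st : low (s x) (t x) by apply/hasP; exists x; rewrite // xu !eqxx.
have ts : low (t x) (s x) by rewrite low_sym.
by apply/idP/idP => /connect_trans-> //; apply: connect1.
Qed.

(** The component of a later child avoids every vertex visited earlier, in particular an earlier
    child, whose component is therefore a different one. *)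
Let C_count st a : prim_ok s t le r G st ->
  count (fun y => (u < w y.2)%R && (a \in C y.1.2)) st <= 1.
Proof.
elim: st => //= y st IH ok; have [_ ok'] := ok.
case: (boolP (_ && _)) => [/andP[uy ay]|_]; last exact: IH.
rewrite (eqP (_ : count _ st == 0)) // -leqn0 leqNgt -has_count.
apply/negP => /hasP[z zs /andP[uz az]].
have zU : z.1.2 \in visited r st by rewrite inE (map_f (fun y : V * V * X => y.1.2) zs) orbT.
have := C_visited ok uy zU; rewrite inE => /negP; apply.
by move: ay az; rewrite [a \in C z.1.2]C_sym !inE; apply: connect_trans.
Qed.

(** Contract the components of edges of weight at most [u]. Each tree edge heavier than [u] enters a
    component without the root, and at least [lam] edges of [H] leave that component. All these
    edges are heavier than [u], and by [C_count] each is counted at most once per end. *)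
Lemma prim_level st : prim_ok s t le r G st ->
  lam * count (fun y => (u < w y.2)%R) st <= 2 * count (fun x => (u < w x)%R) H.
Proof.
move=> ok.
have cnt (y : V * V * X) : (exists st1 st2, st = st2 ++ y :: st1) ->
    (u < w y.2)%R -> lam <= count (crosses s t (C y.1.2)) H.
  move=> [st1 [st2 stE]] uy; apply: lam_cut.
    by apply/set0Pn; exists y.1.2; rewrite inE connect0.
  have oky : prim_ok s t le r G (y :: st1).
    move: ok; rewrite stE; elim: st2 {stE} => //= z st2 IH [_]; exact: IH.
  by apply: (C_visited oky uy); rewrite inE eqxx.
have cnt' y : y \in st -> (u < w y.2)%R ->
    lam <= count (crosses s t (C y.1.2)) H.
  by move=> /splitPr ys; apply: cnt; case: ys => p1 p2; exists p2, p1.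
apply: (@leq_trans (\sum_(y <- st | (u < w y.2)%R)
    count (crosses s t (C y.1.2)) H)).
  rewrite mulnC -sum1_count big_distrl /= big_seq_cond [X in _ <= X]big_seq_cond.
  by apply: leq_sum => y /andP[ys uy]; rewrite mul1n cnt'.
rewrite -sum1_count big_distrr /=.
under eq_bigr do rewrite -sum1_count big_mkcond.
rewrite exchange_big /= big_seq [X in _ <= X]big_mkcond [X in _ <= X]big_seq /=.
apply: leq_sum => x xH; case: ifP => ux; last first.
  rewrite big1 // => y _; case: ifP => // /C_cross -/(_ (sub_HG xH)).
  by rewrite ux.
apply: (@leq_trans (\sum_(y <- st | (u < w y.2)%R)
   ((s x \in C y.1.2) + (t x \in C y.1.2)))).
  by apply: leq_sum => y _; rewrite /crosses; case: (_ \in _); case: (_ \in _).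
rewrite big_split /= (leq_add (n1 := 1) (n2 := 1)) //;
by rewrite -big_mkcondr sum1_count; apply: C_count.
Qed.

End Level.

(** The level inequalities are summed by [layer_cake]. In terms of linear programming, [H] divided
    by [lam] is a fractional solution of the cut relaxation, whose gap for spanning trees is at most
    2. The lemma serves both the initial tree, with [lam] = 1, and the tree packing, with [H] =
    [G]. *)
Lemma prim_weight st : prim_ok s t le r G st ->
  (forall x, 0 <= w x)%R ->
  ((\sum_(y <- st) w y.2) *+ lam <= (\sum_(x <- H) w x) *+ 2)%R.
Proof.
move=> ok w0.
rewrite -(big_map (fun y => w y.2) xpredT id) -[X in (_ <= X *+ _)%R](big_map w xpredT id).
apply: layer_cake.
- by apply/allP => _ /mapP[y _ ->].
- by apply/allP => _ /mapP[y _ ->].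
- by move=> u _; rewrite !count_map; apply: prim_level.
Qed.

End PrimWeight.

(** * Tree packings and near-minimum cuts *)

Lemma leq_expn2r (m n e : nat) : (m <= n -> m ^ e <= n ^ e)%N.
Proof. by case: e => [|e] mn; rewrite ?expn0 // leq_exp2r. Qed.

Section CutEnumeration.
Variables (V X : eqType) (s t : X -> V) (r : V).
Local Open Scope nat_scope.

(* Extends a partial side [z.1] with remaining crossing budget [z.2] to a new
   vertex, which is either on the side of its parent or, at the price of one
   crossing, on the other side. *)
Definition branch (y : V * V * X) (z : seq V * nat) : seq (seq V * nat) :=
  let far := if y.1.1 \in z.1 then z.1 else y.1.2 :: z.1 in
  let near := if y.1.1 \in z.1 then y.1.2 :: z.1 else z.1 in
  (near, z.2) :: (if 0 < z.2 then [:: (far, z.2.-1)] else [::]).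

(** The latest edge comes first in [st], so [foldr] starts from the oldest one and the parent of a
    vertex is placed before the vertex. The root is never put on the side. *)
Definition enum_cuts b (st : seq (V * V * X)) : seq (seq V * nat) :=
  foldr (fun y acc => flatten [seq branch y z | z <- acc]) [:: ([::], b)] st.

(** A partial side with budget c has potential (i+1)^c. Branching with c > 0 turns it into (i+1)^c +
    (i+1)^(c-1) = (i+2)(i+1)^(c-1), at most (i+2)^c, so each tree edge is paid by raising i by one.
    At i = 0 the potential counts the list. *)
Lemma enum_cuts_weight b st i :
  \sum_(z <- enum_cuts b st) i.+1 ^ z.2 <= (i + size st).+1 ^ b.
Proof.
elim: st i => [|y st IH] i /=; first by rewrite big_seq1 addn0.
rewrite big_flatten big_map /= addnS -addSn.
apply: leq_trans (IH i.+1); apply: leq_sum => -[S c] _.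
rewrite /branch big_cons /=; case: c => [|c]; first by rewrite big_nil.
by rewrite big_seq1 /= expnS -mulSnr expnS leq_mul2l leq_expn2r.
Qed.

Lemma size_enum_cuts b st : size (enum_cuts b st) <= (size st).+1 ^ b.
Proof.
apply: leq_trans (enum_cuts_weight b st 0); rewrite -sum1_size.
by apply: leq_sum => z _; rewrite exp1n.
Qed.

(** At each tree edge the branch that agrees with [S] is followed, which pays exactly where [S]
    crosses the tree. The exact remaining budget in the conclusion carries the induction. *)
Lemma enum_cuts_complete le G b st (S : pred V) :
  prim_ok s t le r G st -> ~~ S r ->
  count (fun y => crosses s t S y.2) st <= b ->
  exists2 z, z \in enum_cuts b st &
    z.2 = b - count (fun y => crosses s t S y.2) st /\
    z.1 =i [predI S & visited r st].
Proof.
move=> ok rS; elim: st ok => [_ _|y st IH].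
  exists ([::], b); rewrite ?inE ?eqxx //=; split; first by rewrite subn0.
  move=> v; rewrite in_nil; apply/esym/negP => /andP[/= Sv].
  by rewrite mem_seq1 => /eqP vr; move: rS; rewrite -vr => /negP; apply.
move=> [[uU vU _ ye _] ok] /= cb.
have {IH} [|[S0 b0] zin /= [b0E S0E]] := IH ok; first by move: cb; lia.
have uS0 : (y.1.1 \in S0) = S y.1.1 by rewrite S0E inE uU andbT.
have cE : crosses s t S y.2 = (S y.1.1 != S y.1.2).
  by rewrite /crosses; case/orP: ye => /andP[/eqP<- /eqP<-] //; rewrite eq_sym.
have vE v : (v \in visited r (y :: st)) = (v == y.1.2) || (v \in visited r st).
  by rewrite /visited /= !inE orbCA.
have inE' z : z \in branch y (S0, b0) -> z \in enum_cuts b (y :: st).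
  by move=> zb; apply/flattenP; exists (branch y (S0, b0)) => //; apply: map_f.
rewrite {}cE in cb *.
have [uv|uv] := eqVneq (S y.1.1) (S y.1.2); rewrite ?uv ?eqxx ?(negbTE uv) in cb *.
  exists (if y.1.1 \in S0 then y.1.2 :: S0 else S0, b0).
    by apply: inE'; rewrite inE eqxx.
  split=> //= v; rewrite uS0 inE [in RHS]/= vE uv.
  have [->|vy] := eqVneq v y.1.2; case Sv: (S y.1.2); rewrite ?inE ?eqxx ?S0E ?inE //.
  - by rewrite [_ \in S]Sv.
  - by rewrite [_ \in S]Sv.
  - by rewrite (negbTE vy).
exists (if y.1.1 \in S0 then S0 else y.1.2 :: S0, b0.-1).
  by apply: inE'; rewrite /branch /= b0E subn_gt0 cb !inE eqxx orbT.
split=> /=; first by rewrite b0E; lia.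
move=> v; rewrite uS0 inE [in RHS]/= vE.
have [->|vy] := eqVneq v y.1.2.
  move: uv; case: (S y.1.1); rewrite ?S0E ?inE ?eqxx.
    by case Sv: (S _); rewrite // [_ \in S]Sv.
  by case Sv: (S _); rewrite // [_ \in S]Sv.
by case: (S y.1.1); rewrite ?inE S0E ?inE ?(negbTE vy).
Qed.

End CutEnumeration.

(** This is (1 + 2/n)^n <= e^2 <= 16, where the last step comes from e^(-1/2) >= 1 - 1/2. The bound
    is a power of 2, so that it combines with the weights 2^load. *)
Lemma expn_add2_le (R : realType) (n : nat) :
  (0 < n -> (n + 2) ^ n <= 16 * n ^ n)%N.
Proof.
move=> n0; rewrite -(@ler_nat R) natrM !natrX natrD.
have n0' : 0 < n%:R :> R by rewrite ltr0n.
have e2 : expR (2 : R) <= 16.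
  have -> : (2 : R) = 4%:R * 2^-1 by field.
  rewrite expRM_natl; have -> : (16 : R) = 2 ^+ 4 by rewrite -natrX.
  apply: lerXn2r; rewrite ?nnegrE ?expR_ge0 //.
  rewrite -[X in X <= _]invrK -expRN invf_ple ?posrE ?expR_gt0 //.
  by apply: le_trans (expR_ge1Dx _); lra.
have -> : n%:R + 2 = n%:R * (1 + 2 / n%:R) :> R by field; lra.
rewrite exprMn [X in _ <= X]mulrC ler_wpM2l ?exprn_ge0 ?(ltW n0') //.
apply: le_trans e2.
have -> : expR (2 : R) = expR (2 / n%:R) ^+ n.
  by rewrite -expRM_natl; congr expR; field; lra.
apply: lerXn2r; rewrite ?nnegrE ?expR_ge0 ?expR_ge1Dx //.
by rewrite addr_ge0 // divr_ge0 // ltW.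
Qed.

(** * Greedy tree packing by multiplicative weights *)

Section TreePacking.
Variables (V : finType) (X : eqType) (s t : X -> V) (r : V) (G : seq X).
Variables (k : nat).
Local Open Scope nat_scope.

Definition load (ts : seq (seq (V * V * X))) x :=
  count (fun y => y.2 == x) (flatten ts).

Definition next_tree ts :=
  prim s t (fun x y => load ts x <= load ts y) r G k.

Definition trees N := iter N (fun ts => next_tree ts :: ts) [::].

Lemma size_trees N : size (trees N) = N.
Proof. by elim: N => //= N ->. Qed.

Variable lam : nat.
Hypothesis G_uniq : uniq G.
Hypothesis lam_gt0 : 0 < lam.
Hypothesis lam_cut : forall S : {set V}, S != set0 -> r \notin S ->
  lam <= count (crosses s t S) G.
Hypothesis card_V : #|V| <= k.+1.

Let leT ts : total (fun x y => load ts x <= load ts y).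
Proof. by move=> x y; apply: leq_total. Qed.

Let leTr ts : transitive (fun x y => load ts x <= load ts y).
Proof. by move=> x y z; apply: leq_trans. Qed.

(** Were [v] missing, the unvisited vertices would form a cut, crossed by some edge. So no step was
    idle, and [k] edges give [k.+1] visited vertices besides [v], more than there are. *)
Lemma prim_spanning le : total le -> transitive le ->
  forall v, v \in visited r (prim s t le r G k).
Proof.
move=> le_tot le_tr v; apply/negPn/negP => vU.
set st := prim _ _ _ _ _ _ in vU *.
have ok : prim_ok s t le r G st by apply: prim_okP.
have : lam <= count (crosses s t [set v | v \notin visited r st]) G.
  apply: lam_cut; last by rewrite !inE eqxx.
  by apply/set0Pn; exists v; rewrite inE.
move/(leq_trans lam_gt0); rewrite -has_count => /hasP[x xG].
have -> : crosses s t [set v | v \notin visited r st] x =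
  crosses s t (visited r st) x by rewrite /crosses !in_set; do 2!case: (_ \in _).
move=> xc; have [|sat] := prim_saturated s t r G le_tot le_tr k; last first.
  by have := sat x xG; rewrite xc.
rewrite -/st => szE.
have /card_uniqP cv : uniq (v :: visited r st).
  by rewrite cons_uniq vU (uniq_visited ok).
have := max_card (mem (v :: visited r st)).
by rewrite cv /= size_map szE => /leq_trans/(_ card_V); rewrite ltnn.
Qed.

(** The order is existential because each tree is grown under the loads of its own time. *)
Definition tree_ok T := (exists le, prim_ok s t le r G T) /\
  forall v, v \in visited r T.

Lemma next_tree_ok ts : tree_ok (next_tree ts).
Proof.
split; last exact: prim_spanning.
by exists (fun x y => load ts x <= load ts y); apply: prim_okP.
Qed.

Lemma trees_ok N : {in trees N, forall T, tree_ok T}.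
Proof.
elim: N => //= N IH T; rewrite inE => /orP[/eqP->|/IH//].
exact: next_tree_ok.
Qed.

Lemma size_tree_ok T : tree_ok T -> size T < #|V|.
Proof.
move=> [[le ok] _]; have /card_uniqP := uniq_visited ok.
by rewrite /= size_map => <-; apply: max_card.
Qed.

(** The potential of the multiplicative-weights argument: an edge doubles its weight each time a
    tree uses it. *)
Let W ts := \sum_(x <- G) 2 ^ load ts x.

(** A tree of minimum load is also one of minimum weight, as 2^load is monotone. By [prim_weight]
    with [H] = [G] its weight is at most 2/[lam] of the total, and this is what doubling its edges
    adds. *)
Let W_next ts : lam * W (next_tree ts :: ts) <= (lam + 2) * W ts.
Proof.
have ok : prim_ok s t (fun x y => load ts x <= load ts y) r G (next_tree ts).
  exact: prim_okP.
set T' := [seq y.2 | y <- next_tree ts].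
have uT : uniq T' := uniq_prim_edges ok.
have sT : {subset T' <= G} := prim_sub ok.
have -> : W (next_tree ts :: ts) = W ts + \sum_(x <- T') 2 ^ load ts x.
  have -> : \sum_(x <- T') 2 ^ load ts x = \sum_(x <- G | x \in T') 2 ^ load ts x.
    rewrite -[in RHS]big_filter; apply: perm_big; apply: uniq_perm => //.
      exact: filter_uniq.
    by move=> x; rewrite mem_filter andb_idr //; apply: sT.
  rewrite [X in _ = _ + X]big_mkcond -big_split; apply: eq_bigr => x _ /=.
  rewrite /load /= count_cat.
  have -> : count (fun y => y.2 == x) (next_tree ts) = (x \in T').
    by rewrite -(count_uniq_mem _ uT) count_map.
  by case: (x \in T'); rewrite ?add0n ?addn0 // add1n expnS mul2n addnn.
have : ((\sum_(y <- next_tree ts) (2 ^ load ts y.2)%:R) *+ lam <=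
        (\sum_(x <- G) (2 ^ load ts x)%:R) *+ 2 :> int)%R.
  apply: (prim_weight (w := fun x => (2 ^ load ts x)%:R%R) _ _ lam_cut ok) => //.
  by move=> x y xy; rewrite ler_nat leq_exp2l.
rewrite -!natr_sum -!mulrnA ler_nat big_map.
by rewrite -/(W ts) => ?; lia.
Qed.

Let W_trees N : lam ^ N * W (trees N) <= (lam + 2) ^ N * size G.
Proof.
elim: N => [|N IH].
  by rewrite !expn0 !mul1n /W -sum1_size; apply: leq_sum => x _.
rewrite !expnS; apply: (@leq_trans (lam ^ N * ((lam + 2) * W (trees N)))).
  by rewrite [lam * _]mulnC -mulnA leq_mul2l W_next orbT.
by rewrite mulnCA -mulnA leq_mul2l IH orbT.
Qed.

Variables (R : realType) (K : nat).
Hypothesis size_G : size G <= 2 ^ K.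
Local Notation ts := (trees (lam * K)).

(** In [lam * K] rounds a growth factor of 1 + 2/[lam] amounts to at most 16^K, and the initial
    potential [size G] is at most 2^K. *)
Let W_bound : W ts <= 2 ^ (5 * K).
Proof.
have lam0 : 0 < lam ^ (lam * K) by rewrite expn_gt0 lam_gt0.
rewrite -(leq_pmul2l lam0); apply: leq_trans (W_trees _) _.
apply: (@leq_trans ((16 * lam ^ lam) ^ K * 2 ^ K)).
  by rewrite leq_mul // expnM leq_expn2r // expn_add2_le.
have -> : 2 ^ (5 * K) = 16 ^ K * 2 ^ K by rewrite (expnM 2 5) -expnMn.
by rewrite expnMn (expnM lam lam) mulnA [_ * 16 ^ K]mulnC.
Qed.

Let cut_load (S : {set V}) N :
  \sum_(T <- trees N) count (fun y => crosses s t S y.2) T =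
  \sum_(x <- G | crosses s t S x) load (trees N) x.
Proof.
have one z : z \in G -> \sum_(x <- G | crosses s t S x) (z == x) = crosses s t S z.
  move=> zG; rewrite big_mkcond (bigD1_seq z) //= eqxx big1 ?addn0.
    by case: ifP.
  by move=> x /negbTE; rewrite eq_sym => ->; case: ifP.
have tree T : {subset [seq y.2 | y <- T] <= G} ->
  count (fun y => crosses s t S y.2) T =
  \sum_(x <- G | crosses s t S x) count (fun y => y.2 == x) T.
  elim: T => [_|y T IH sub]; first by rewrite big1.
  rewrite /= big_split /= one; last by apply: sub; rewrite /= inE eqxx.
  by rewrite IH // => x xT; apply: sub; rewrite /= inE xT orbT.
elim: N => [|N IH]; first by rewrite big_nil big1.
rewrite /= big_cons IH tree; last first.
  by have [[le /prim_sub]] := next_tree_ok (trees N).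
by rewrite -big_split; apply: eq_bigr => x _; rewrite /load /= count_cat.
Qed.

(** The linear lower bound 2^l >= 2^a (1 + l - a) without subtraction. Summed over a cut, it does
    the work of Jensen's inequality. *)
Let exp_tangent a l : 2 ^ a * l.+1 <= 2 ^ l + 2 ^ a * a.
Proof.
have [la|al] := leqP l.+1 a; first by rewrite (leq_trans _ (leq_addl _ _)) // leq_mul.
have -> : 2 ^ l = 2 ^ a * 2 ^ (l - a) by rewrite -expnD subnKC.
rewrite -mulnDr leq_mul2l; apply/orP; right.
by have := ltn_expl (l - a) (isT : 1 < 2); lia.
Qed.

(** Sum [exp_tangent] at a = 5K over the c edges of the cut. With [W_bound], the total load L
    satisfies c + L <= 1 + 5Kc, so L <= 5Kc because c >= 1, and c < 2 [lam] gives the constant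
    10. *)
Lemma small_cut_crossings (S : {set V}) :
  S != set0 -> r \notin S -> count (crosses s t S) G < 2 * lam ->
  \sum_(T <- ts) count (fun y => crosses s t S y.2) T <= 10 * (lam * K).
Proof.
move=> S0 rS Sl; rewrite cut_load.
have lc := lam_cut S0 rS.
set L := \sum_(x <- _ | _) _; set c := count _ _ in Sl lc.
have : 2 ^ (5 * K) * (c + L) <= 2 ^ (5 * K) * (1 + 5 * K * c).
  rewrite /c -sum1_count -big_split /= big_distrr /= mulnDr muln1.
  apply: (@leq_trans (\sum_(x <- G | crosses s t S x)
      (2 ^ load ts x + 2 ^ (5 * K) * (5 * K)))).
    by apply: leq_sum => x _; rewrite add1n exp_tangent.
  rewrite big_split /= leq_add //.
    apply: leq_trans W_bound; rewrite /W [X in _ <= X](bigID (crosses s t S)) /=.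
    exact: leq_addr.
  by rewrite big_const_seq iter_addn_0 -mulnA sum1_count.
rewrite leq_pmul2l ?expn_gt0 // => cL.
have : 5 * K * c <= 5 * K * (2 * lam) by rewrite leq_mul2l ltnW ?orbT.
by move: cL lc; nia.
Qed.

(* Markov's inequality. *)
Lemma small_cut_light_trees (S : {set V}) :
  S != set0 -> r \notin S -> count (crosses s t S) G < 2 * lam ->
  lam * K <= 2 * count
    (fun T => count (fun y => crosses s t S y.2) T <= 20) ts.
Proof.
move=> S0 rS Sl.
pose cr (T : seq (V * V * X)) := count (fun y => crosses s t S y.2) T.
pose light T := cr T <= 20; change (lam * K <= 2 * count light ts).
have : \sum_(T <- ts) cr T <= 10 * (lam * K) := small_cut_crossings S0 rS Sl.
have : 21 * count (predC light) ts <= \sum_(T <- ts) cr T.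
  rewrite -sum1_count big_distrr /= [X in _ <= X](bigID light) /=.
  rewrite (leq_trans _ (leq_addl _ _)) //; apply: leq_sum => T.
  by rewrite /light -ltnNge.
by have := count_predC light ts; rewrite size_trees; lia.
Qed.

(* Double counting of pairs (small cut, tree crossed at most 20 times). *)
Lemma count_small_cuts (E : eqType) (delta : seq V -> seq E)
    (D : seq (seq E)) :
  (forall U U' : seq V, U =i U' -> delta U = delta U') -> 0 < K -> uniq D ->
  (forall d, d \in D -> exists S : {set V}, [/\ S != set0, r \notin S,
    count (crosses s t S) G < 2 * lam & d = delta (enum S)]) ->
  size D <= 2 * #|V| ^ 20.
Proof.
move=> delta_eq K0 uD DP.
pose hit (d : seq E) (T : seq (V * V * X)) := d \in [seq delta z.1 | z <- enum_cuts 20 T].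
have hitP d : d \in D -> lam * K <= 2 * count (hit d) ts.
  move=> /DP[S [S0 rS Sl dE]]; apply: leq_trans (small_cut_light_trees S0 rS Sl) _.
  rewrite leq_mul2l /= -!sum1_count big_seq_cond [X in _ <= X]big_seq_cond.
  rewrite big_mkcond [X in _ <= X]big_mkcond; apply: leq_sum => T _ /=.
  case: (boolP (T \in ts)) => //= Tts; case: ifP => // light.
  suff -> : hit d T by [].
  have [[le ok] full] := trees_ok Tts.
  have [z zin [_ zS]] := enum_cuts_complete (S := mem S) ok rS light.
  apply/mapP; exists z => //; rewrite dE; apply: delta_eq => v.
  by rewrite zS mem_enum inE full andbT.
have TP T : T \in ts -> count (hit^~ T) D <= #|V| ^ 20.
  move=> /trees_ok Tok.
  apply: (@leq_trans (size [seq delta z.1 | z <- enum_cuts 20 T])).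
    rewrite -size_filter uniq_leq_size ?filter_uniq // => d.
    by rewrite mem_filter => /andP[].
  rewrite size_map (leq_trans (size_enum_cuts _ _)) // leq_expn2r //.
  exact: size_tree_ok.
have lK0 : 0 < lam * K by rewrite muln_gt0 lam_gt0.
rewrite -(leq_pmul2r lK0).
apply: (@leq_trans (\sum_(d <- D) 2 * count (hit d) ts)).
  rewrite -sum1_size big_distrl /= big_seq [X in _ <= X]big_seq.
  by apply: leq_sum => d dD; rewrite mul1n hitP.
rewrite -big_distrr /= -mulnA leq_mul2l /=.
under eq_bigr do rewrite -sum1_count big_mkcond.
rewrite exchange_big /= -[X in _ <= _ * X](size_trees (lam * K)).
rewrite -sum1_size big_distrr /= big_seq [X in _ <= X]big_seq.
apply: leq_sum => T Tts; rewrite muln1 -big_mkcond sum1_count.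
exact: TP.
Qed.

End TreePacking.

(** * Greedy multicover *)

Section Greedy.
Variables (R : realFieldType) (E : finType) (c : E -> R) (D : seq (seq E)).
Variable T : nat.
Implicit Types (F d : seq E) (e : E).

Definition unsat F d := (count [in F] d < T)%N.
Definition gain F e := count (fun d => (e \in d) && unsat F d) D.
Definition candidate F e := (e \notin F) && (0 < gain F e)%N.
Definition cheaper F e f := c e *+ gain F f <= c f *+ gain F e.
Definition greedy_step F :=
  if argmin (candidate F) (cheaper F) (enum E) is Some e then e :: F else F.
Definition greedy k F := iter k greedy_step F.

Definition harmonic n : R := \sum_(i < n) i.+1%:R^-1.

Lemma harmonic_ge n : (0 < n)%N -> 1 <= harmonic n.
Proof.
case: n => // n _; rewrite /harmonic big_ord_recl /= invr1 lerDl sumr_ge0 // => i _.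
by rewrite invr_ge0.
Qed.

Lemma harmonic_le m n : (m <= n)%N -> harmonic m <= harmonic n.
Proof.
move=> /subnK <-; elim: (n - m)%N => // k IH.
by rewrite addSn /harmonic big_ord_recr /= (le_trans IH) // lerDl invr_ge0.
Qed.

(** Each of the [n - m] terms in the difference is at least 1/n. *)
Lemma harmonic_diff m n : (m <= n)%N ->
  (n - m)%:R / n%:R <= harmonic n - harmonic m.
Proof.
elim: n => [|n IH]; first by rewrite leqn0 => /eqP ->; rewrite mul0r subrr.
rewrite leq_eqVlt => /orP[/eqP->|]; first by rewrite subnn mul0r subrr.
rewrite ltnS => mn; rewrite {1}/harmonic big_ord_recr /= -/(harmonic n).
rewrite subSn // -natr1 mulrDl mul1r addrAC lerD2r.
apply: le_trans (IH mn); case: n {IH} mn => [|n] mn.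
  by rewrite sub0n !mul0r.
by rewrite ler_wpM2l // lef_pV2 ?posrE ?ltr0n // ler_nat.
Qed.

Hypothesis c_ge0 : forall e, 0 <= c e.

Lemma cheaper_total F : {in candidate F &, total (cheaper F)}.
Proof. by move=> e f _ _; rewrite /cheaper le_total. Qed.

Lemma cheaper_trans F : {in candidate F & &, transitive (cheaper F)}.
Proof.
move=> f e g /andP[_ f0] /andP[_ e0] /andP[_ g0]; rewrite /cheaper => ef fg.
have f0' : 0 < (gain F f)%:R :> R by rewrite ltr0n.
rewrite -(ler_pM2r f0') !mulr_natr mulrnAC.
apply: (@le_trans _ _ (c f *+ gain F e *+ gain F g)).
  by rewrite lerMn2r ef orbT.
by rewrite mulrnAC [X in _ <= X]mulrnAC lerMn2r fg orbT.
Qed.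

Lemma greedy_argminP F :
  if argmin (candidate F) (cheaper F) (enum E) is Some g then
    candidate F g /\ forall e, candidate F e -> cheaper F g e
  else forall e, ~~ candidate F e.
Proof.
have := argminP (enum E) (@cheaper_total F) (@cheaper_trans F).
case: argmin => [g [_ Cg gmin]|none] => [|e].
  by split=> // e Ce; apply: gmin; rewrite ?mem_enum.
by apply: none; rewrite mem_enum.
Qed.

Lemma greedy_sub k F : {subset F <= greedy k F}.
Proof.
elim: k => //= k IH e /IH eF; rewrite /greedy_step -/(greedy k F).
by case: argmin => // g; rewrite inE eF orbT.
Qed.

Lemma greedy_uniq k F : uniq F -> uniq (greedy k F).
Proof.
move=> uF; elim: k => //= k IH; rewrite /greedy_step -/(greedy k F).
have := greedy_argminP (greedy k F).
by case: argmin => //= g [/andP[-> _] _].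
Qed.

Lemma size_greedy k F : (size (greedy k F) <= k + size F)%N.
Proof.
elim: k => //= k IH; rewrite /greedy_step -/(greedy k F).
by case: argmin => [g|] /=; lia.
Qed.

Lemma greedy_saturated k F : uniq F -> (#|E| <= k)%N ->
  forall e, ~~ candidate (greedy k F) e.
Proof.
move=> uF Ek.
have sat m : size (greedy m F) = (m + size F)%N \/
    forall e, ~~ candidate (greedy m F) e.
  elim: m => [|m]; first by left.
  rewrite /= /greedy_step -/(greedy m F).
  have := greedy_argminP (greedy m F).
  case: argmin => [g [Cg _]|none _]; last by right.
  by case=> [sz|/(_ g)]; [left; rewrite /= sz | rewrite Cg].
have [sz|//] := sat k; move=> e; apply/negP => /andP[eF _].
have /card_uniqP : uniq (e :: greedy k F) by rewrite /= eF greedy_uniq.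
move=> ce; have := max_card (mem (e :: greedy k F)); rewrite ce /= sz => lt.
by have := leq_trans lt Ek; lia.
Qed.

Hypothesis D_uniq : {in D, forall d, uniq d}.

Lemma greedy_sat k F : uniq F -> (#|E| <= k)%N ->
  {in D, forall d, T <= size d}%N -> {in D, forall d, ~~ unsat (greedy k F) d}.
Proof.
move=> uF Ek DT d dD; apply/negP => un.
have : (0 < count (predC [in greedy k F]) d)%N.
  rewrite -(ltn_add2l (count [in greedy k F] d)) addn0 count_predC.
  exact: leq_trans un (DT d dD).
rewrite -has_count => /hasP[e ed /= eF].
have := greedy_saturated uF Ek e; rewrite /candidate eF -has_count.
by move/negP; apply; apply/hasP; exists d; rewrite // ed.
Qed.

Let cost F := \sum_(e <- F) c e.

Let count_cons F g d : uniq d -> g \notin F ->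
  count [in g :: F] d = (count [in F] d + (g \in d))%N.
Proof.
move=> ud gF; rewrite -(count_uniq_mem _ ud) -count_predUI.
rewrite [X in (_ + X)%N](_ : _ = 0%N); last first.
  apply/eqP; rewrite -leqn0 leqNgt -has_count; apply/negP => /hasP[x _ /=].
  by move=> /andP[xF /eqP xg]; rewrite -xg xF in gF.
by rewrite addn0; apply: eq_count => x; rewrite /= !inE orbC.
Qed.

(* Dual fitting: [al d] is the price at which the last unit of [d] is covered,
   and [be e] corrects for picking [e] only once. Prices only increase, which is
   what the last clause records. *)
Lemma greedy_dual k F :
  {in D, forall d, ~~ unsat (greedy k F) d} ->
  exists (al : seq E -> R) (be : E -> R),
  [/\ (forall d, 0 <= al d) /\ (forall e, 0 <= be e),
      cost (greedy k F) - cost F =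
        \sum_(d <- D) al d *+ (T - count [in F] d) - \sum_(e | e \notin F) be e,
      forall e, e \notin F -> \sum_(d <- D | (e \in d) && unsat F d) al d <=
        be e + c e * harmonic (gain F e) &
      forall u, (forall e, e \notin F -> u *+ gain F e <= c e) ->
        {in D, forall d, unsat F d -> u <= al d}].
Proof.
elim: k F => [|k IH] F sat.
  exists (fun=> 0), (fun=> 0); split=> //.
  - by rewrite subrr !big1 ?subr0 // => d _; rewrite mul0rn.
  - move=> e _; rewrite big1 // add0r mulr_ge0 // /harmonic sumr_ge0 // => i _.
    by rewrite invr_ge0.
  - by move=> u _ d /sat /negbTE /= ->.
move: sat; rewrite /greedy iterSr -/(greedy k _) /greedy_step.
have := greedy_argminP F; case: argmin => [g [Cg gmin]|_]; last exact: IH.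
move=> /IH[al' [be' [[al0 be0] cE le3 le4]]].
have /andP[gF g0] := Cg.
set F' := g :: F in al' be' al0 be0 cE le3 le4 *.
have cntE d : d \in D -> count [in F'] d = (count [in F] d + (g \in d))%N.
  by move=> dD; apply: count_cons => //; apply: D_uniq.
have unsatW d : d \in D -> unsat F' d -> unsat F d.
  by move=> dD; rewrite /unsat cntE //; lia.
have gainW e : (gain F' e <= gain F e)%N.
  rewrite /gain -!sum1_count big_seq_cond [X in (_ <= X)%N]big_seq_cond.
  rewrite big_mkcond [X in (_ <= X)%N]big_mkcond leq_sum // => d _.
  case: ifP => // /andP[dD /andP[ed un]].
  by rewrite dD ed unsatW.
have g0' : 0 < (gain F g)%:R :> R by rewrite ltr0n.
(* The cost of [g], shared equally among the units of demand that it covers. *)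
pose pr := c g / (gain F g)%:R.
have pr0 : 0 <= pr by rewrite divr_ge0.
have prg : pr *+ gain F g = c g by rewrite -mulr_natr divfK // gt_eqF.
have prP e : e \notin F -> pr *+ gain F e <= c e.
  move=> eF; have [->|e0] := posnP (gain F e); first by rewrite mulr0n.
  have := gmin e; rewrite /candidate eF e0 => /(_ isT); rewrite /cheaper.
  by rewrite -[c g]prg mulrnAC lerMn2r eqn0Ngt g0.
(* The last clause of the induction hypothesis applies to [pr], because gains only shrink after [g]
   is taken. *)
have al'P : {in D, forall d, unsat F' d -> pr <= al' d}.
  apply: le4 => e; rewrite inE negb_or => /andP[_ eF].
  by apply: le_trans (prP e eF); rewrite ler_wpMn2l.
(* A set finished by [g] gets the price of [g]. So does a set already satisfied in [F], but there
   the multiplier [T - count [in F] d] is 0. *)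
pose al d := if unsat F' d then al' d else pr.
(* Sets that [g] serves but does not finish end with a price of at least [pr]; [be g] absorbs the
   excess of their prices over the cost of [g]. *)
pose be e := if e == g then \sum_(d <- D | (g \in d) && unsat F d) al d - c g
             else be' e.
have alP : {in D, forall d, pr <= al d}.
  by move=> d dD; rewrite /al; case: ifP => // /al'P ->.
have beg : be g = \sum_(d <- D | (g \in d) && unsat F d) al d - c g.
  by rewrite /be eqxx.
exists al, be; split.
- split=> [d|e]; first by rewrite /al; case: ifP.
  rewrite /be; case: eqP => // _; rewrite subr_ge0 -prg /gain -sum1_count.
  rewrite -sumrMnr big_seq_cond [X in _ <= X]big_seq_cond.
  by apply: ler_sum => d /andP[dD _]; rewrite mulr1n alP.
- have -> : cost (greedy k F') - cost F = cost (greedy k F') - cost F' + c g.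
    by rewrite /cost /F' big_cons; ring.
  rewrite cE [\sum_(e | e \notin F) be e](bigD1 g) //= beg.
  have -> : \sum_(e | (e \notin F) && (e != g)) be e = \sum_(e | e \notin F') be' e.
    apply: eq_big => [e|e /andP[_ /negbTE]]; first by rewrite inE negb_or andbC.
    by rewrite /be => ->.
  have -> : \sum_(d <- D) al d *+ (T - count [in F] d) =
    \sum_(d <- D) al' d *+ (T - count [in F'] d) +
    \sum_(d <- D | (g \in d) && unsat F d) al d.
    rewrite [X in _ = _ + X]big_mkcond -big_split big_seq [RHS]big_seq.
    apply: eq_bigr => d dD /=; rewrite cntE // /al /unsat cntE //.
    move: (count [in F] d) => n.
    case: (g \in d) => /=; last first.
      rewrite addn0 addr0; case: ltnP => // Tn.
      by rewrite (eqP Tn) !mulr0n.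
    rewrite addn1; case: (ltnP n T) => nT; last first.
      by rewrite (eqP nT) (eqP (leqW nT)) !mulr0n addr0.
    case: ltnP => nT'; first by rewrite -mulrSr; congr (_ *+ _); lia.
    have -> : T = n.+1 by lia.
    by rewrite subSnn subnn mulr0n add0r.
  ring.
- move=> e eF; have [->|eg] := eqVneq e g.
    rewrite beg -subr_ge0.
    have -> : \sum_(d <- D | (g \in d) && unsat F d) al d - c g +
      c g * harmonic (gain F g) - \sum_(d <- D | (g \in d) && unsat F d) al d
      = c g * (harmonic (gain F g) - 1) by ring.
    by rewrite mulr_ge0 // subr_ge0 harmonic_ge.
  have eF' : e \notin F' by rewrite inE negb_or eg.
  (* The sets through [e] finished by [g] number [gain F e - gain F' e], each at price [pr], which
     is at most [c e] divided by [gain F e]. By [harmonic_diff] the drop of the harmonic number pays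
     for them. *)
  have sumE : \sum_(d <- D | (e \in d) && unsat F d) al d =
    \sum_(d <- D | (e \in d) && unsat F' d) al' d +
    pr *+ (gain F e - gain F' e).
    rewrite mulrnBr ?gainW // /gain -!sum1_count -!sumrMnr.
    rewrite !(big_mkcond (fun d => _ && _)) /= -sumrB -big_split /=.
    rewrite big_seq [RHS]big_seq; apply: eq_bigr => d dD.
    case: (e \in d) => /=; last by rewrite subrr addr0.
    rewrite /al; case: ifP => un.
      by case: ifP => un'; rewrite ?subrr ?addr0 ?subr0 ?add0r ?mulr1n.
    case: ifP => un'; last by rewrite subrr addr0.
    by rewrite unsatW in un.
  rewrite sumE /be (negbTE eg).
  have := le3 e eF'; have := harmonic_diff (gainW e); move: (prP e eF).
  have [e0|e0] := posnP (gain F e).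
    have /eqP -> : gain F' e == 0%N by rewrite -leqn0 -e0 gainW.
    by rewrite e0 subn0 !mulr0n addr0.
  have e0' : 0 < (gain F e)%:R :> R by rewrite ltr0n.
  move: (_ - _)%N => m; rewrite -[pr *+ gain F e]mulr_natr -[pr *+ m]mulr_natr.
  rewrite -ler_pdivlMr // => prle hle; rewrite -subr_ge0 in hle.
  move=> /le_trans; set S := \sum_(d <- D | _) _.
  have : pr * m%:R <= c e / (gain F e)%:R * m%:R by rewrite ler_wpM2r.
  have := mulr_ge0 (c_ge0 e) hle.
  set h1 := harmonic _; set h2 := harmonic _; set x := _ / _%:R.
  have -> : c e / (gain F e)%:R * m%:R = c e * x by rewrite /x; ring.
  move=> q1 q2 /(_ (be' e + c e * h2) (lexx _)).
  by move: q1 q2; rewrite !mulrBr; lra.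
- move=> u uP d dD un; rewrite /al; case: ifP => un'; last first.
    by rewrite ler_pdivlMr // mulr_natr uP.
  apply: le4 un' => // e; rewrite inE negb_or => /andP[_ eF].
  (* A negative [u] is treated separately, since multiplying it by a smaller gain makes the product
     larger. *)
  have [u0|u0] := leP 0 u; first by apply: le_trans (uP e eF); rewrite ler_wpMn2l.
  by apply: le_trans (c_ge0 e); rewrite -mulr_natr mulr_le0_ge0 // ltW.
Qed.

(** Here [th] times the edges of [Fs] outside [F] covers the residual demands fractionally.
    Weighting the demands by the prices and exchanging sums bounds their total by [th] times the sum
    of [be e + c e * harmonic (size D)] over these edges. As [th] <= 1, the [be] part is cancelled
    by the negative sum in [greedy_dual]. *)
Lemma greedy_cost k F (Fs : {set E}) (th : R) :
  {in D, forall d, ~~ unsat (greedy k F) d} -> 0 <= th <= 1 ->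
  {in D, forall d, unsat F d -> (T - count [in F] d)%:R <=
     th * (count (fun e => (e \in Fs) && (e \notin F)) d)%:R} ->
  \sum_(e <- greedy k F) c e <=
  \sum_(e <- F) c e + th * harmonic (size D) * \sum_(e in Fs) c e.
Proof.
move=> sat /andP[th0 th1] frac.
have [al [be [[al0 be0] cE le3 _]]] := greedy_dual sat.
rewrite -lerBlDl -/(cost F) -/(cost (greedy k F)) cE lerBlDr.
pose A e := (e \in Fs) && (e \notin F).
apply: (@le_trans _ _ (th * \sum_(e | A e)
    \sum_(d <- D | (e \in d) && unsat F d) al d)).
  rewrite mulr_sumr.
  under [X in _ <= X]eq_bigr do rewrite mulr_sumr big_mkcond.
  rewrite exchange_big /= big_seq [X in _ <= X]big_seq; apply: ler_sum => d dD.
  have [un|un] := boolP (unsat F d); last first.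
    move: un; rewrite /unsat -leqNgt => /eqP ->; rewrite mulr0n sumr_ge0 // => e _.
    by rewrite andbF.
  rewrite -mulr_natr; apply: le_trans (ler_wpM2l (al0 d) (frac d dD un)) _.
  rewrite mulrA [al d * th]mulrC.
  have -> : (count A d)%:R = \sum_(e | A e) ((e \in d)%:R : R).
    have -> : count A d = (\sum_(e | A e) (e \in d))%N.
      rewrite -sum1_count -big_filter.
      rewrite (perm_big (enum [pred e | A e && (e \in d)])); last first.
        apply: uniq_perm; [exact/filter_uniq/D_uniq | exact: enum_uniq |].
        by move=> e; rewrite mem_filter mem_enum !inE.
      transitivity (\sum_(e | A e && (e \in d)) 1)%N; first by rewrite big_enum.
      rewrite big_mkcond [RHS]big_mkcond; apply: eq_bigr => e _.
      by case: (A e); case: (_ \in _).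
    by rewrite natr_sum.
  rewrite mulr_sumr; apply: ler_sum => e _; rewrite andbT.
  by case: (e \in d); rewrite ?mulr1 ?mulr0.
apply: (@le_trans _ _ (th * \sum_(e | A e)
    (be e + c e * harmonic (size D)))).
  rewrite ler_wpM2l //; apply: ler_sum => e /andP[_ eF].
  apply: le_trans (le3 e eF) _; rewrite lerD2l ler_wpM2l //.
  by apply: harmonic_le; apply: count_size.
rewrite big_split /= mulrDr [X in _ <= X]addrC lerD //.
  apply: (@le_trans _ _ (\sum_(e | A e) be e)).
    by rewrite ler_piMl // sumr_ge0.
  rewrite [X in _ <= X](bigID [in Fs]) /= -[X in X <= _]addr0 lerD //.
    by rewrite le_eqVlt; apply/orP; left; apply/eqP; apply: eq_bigl => e; rewrite andbC.
  exact: sumr_ge0.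
have H0 : 0 <= harmonic (size D) by rewrite sumr_ge0 // => i _; rewrite invr_ge0.
rewrite -mulr_suml mulrA mulrAC ler_wpM2l ?mulr_ge0 //.
by rewrite [X in _ <= X](bigID (fun e => e \notin F)) /= lerDl sumr_ge0.
Qed.

End Greedy.

(** * The algorithm *)

Section Algorithm.
Variables (R : realType) (V E : finType) (src dst : E -> V) (safe : pred E).
Variables (cost : E -> R) (r : V) (p : nat).
Implicit Types (F d : seq E) (S : {set V}).

(** Listed in the order of [enum E], a cut has only one representation, so duplicates can be removed
    by comparing lists. *)
Definition delta (U : seq V) : seq E := [seq e <- enum E | crosses src dst U e].

Definition mult (T0 : nat) e := if safe e then maxn T0 p else p.

Definition copies (T0 : nat) F : seq (E * nat) :=
  flatten [seq [seq (e, i) | i <- iota 0 (mult T0 e)] | e <- F].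

(** The number of trees is [lam * K] for [lam] = p T0 and K = [size (copies T0 F)]. A logarithm of
    the size would do for K; the size itself needs no computation of logarithms and is still
    polynomial. [#|E|] Prim steps suffice by [card_vertices]. *)
Definition forest (T0 : nat) F :=
  trees (fun x : E * nat => src x.1) (fun x => dst x.1) r (copies T0 F) #|E|
    (p * T0 * size (copies T0 F)).

Definition all_cuts (T0 : nat) F : seq (seq E) :=
  flatten [seq [seq delta z.1 | z <- enum_cuts 20 st] | st <- forest T0 F].

(** The condition [0 < size d] discards the empty side, which the branching also lists and which no
    edge can repair. *)
Definition deficient (T : nat) F d :=
  [&& 0 < size d, count [pred e | (e \in F) && safe e] d < p
    & count [in F] d < T]%N.

Definition cuts (T0 T : nat) F : seq (seq E) :=
  undup [seq d <- all_cuts T0 F | deficient T F d].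

Definition phase (T0 T : nat) F := greedy cost (cuts T0 T F) T #|E| F.

Definition next_target (T0 : nat) :=
  (if T0 < p then minn (2 * T0) p else T0.+1)%N.

Definition round (Q : nat) (x : nat * seq E) :=
  if (x.1 < Q)%N then (next_target x.1, phase x.1 (next_target x.1) x.2) else x.

Definition mst : seq E :=
  [seq y.2 | y <- prim src dst (fun e f => cost e <= cost f) r (enum E) #|E|].

(** A round before the target is reached raises it by at least 1, and later rounds change nothing,
    so a fixed number of [Q] rounds suffices. *)
Definition algorithm (Q : nat) := (iter Q (round Q) (1%N, mst)).2.

Lemma eq_delta (U W : seq V) : U =i W -> delta U = delta W.
Proof. by move=> UW; apply: eq_filter; apply: eq_crosses. Qed.

Lemma delta_uniq U : uniq (delta U).
Proof. by rewrite filter_uniq ?enum_uniq. Qed.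

Lemma mem_delta S e : (e \in delta (enum S)) = crosses src dst S e.
Proof.
by rewrite mem_filter mem_enum andbT; apply: eq_crosses => v; rewrite mem_enum.
Qed.

Lemma count_delta F S (a : pred E) : uniq F ->
  count [pred e | (e \in F) && a e] (delta (enum S)) =
  count [pred e | crosses src dst S e && a e] F.
Proof.
move=> uF; rewrite -!size_filter; apply: perm_size; apply: uniq_perm.
- by rewrite filter_uniq ?delta_uniq.
- by rewrite filter_uniq.
- move=> e; rewrite mem_filter mem_delta mem_filter /=.
  by case: (e \in F); case: (a e); case: crosses.
Qed.

Lemma count_deltaT F S : uniq F ->
  count [in F] (delta (enum S)) = count (crosses src dst S) F.
Proof.
move=> uF; have := count_delta S predT uF.
rewrite (eq_count (a2 := [in F])) => [->|e]; last by rewrite /= andbT.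
by apply: eq_count => e; rewrite /= andbT.
Qed.

Definition sdeg F S := count [pred e | (e \in F) && safe e] (delta (enum S)).
Definition deg F S := count [in F] (delta (enum S)).

(** Each cut is represented by its side without the root. *)
Definition good (T : nat) F :=
  forall S, S != set0 -> r \notin S -> (p <= sdeg F S \/ T <= deg F S)%N.

Lemma sdeg_le F S : (sdeg F S <= deg F S)%N.
Proof. by apply: sub_count => e /andP[]. Qed.

Lemma deg_sub F F' S : {subset F <= F'} -> (deg F S <= deg F' S)%N.
Proof. by move=> FF'; apply: sub_count => e /FF'. Qed.

Lemma sdeg_sub F F' S : {subset F <= F'} -> (sdeg F S <= sdeg F' S)%N.
Proof.
move=> FF'; apply: sub_count => e /= /andP[/FF' eF' es].
by rewrite eF' es.
Qed.

Section Copies.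
Local Open Scope nat_scope.
Let s (x : E * nat) := src x.1.
Let t (x : E * nat) := dst x.1.

Lemma copies_uniq T0 F : uniq F -> uniq (copies T0 F).
Proof.
move=> uF; apply: (allpairs_uniq_dep (t := fun e => iota 0 (mult T0 e))) => //.
  by move=> e _; apply: iota_uniq.
by move=> [e i] [e' i'] _ _ [-> ->].
Qed.

Lemma count_copies T0 F S : uniq F -> count (crosses s t S) (copies T0 F) =
  p * deg F S + (maxn T0 p - p) * sdeg F S.
Proof.
move=> uF; rewrite /deg count_deltaT // /sdeg count_delta //.
rewrite /copies count_flatten -map_comp.
elim: F {uF} => [|e F IH] /=; first by rewrite !muln0.
rewrite IH count_map /preim /=.
have -> : count (fun i => crosses s t S (e, i)) (iota 0 (mult T0 e)) =
    crosses src dst S e * mult T0 e.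
  rewrite (eq_count (a2 := fun=> crosses src dst S e)) //.
  by case: crosses; rewrite ?count_predT ?size_iota ?mul1n // count_pred0.
rewrite /mult; case: crosses; case: (safe e) => /=;
  have := leq_maxr T0 p; nia.
Qed.

End Copies.

(** If no tree edge crossed, being outside [S] would pass from the root along the tree to every
    vertex. *)
Lemma tree_crosses (X : eqType) (s t : X -> V) le (G : seq X) st S :
  prim_ok s t le r G st -> (forall v, v \in visited r st) ->
  S != set0 -> r \notin S -> has (fun y => crosses s t S y.2) st.
Proof.
move=> ok full /set0Pn[v vS] rS; apply/negPn/negP => nc.
suff : v \notin S by rewrite vS.
move: (full v); move: v {vS full}; elim: st ok nc => [_ _ v|y st IH].
  by rewrite inE => /eqP->.
move=> [[uU _ _ ye _] ok]; rewrite /= negb_or => /andP[yc nc] v.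
rewrite /visited /= !inE orbCA => /orP[/eqP->|vU]; last exact: IH.
have uS : y.1.1 \notin S by apply: IH.
move: yc; rewrite /crosses negbK => /eqP.
by case/orP: ye => /andP[/eqP<- /eqP<-] sE; rewrite ?sE // -?sE in uS *.
Qed.

Lemma enum_cuts_root (X : eqType) (s t : X -> V) le (G : seq X) b st :
  prim_ok s t le r G st -> {in enum_cuts b st, forall z, r \notin z.1}.
Proof.
elim: st => [_ z|y st IH [[_ vU _ _ _] ok] z].
  by rewrite inE => /eqP->.
have yr : r != y.1.2.
  by apply: contraNneq vU => <-; rewrite inE eqxx.
case/flattenP => l /mapP[[S0 b0] /(IH ok) /= rS0 ->].
rewrite /branch inE => /orP[/eqP->|].
  by case: ifP => /=; rewrite ?inE ?negb_or ?yr.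
by case: ifP => //; rewrite mem_seq1 => _ /eqP-> /=; case: ifP;
  rewrite ?inE ?negb_or ?yr.
Qed.

(** * Analysis against a fixed feasible edge set *)

Section Competitor.
Variables (Q : nat) (Fs : {set E}).
Hypothesis p_gt0 : (0 < p)%N.
Hypothesis p_leQ : (p <= Q)%N.
Hypothesis cost_ge0 : forall e, 0 <= cost e.
Hypothesis Fs_good : good Q (enum Fs).

Local Notation opt := (\sum_(e in Fs) cost e).

Let cutE S : S != set0 -> r \notin S ->
  (1 <= count (crosses src dst S) (enum Fs))%N.
Proof.
move=> S0 rS; rewrite -count_deltaT ?enum_uniq // -/(deg _ _).
have := sdeg_le (enum Fs) S.
by case: (Fs_good S0 rS); move: p_gt0 p_leQ; lia.
Qed.

Let cutET S : S != set0 -> r \notin S ->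
  (1 <= count (crosses src dst S) (enum E))%N.
Proof.
move=> S0 rS; have := cutE S0 rS; rewrite -!has_count => /hasP[e _ ec].
by apply/hasP; exists e; rewrite ?mem_enum.
Qed.

Let cheap_total : total (fun e f => cost e <= cost f).
Proof. by move=> e f; apply: le_total. Qed.

Let cheap_trans : transitive (fun e f => cost e <= cost f).
Proof. by move=> e f g; apply: le_trans. Qed.

(** The edges of a spanning tree are distinct. This makes [#|E|] an admissible number of Prim steps
    and, later, bounds the number of vertices by the input length. *)
Lemma card_vertices : (#|V| <= #|E|.+1)%N.
Proof.
pose st := prim src dst (fun e f => cost e <= cost f) r (enum E) #|V|.
have ok := @prim_okP V E src dst (fun e f => cost e <= cost f) r (enum E)
  cheap_total cheap_trans #|V|.
have full := @prim_spanning V E src dst r (enum E) #|V| 1 isT cutET (leqnSn _) _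
  cheap_total cheap_trans.
have le1 : (#|V| <= size (visited r st))%N.
  by apply: leq_trans (card_size _); apply: subset_leq_card; apply/subsetP => v _.
apply: (leq_trans le1); rewrite /= size_map ltnS -(size_map (fun y => y.2)).
by rewrite -(card_uniqP (uniq_prim_edges ok)) max_card.
Qed.

Let mst_ok : prim_ok src dst (fun e f => cost e <= cost f) r (enum E)
  (prim src dst (fun e f => cost e <= cost f) r (enum E) #|E|).
Proof. exact: prim_okP. Qed.

Lemma mst_uniq : uniq mst.
Proof. exact: uniq_prim_edges mst_ok. Qed.

Lemma mst_good : good 1 mst.
Proof.
move=> S S0 rS; right; rewrite /deg count_deltaT ?mst_uniq // -has_count has_map.
apply: tree_crosses mst_ok _ S0 rS.
exact: (@prim_spanning V E src dst r (enum E) #|E| 1 isT cutET card_vertices).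
Qed.

(** [prim_weight] with [Fs] as [H] and [lam] = 1; the comparison through cuts costs the factor 2. *)
Lemma mst_cost : \sum_(e <- mst) cost e <= 2 * opt.
Proof.
rewrite /mst big_map -[X in X <= _]mulr1n.
apply: le_trans (prim_weight (H := enum Fs) (lam := 1) (w := cost) _ _ _ mst_ok _) _.
- by [].
- by move=> e _; rewrite mem_enum.
- exact: cutE.
- by [].
- by rewrite big_enum /= mulr_natl.
Qed.

Section Phase.
Variables (T0 T : nat) (F : seq E).
Hypothesis F_uniq : uniq F.
Hypothesis T0_gt0 : (0 < T0)%N.
Hypothesis T_leQ : (T <= Q)%N.
Hypothesis T_step :
  (((p <= T0) && (T == T0.+1)) || [&& T0 <= T, T <= 2 * T0 & T <= p])%N.
Hypothesis F_good : good T0 F.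

Let G := copies T0 F.
Let lam := (p * T0)%N.
Let s (x : E * nat) := src x.1.
Let t (x : E * nat) := dst x.1.

Let lam_gt0 : (0 < lam)%N. Proof. by rewrite muln_gt0 p_gt0. Qed.

Let lam_cut S : S != set0 -> r \notin S -> (lam <= count (crosses s t S) G)%N.
Proof.
move=> S0 rS; rewrite count_copies // /lam.
have := sdeg_le F S; case: (F_good S0 rS) => [le1 le2|le1 _].
  by have := leq_maxl T0 p; have := leq_maxr T0 p; nia.
by rewrite (leq_trans _ (leq_addr _ _)) // leq_mul2l le1 orbT.
Qed.

(** For T = T0 + 1 > p, a deficient cut has at most T0 edges, fewer than p of them safe, so its
    multiplicity is at most p T0 + (T0 - p)(p - 1). For T <= p all multiplicities equal p, and there
    are fewer than T <= 2 T0 edges. *)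
Let small S : S != set0 -> r \notin S -> deficient T F (delta (enum S)) ->
  (count (crosses s t S) G < 2 * lam)%N.
Proof.
move=> S0 rS /and3P[_]; rewrite -/(sdeg F S) -/(deg F S) count_copies // /lam.
move=> sp dT; have sd := sdeg_le F S.
case/orP: T_step => [/andP[pT /eqP TE]|/and3P[T1 T2 Tp]].
  have -> : maxn T0 p = T0 by apply/maxn_idPl.
  have dT0 : (p * deg F S <= p * T0)%N.
    by move: dT; rewrite TE ltnS leq_mul2l => ->; rewrite orbT.
  have : ((T0 - p) * sdeg F S < T0 * p)%N by nia.
  by nia.
have -> : maxn T0 p = p by apply/maxn_idPr; exact: leq_trans Tp.
by rewrite subnn mul0n addn0; nia.
Qed.

Let size_G0 S : S != set0 -> r \notin S -> (0 < size G)%N.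
Proof.
move=> S0 rS; apply: leq_trans (count_size (crosses s t S) G).
exact: leq_trans lam_gt0 (lam_cut S0 rS).
Qed.

Let size_G : (size G <= 2 ^ size G)%N. Proof. exact/ltnW/ltn_expl. Qed.

Let forest_ok : {in forest T0 F, forall st, tree_ok s t r G st}.
Proof. exact: (trees_ok lam_gt0 lam_cut card_vertices). Qed.

Let all_cutsP S : S != set0 -> r \notin S -> deficient T F (delta (enum S)) ->
  delta (enum S) \in all_cuts T0 F.
Proof.
move=> S0 rS def.
have := small_cut_light_trees (copies_uniq T0 F_uniq) lam_gt0 lam_cut
  card_vertices R size_G S0 rS (small S0 rS def).
rewrite -/(forest T0 F) => light.
have : (0 < 2 * count (fun st => count (fun y => crosses s t S y.2) st <= 20)%N
          (forest T0 F))%N.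
  by apply: leq_trans light; rewrite muln_gt0 lam_gt0 (size_G0 S0 rS).
rewrite muln_gt0 /= -has_count => /hasP[st stF cr].
have [[le ok] full] := forest_ok stF.
have [z zin [_ zS]] := enum_cuts_complete (S := mem S) ok rS cr.
apply/flattenP; exists [seq delta z.1 | z <- enum_cuts 20 st]; first exact: map_f.
apply/mapP; exists z => //; apply: eq_delta => v.
by rewrite zS mem_enum inE full andbT.
Qed.

Let cutsP d : d \in cuts T0 T F -> exists S, [/\ S != set0, r \notin S,
  deficient T F d & d = delta (enum S)].
Proof.
rewrite mem_undup mem_filter => /andP[def /flattenP[l /mapP[st stF ->]]].
case/mapP => z zin dE; have [[le ok] full] := forest_ok stF.
have rz := enum_cuts_root ok zin.
have dS : d = delta (enum [set v in z.1]).
  by rewrite dE; apply: eq_delta => v; rewrite mem_enum inE.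
exists [set v in z.1]; split => //; last by rewrite inE.
apply/eqP => S0; case/and3P: def; rewrite dS S0 lt0n => /negP[].
rewrite size_filter; apply/eqP; rewrite (eq_count (a2 := pred0)) ?count_pred0 //.
by move=> e; rewrite /crosses !mem_enum !inE.
Qed.

Let size_cuts : (size (cuts T0 T F) <= 2 * #|V| ^ 20)%N.
Proof.
case cE: (cuts T0 T F) => [//|d D]; rewrite -cE.
have [S [S0 rS _ _]] : exists S, [/\ S != set0, r \notin S,
    deficient T F d & d = delta (enum S)] by apply: cutsP; rewrite cE inE eqxx.
apply: (count_small_cuts (copies_uniq T0 F_uniq) lam_gt0 lam_cut
  card_vertices R size_G eq_delta) => //.
- exact: size_G0 S0 rS.
- exact: undup_uniq.
move=> d' /cutsP[S' [S'0 rS' def dE]]; exists S'; split=> //.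
by apply: small => //; rewrite -dE.
Qed.

Definition theta : R := if (T <= p)%N then T%:R / p%:R else 1.

Let theta01 : 0 <= theta <= 1.
Proof.
rewrite /theta; case: ifP => Tp; rewrite ?ler01 ?lexx // divr_ge0 //=.
by rewrite ler_pdivrMr ?ltr0n // mul1r ler_nat.
Qed.

(** Let the cut have z edges of [Fs] inside [F] and y outside. If T <= p, then z + y >= p, so theta
    (z + y) >= T, while theta z <= z is at most the number of [F]-edges. If T > p, the deficit is at
    most 1, and one edge of [Fs] outside [F] is enough: without it all [Fs]-edges of the cut lie in
    [F], which gives [F] either p safe edges or Q >= T edges there. *)
Let frac : {in cuts T0 T F, forall d, unsat T F d ->
  (T - count [in F] d)%:R <=
  theta * (count (fun e => (e \in Fs) && (e \notin F)) d)%:R}.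
Proof.
move=> d /cutsP[S [S0 rS /and3P[_ sp dT] dE]] _.
pose x := count [in enum Fs] d.
pose z := count [pred e | (e \in Fs) && (e \in F)] d.
pose y := count (fun e => (e \in Fs) && (e \notin F)) d; rewrite -/y.
have xE : x = (z + y)%N.
  rewrite /x /z /y -!sum1_count (bigID [in F]) /=.
  by congr addn; apply: eq_bigl => e; rewrite /= mem_enum.
have zF : (z <= count [in F] d)%N by apply: sub_count => e /andP[].
have [Tp|Tp] := leqP T p.
  have thE : theta = T%:R / p%:R by rewrite /theta Tp.
  have px : (p <= x)%N.
    have := sdeg_le (enum Fs) S; have : deg (enum Fs) S = x by rewrite /x dE.
    by case: (Fs_good S0 rS); move: p_leQ; lia.
  have p0 : 0 < p%:R :> R by rewrite ltr0n.
  have e1 : theta * p%:R = T%:R by rewrite thE divfK // gt_eqF.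
  have e2 : p%:R <= z%:R + y%:R :> R by rewrite -natrD -xE ler_nat.
  have e3 : z%:R <= (count [in F] d)%:R :> R by rewrite ler_nat.
  have /andP[th0 th1] := theta01.
  rewrite natrB; last exact: ltnW.
  have z0 : 0 <= z%:R :> R by [].
  have := ler_wpM2l th0 e2; rewrite e1 mulrDr => e4.
  have : theta * z%:R <= z%:R by rewrite ler_piMl.
  by lra.
have thE : theta = 1 by rewrite /theta leqNgt Tp.
have cT : (T - count [in F] d <= 1)%N.
  have : (T0 <= count [in F] d)%N.
    by have := F_good S0 rS; rewrite /sdeg /deg -dE; case=> //; move: sp; lia.
  by move: T_step Tp; lia.
rewrite thE mul1r ler_nat; apply: leq_trans cT _.
rewrite lt0n; apply/negP => /eqP y0.
have sub e : e \in d -> e \in Fs -> e \in F.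
  move=> ed eFs; apply/negPn/negP => eF.
  have : has (fun e => (e \in Fs) && (e \notin F)) d.
    by apply/hasP; exists e; rewrite ?eFs.
  by rewrite has_count -/y y0.
have := Fs_good S0 rS; rewrite /sdeg /deg -dE => -[].
  rewrite leqNgt => /negP; apply; apply: leq_ltn_trans sp.
  rewrite -!sum1_count big_seq_cond [X in (_ <= X)%N]big_seq_cond.
  rewrite big_mkcond [X in (_ <= X)%N]big_mkcond leq_sum // => e _ /=.
  rewrite mem_enum; case ed: (e \in d) => //=.
  by case eFs: (e \in Fs) => //=; rewrite sub.
rewrite -/x xE y0 addn0 => Qz; have := leq_trans Qz zF.
by move: T_leQ dT; lia.
Qed.

Let cuts_size_ge : {in cuts T0 T F, forall d, T <= size d}%N.
Proof.
move=> d dC; have [S [_ _ /and3P[_ _ dT] _]] := cutsP dC.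
have := frac dC dT; have /andP[th0 th1] := theta01.
pose y := count (fun e => (e \in Fs) && (e \notin F)) d; rewrite -/y => fr.
have le1 : (T - count [in F] d <= y)%N.
  by rewrite -(@ler_nat R) (le_trans fr) // ler_piMl.
have le2 : (y <= count (predC [in F]) d)%N by apply: sub_count => e /andP[].
by rewrite -(count_predC [in F] d) -leq_subLR (leq_trans le1).
Qed.

Let cuts_uniq : {in cuts T0 T F, forall d, uniq d}.
Proof. by move=> d /cutsP[S [_ _ _ ->]]; apply: delta_uniq. Qed.

Lemma phase_uniq : uniq (phase T0 T F).
Proof. exact: greedy_uniq. Qed.

Lemma phase_good : good T (phase T0 T F).
Proof.
move=> S S0 rS; have sub := @greedy_sub R E cost (cuts T0 T F) T #|E| F.
have [def|] := boolP (deficient T F (delta (enum S))).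
  have dC : delta (enum S) \in cuts T0 T F.
    by rewrite mem_undup mem_filter def all_cutsP.
  right; rewrite leqNgt.
  exact: (greedy_sat cost F_uniq (leqnn _) cuts_size_ge dC).
rewrite /deficient !negb_and -!leqNgt => /or3P[|sp|dT].
- rewrite leqn0 size_eq0 => /eqP d0.
  have := cutET S0 rS; rewrite -has_count => /hasP[e _].
  by rewrite -mem_delta d0.
- by left; apply: leq_trans sp (sdeg_sub _ sub).
- by right; apply: leq_trans dT (deg_sub _ sub).
Qed.

Lemma phase_cost : \sum_(e <- phase T0 T F) cost e <=
  \sum_(e <- F) cost e + theta * harmonic R (2 * #|V| ^ 20) * opt.
Proof.
apply: le_trans (greedy_cost cost_ge0 cuts_uniq _ theta01 frac) _.
  exact: (greedy_sat cost F_uniq (leqnn _) cuts_size_ge).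
have /andP[th0 _] := theta01.
by rewrite lerD2l ler_wpM2r ?sumr_ge0 // ler_wpM2l // harmonic_le.
Qed.

End Phase.

Let H := harmonic R (2 * #|V| ^ 20).
(** The sum of the values [theta] paid until target x. While targets double it is the geometric
    series, bounded by 2x/p; the last step, to exactly p, adds 1 to at most 2, hence the 3; each
    later step adds 1. *)
Let g (x : nat) : R := if (x < p)%N then x%:R * 2 / p%:R else 3 + (x - p)%:R.

Let g_next x : (0 < x < Q)%N -> g x + theta (next_target x) <= g (next_target x).
Proof.
move=> /andP[x0 xQ]; rewrite /g /theta /next_target.
have p0 : 0 < p%:R :> R by rewrite ltr0n.
have [xp|xp] := ltnP x p; last first.
  by rewrite !ltnNge xp (leqW xp) /= subSn // -natr1; lra.
rewrite geq_minr; have [le2|lt2] := ltnP (2 * x) p.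
  rewrite ?le2 natrM le_eqVlt; apply/orP; left; apply/eqP; field; lra.
rewrite ltnn subnn divff ?gt_eqF // addr0.
have : x%:R * 2 / p%:R <= 2 :> R.
  by rewrite ler_pdivrMr // mulrC ler_wpM2l // ler_nat ltnW.
by lra.
Qed.

Lemma rounds_spec i : let x := iter i (round Q) (1%N, mst) in
  [/\ (0 < x.1 <= Q)%N, (minn Q i.+1 <= x.1)%N, uniq x.2, good x.1 x.2 &
      \sum_(e <- x.2) cost e <= (2 + g x.1 * H) * opt].
Proof.
have H0 : 0 <= H by rewrite sumr_ge0 // => j _; rewrite invr_ge0.
have opt0 : 0 <= opt by rewrite sumr_ge0.
elim: i => [|i] /=.
  split=> //; [by move: p_leQ p_gt0; lia | by rewrite geq_minr | exact: mst_uniq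
              | exact: mst_good |].
  apply: le_trans mst_cost _; rewrite ler_wpM2r // lerDl mulr_ge0 // /g.
  by case: ifP => _; rewrite ?addr_ge0 // divr_ge0 // mulr_ge0.
set x := iter i _ _ => -[/andP[x0 xQ] ix ux gx cx].
rewrite /round; have [lt|ge] := ltnP x.1 Q; last first.
  by split=> //; [rewrite x0|move: ge ix; lia].
have nx : (x.1 < next_target x.1 <= Q)%N.
  by rewrite /next_target; case: ifP; move: p_leQ lt x0; lia.
have nst : (((p <= x.1) && (next_target x.1 == x.1.+1)) ||
    [&& x.1 <= next_target x.1, next_target x.1 <= 2 * x.1 &
        next_target x.1 <= p])%N.
  by rewrite /next_target; case: ltnP; move: x0; lia.
have /andP[nx1 nx2] := nx.
split=> /=.
- by rewrite nx2 (leq_ltn_trans _ nx1).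
- by move: nx1 ix; lia.
- exact: phase_uniq.
- exact: phase_good.
apply: le_trans (phase_cost ux x0 nx2 nst gx) _.
apply: le_trans (lerD cx (lexx _)) _.
rewrite -mulrDl ler_wpM2r // -addrA lerD2l -mulrDl ler_wpM2r // g_next //.
by rewrite x0.
Qed.

Lemma algorithm_spec : [/\ uniq (algorithm Q), good Q (algorithm Q) &
  \sum_(e <- algorithm Q) cost e <= (2 + (3 + (Q - p)%:R) * H) * opt].
Proof.
rewrite /algorithm; have := rounds_spec Q; set x := iter _ _ _ => -[xQ mQ ux gx cx].
have xE : x.1 = Q by move: xQ mQ; lia.
rewrite xE in gx cx; split=> //; move: cx; rewrite /g ltnNge p_leQ //.
Qed.

End Competitor.
End Algorithm.

(** * Approximation guarantee *)

(** Inductively, 1/(n+2) <= - ln (1 - 1/(n+2)) = ln (n+2) - ln (n+1). *)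
Lemma harmonic_ln (R : realType) (n : nat) : (0 < n)%N ->
  harmonic R n <= 1 + ln (n%:R : R).
Proof.
case: n => // n _; elim: n => [|n IH].
  by rewrite /harmonic big_ord1 invr1 ln1 addr0.
rewrite /harmonic big_ord_recr /= -/(harmonic R n.+1).
apply: le_trans (lerD IH (lexx _)) _; rewrite -addrA lerD2l -lerBrDl.
have n2 : 0 < n.+2%:R :> R by rewrite ltr0n.
have n1 : 0 < n.+1%:R :> R by rewrite ltr0n.
have : ln (1 + - n.+2%:R^-1 : R) <= - n.+2%:R^-1.
  by apply: le_ln1Dx; rewrite ltrN2 invf_lt1 // ltr1n.
have -> : 1 + - n.+2%:R^-1 = n.+1%:R / n.+2%:R :> R.
  have -> : n.+1%:R = n.+2%:R - 1 :> R by rewrite -[n.+2%:R]natr1 addrK.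
  by rewrite mulrBl mul1r divff ?gt_eqF.
by rewrite lnM ?posrE ?invr_gt0 // lnV ?posrE // lerNr opprB.
Qed.

Section Instance.
Variables (R : realType) (I : instance R).
Local Notation V := 'I_(nv I).
Local Notation E := 'I_(ne I).
Local Notation src := (@src R I).
Local Notation dst := (@dst R I).

Definition root_vertex : V := Ordinal (nv_gt0 I).

Local Notation good := (good src dst [in safe I] root_vertex).

Let D (A : {set E}) (S : {set V}) := [set e in A | crosses src dst S e].

Let count_D (F : seq E) (A : {set E}) S : F =i A ->
  deg src dst F S = #|D A S| /\
  sdeg src dst [in safe I] F S = #|D A S :&: safe I|.
Proof.
move=> FA; split; rewrite /deg /sdeg -size_filter.
  have /card_uniqP <- : uniq [seq e <- delta src dst (enum S) | e \in F].
    by rewrite filter_uniq ?delta_uniq.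
  by apply: eq_card => e; rewrite mem_filter mem_delta FA !inE.
have /card_uniqP <- : uniq [seq e <- delta src dst (enum S) |
    [pred e | (e \in F) && (e \in safe I)] e].
  by rewrite filter_uniq ?delta_uniq.
apply: eq_card => e; rewrite mem_filter mem_delta /= FA !inE.
by case: (e \in A); case: (e \in safe I); case: crosses.
Qed.

Let subset_card (A : {set E}) k :
  exists2 B : {set E}, B \subset A & #|B| = minn k #|A|.
Proof.
exists [set e in take k (enum A)].
  by apply/subsetP => e; rewrite inE => /mem_take; rewrite mem_enum.
rewrite cardsE (card_uniqP _) ?take_uniq ?enum_uniq //.
by rewrite size_take_min -cardE.
Qed.

Let connected_crosses (A : {set E}) S : connected src dst A -> S != set0 ->
  root_vertex \notin S -> exists2 e, e \in A & crosses src dst S e.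
Proof.
move=> con /set0Pn[v vS] rS.
case: (boolP [exists e in A, crosses src dst S e]) => [/exists_inP//|/negP no].
exfalso.
have cl : closed (adj src dst A) (mem S).
  move=> x y /existsP[e /andP[eA xy]]; apply/eqP/negPn/negP => ne; apply: no.
  apply/exists_inP; exists e => //; rewrite /crosses.
  by case/orP: xy => /andP[/eqP-> /eqP->] //; rewrite eq_sym.
by have := closed_connect cl (con root_vertex v); rewrite vS (negbTE rS).
Qed.

(** If a cut has fewer than p safe edges, delete as many of its unsafe edges as possible, at most q.
    By feasibility p edges remain, so not all unsafe ones were deleted; hence exactly q were, and
    the cut had p+q edges. Conversely, a disconnection by F' and B yields a cut inside their union.
    Its safe edges lie in B, so there are fewer than p of them, and it has fewer than p+q edges in
    all. *)
Lemma feasible_good p q (F : seq E) (A : {set E}) : F =i A ->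
  feasible I p q A <-> good p (p + q) F.
Proof.
move=> FA; split=> [feas S S0 rS|gd F' F'u F'q B BA Bp x y].
  have [-> ->] := count_D S FA.
  have [ps|sp] := leqP p #|D A S :&: safe I|; [by left | right].
  have [F' F'D F'E] := subset_card (D A S :\: safe I) q.
  have F'u : F' \subset unsafe I.
    by apply: subset_trans F'D _; rewrite setDE subsetIr.
  have F'q : (#|F'| <= q)%N by rewrite F'E geq_minl.
  have dp : (p <= #|D A S :\: F'|)%N.
    rewrite leqNgt; apply/negP => lt.
    have sub : D A S :\: F' \subset A :\: F'.
      by apply: setSD; apply/subsetP => e; rewrite inE => /andP[].
    have [e] := connected_crosses (feas F' F'u F'q _ sub lt) S0 rS.
    by rewrite !inE => /and3P[nD nF eA] ec; move: nD; rewrite nF eA ec.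
  have F'D' : F' \subset D A S by apply: subset_trans F'D (subsetDl _ _).
  move: dp; rewrite cardsDS // F'E.
  by have := cardsID (safe I) (D A S); lia.
apply/negPn/negP => nxy.
pose C := [set z | connect (adj src dst (A :\: F' :\: B)) x z].
have adj_sym : symmetric (adj src dst (A :\: F' :\: B)).
  by move=> a b; apply: eq_existsb => e; rewrite orbC.
(* A component and its complement give the same cut; the side without the root is taken. *)
pose S := if root_vertex \in C then ~: C else C.
have rS : root_vertex \notin S by rewrite /S; case: ifP => [|->//]; rewrite !inE => ->.
have S0 : S != set0.
  apply/set0Pn; rewrite /S; case: ifP => _; [exists y | exists x];
  by rewrite !inE ?connect0.
have SC : crosses src dst S =1 crosses src dst C.
  move=> e; rewrite /crosses /S; case: ifP => // _; rewrite !inE.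
  by do 2!case: (connect _ _ _).
have sub : D A S \subset F' :|: B.
  apply/subsetP => e; rewrite !inE SC => /andP[eA].
  apply: contraLR; rewrite negb_or => /andP[eF eB].
  have ea : adj src dst (A :\: F' :\: B) (src e) (dst e).
    by apply/existsP; exists e; rewrite !inE eF eB eA !eqxx.
  have ea' : adj src dst (A :\: F' :\: B) (dst e) (src e) by rewrite adj_sym.
  rewrite /crosses !inE negbK; apply/eqP.
  by apply/idP/idP => /connect_trans-> //; apply: connect1.
have := gd S S0 rS; have [-> ->] := count_D S FA.
have sB : D A S :&: safe I \subset B.
  apply/subsetP => e; rewrite inE => /andP[/(subsetP sub)]; rewrite inE.
  by case/orP=> // /(subsetP F'u); rewrite inE => /negbTE->.
have := subset_leq_card sB; have := subset_leq_card sub.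
have := cardsU F' B; lia.
Qed.

(** In binary, p and q may be exponential in the input length, but the algorithm uses them as unary
    counters. With at least two vertices, feasibility forces p to be at most the number of edges,
    and capping q preserves goodness because no cut has more edges than the graph. *)
Definition solve (p q : nat) : seq E :=
  algorithm src dst [in safe I] (@cost R I) root_vertex (minn p (ne I))
    (minn p (ne I) + minn q (ne I)).

(** Let L = ln n, x = L / ln 2 >= 1 and M = max(q,1). The cost factor is 2 + (3 + q')H, where H <= 1
    + ln 2 + 20L <= x + 21L, 3 + q' <= 4M and 2 <= 2Mx. The sum is at most M(6x + 84L). *)
Definition approx_ratio : R := 6 / ln 2 + 84.

Lemma solve_spec p q : (0 < p)%N ->
  (exists F0 : {set E}, feasible I p q F0) ->
  feasible I p q [set e in solve p q] /\
  forall F' : {set E}, feasible I p q F' ->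
    total_cost I [set e in solve p q] <=
      approx_ratio * ((maxn q 1)%:R * ln ((nv I)%:R : R)) * total_cost I F'.
Proof.
move=> p0 [F0 F0f].
have F0g : good p (p + q) (enum F0).
  by apply/(feasible_good _ _ (A := F0)) => // e; rewrite mem_enum.
(* With one vertex the logarithm is 0, but loops are excluded, so there are no edges and no cost. *)
have [n1|n1] := leqP (nv I) 1.
  have nS (S : {set V}) : S != set0 -> root_vertex \in S.
    case/set0Pn => v vS; have -> : root_vertex = v by apply: val_inj => /=; case: v vS => /=; lia.
    by [].
  split.
    apply/(feasible_good _ _ (F := solve p q)) => [e|S /nS -> //].
    by rewrite inE.
  have noE (e : E) : False.
    have := loopless e; have -> // : Defs.src e = Defs.dst e; last by rewrite eqxx.
    by apply: val_inj => /=; case: (Defs.src e) (Defs.dst e) => a a0 [b b0] /=; lia.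
  by move=> F' _; rewrite /total_cost !big1 ?mulr0 // => e; case: (noE e).
have degE F S : (deg src dst F S <= ne I)%N.
  apply: leq_trans (count_size _ _) _; rewrite size_filter.
  by apply: leq_trans (count_size _ _) _; rewrite -cardE card_ord.
have pm : (p <= ne I)%N.
  pose v : V := Ordinal n1.
  have S0 : [set v] != set0 by apply/set0Pn; exists v; rewrite inE.
  have rS : root_vertex \notin [set v] by rewrite inE.
  have := sdeg_le src dst [in safe I] (enum F0) [set v].
  have := degE (enum F0) [set v].
  by case: (F0g _ S0 rS); lia.
have solveE : solve p q = algorithm src dst [in safe I] (@cost R I) root_vertex p
    (p + minn q (ne I)).
  by rewrite /solve (minn_idPl pm).
set q' := minn q (ne I) in solveE.
have good_cap F : good p (p + q) F -> good p (p + q') F.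
  move=> g S S0 rS; case: (g S S0 rS) => [|le]; [by left | right].
  by rewrite /q'; lia.
have good_uncap F : good p (p + q') F -> good p (p + q) F.
  move=> g S S0 rS; case: (g S S0 rS) => [|le]; [by left | right].
  by have := degE F S; move: le; rewrite /q'; lia.
have spec (Fs : {set E}) : feasible I p q Fs ->
  [/\ uniq (solve p q), good p (p + q') (solve p q) &
   \sum_(e <- solve p q) cost e <=
   (2 + (3 + q'%:R) * harmonic R (2 * nv I ^ 20)) * \sum_(e in Fs) cost e].
  move=> Fsf; have Fsg : good p (p + q) (enum Fs).
    by apply/(feasible_good _ _ (A := Fs)) => // e; rewrite mem_enum.
  have := algorithm_spec p0 (leq_addr q' p) (@cost_ge0 R I) (good_cap _ Fsg).
  by rewrite -solveE addKn card_ord.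
have [us gs _] := spec F0 F0f; split.
  apply/(feasible_good _ _ (F := solve p q)); last exact: good_uncap.
  by move=> e; rewrite inE.
move=> F' F'f; have [_ _] := spec F' F'f.
have -> : \sum_(e <- solve p q) cost e = total_cost I [set e in solve p q].
  rewrite /total_cost [RHS](eq_bigl [in solve p q]) => [|e]; last by rewrite inE.
  by rewrite big_uniq.
move=> /le_trans; apply; rewrite -/(total_cost I F').
rewrite ler_wpM2r ?sumr_ge0 // => [e _|]; first exact: cost_ge0.
have l2 : 0 < ln 2 :> R by rewrite ln_gt0 // ltr1n.
have nn : 2 <= (nv I)%:R :> R by rewrite (ler_nat _ 2).
set L := ln _; have l2L : ln 2 <= L :> R by rewrite ler_ln ?posrE //; lra.
have hH : harmonic R (2 * nv I ^ 20) <= 1 + (ln 2 + L *+ 20).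
  apply: le_trans (harmonic_ln _ _) _; first by rewrite muln_gt0 expn_gt0 (ltnW n1).
  rewrite natrM natrX lnM ?posrE ?exprn_gt0 //; last lra.
  by rewrite lnXn //; lra.
have L1 : 1 <= L / ln 2 by rewrite ler_pdivlMr // mul1r.
set x := L / ln 2 in L1.
have -> : approx_ratio * ((maxn q 1)%:R * L) = (maxn q 1)%:R * (6 * x + 84 * L).
  by rewrite /approx_ratio /x; field; rewrite gt_eqF.
have H1 : harmonic R (2 * nv I ^ 20) <= x + 21 * L by move: hH; lra.
have H0 : 0 <= harmonic R (2 * nv I ^ 20).
  by rewrite sumr_ge0 // => i _; rewrite invr_ge0.
have q1 : 1 <= (maxn q 1)%:R :> R by rewrite (ler_nat _ 1) leq_maxr.
have q3 : 3 + q'%:R <= 4 * (maxn q 1)%:R :> R.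
  have : q'%:R <= (maxn q 1)%:R :> R by rewrite ler_nat /q'; lia.
  by lra.
have : (3 + q'%:R) * harmonic R (2 * nv I ^ 20) <=
    4 * (maxn q 1)%:R * (x + 21 * L).
  by apply: ler_pM => //; rewrite addr_ge0.
have : 2 <= (maxn q 1)%:R * (2 * x) by rewrite -[X in X <= _]mul1r ler_pM //; lra.
by lra.
Qed.

End Instance.

(** * Reading the input *)

Section Decode.
Variable R : realType.
Local Open Scope nat_scope.

Fixpoint pos_bits (b : positive) : seq bool :=
  match b with
  | xH => [:: true]
  | xO b' => false :: pos_bits b'
  | xI b' => true :: pos_bits b'
  end.

Definition bits (k : nat) := if bin_of_nat k is Npos b then pos_bits b else [::].

Lemma enc_natE k : enc_nat R k = elist (of_bool R) (bits k).
Proof.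
rewrite /enc_nat /bits; case: bin_of_nat => // b.
by rewrite /elist; elim: b => //= b ->.
Qed.

Lemma tree_size_elist (X : Type) (e : X -> tree R) l :
  size l <= tree_size (elist e l).
Proof. by elim: l => //= x l IH; rewrite ltnS (leq_trans IH) ?leq_addl. Qed.

(** The pair consists of the current power of 2 and the value read so far, both saturated at [cap]
    so that they remain small in unary. *)
Definition decode_step cap (x : nat * nat) (b : bool) :=
  (minn cap (x.1 + x.1), if b then minn cap (x.2 + x.1) else x.2).

(** Saturation commutes with addition: capping the summands first does not change the capped sum. *)
Lemma decodeP cap k :
  (foldl (decode_step cap) (minn cap 1, 0) (bits k)).2 = minn cap k.
Proof.
pose val := foldr (fun (b : bool) v => b + v.*2) 0.
have kE : k = val (bits k).
  rewrite -{1}[k]bin_of_natK /bits; case: bin_of_nat => //= b.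
  have posE c : nat_of_pos c = val (pos_bits c).
    by elim: c => //= c ->; rewrite NatTrec.doubleE.
  exact: posE.
have inv l i v : foldl (decode_step cap) (minn cap (2 ^ i), minn cap v) l =
    (minn cap (2 ^ (i + size l)), minn cap (v + 2 ^ i * val l)).
  elim: l i v => [|x l IH] i v /=; first by rewrite addn0 muln0 addn0.
  have -> : decode_step cap (minn cap (2 ^ i), minn cap v) x =
      (minn cap (2 ^ i.+1), minn cap (v + x * 2 ^ i)).
    rewrite /decode_step /= expnS; congr pair; first by lia.
    by case: x; rewrite ?mul1n ?mul0n ?addn0 //; lia.
  rewrite IH addSnnS; congr (_, minn _ _).
  by rewrite expnS -muln2; case: x => /=; nia.
by have := inv (bits k) 0 0; rewrite minn0 expn0 => ->; rewrite mul1n add0n -kE.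
Qed.

Lemma pt_decode (J : Type) (P : nat -> J -> Prop) (ctx : J -> tree R)
    (k cap : J -> nat) :
  bnd P cap -> bnd P (fun j => size (bits (k j))) ->
  pt P ctx (fun j => eun R (cap j)) -> pt P ctx (fun j => enc_nat R (k j)) ->
  pt P ctx (fun j => eun R (minn (cap j) (k j))).
Proof.
move=> cb kb pc pk.
suff h : pt P ctx (fun j => epair (eun R) (eun R)
    (foldl (decode_step (cap j)) (minn (cap j) 1, 0) (bits (k j)))).
  by apply: pt_ext (pt_tl h) => N j _; rewrite decodeP.
pose PP := foldP P (fun j => decode_step (cap j)) (fun j => (minn (cap j) 1, 0))
  (fun j => bits (k j)).
apply: (pt_foldl (X := fun=> bool) (eX := fun=> of_bool R)
  (A := fun=> (nat * nat)%type) (eA := fun=> epair (eun R) (eun R))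
  (f := fun j => decode_step (cap j)) (a := fun j => (minn (cap j) 1, 0)) kb).
- by apply: pt_ext pk => N j _; rewrite enc_natE.
- apply: pt_cons; last exact: pt_nil.
  apply: pt_minn => //; [exact: bnd_const | exact: (pt_const _ _ 1)].
move=> c cw cx ca.
rewrite -/PP in cw cx ca *.
have b1 : bnd PP (fun q => (tagged q).1.1).
  apply: bnd_le (bnd_reindex (h := tag) _ cb) _; first by move=> N q [].
  move=> N [j [a x]] [/= _ [l1 [l2 [_ ->]]]].
  elim/last_ind: l1 => [|l1 y _]; first by rewrite /= geq_minl.
  by rewrite foldl_rcons /= geq_minl.
have p1 : pt PP c (fun q => eun R (tagged q).1.1) := pt_hd ca.
have p2 : pt PP c (fun q => eun R (tagged q).1.2) := pt_tl ca.
have pcap := cw _ pc; have b2 := bnd_add b1 b1.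
have p11 : pt PP c (fun q => eun R ((tagged q).1.1 + (tagged q).1.1)).
  exact: (pt_addn p1 p1 b1).
apply: pt_cons; first exact: pt_minn b2 pcap p11.
rewrite /decode_step /=.
apply: (@pt_ext _ _ _ _ (fun q => if (tagged q).2 then
   eun R (minn (cap (tag q)) ((tagged q).1.2 + (tagged q).1.1))
   else eun R (tagged q).1.2)); first by move=> N q _; case: ifP.
apply: pt_if => //.
apply: (@pt_ext _ _ _ _ (fun q => eun R
  (minn ((tagged q).1.2 + (tagged q).1.1) (cap (tag q))))).
  by move=> N q _; rewrite minnC.
apply: pt_minn pcap; last exact: pt_addn.
by apply: bnd_reindex cb => N q [].
Qed.

Definition inp := (instance R * nat * nat)%type.

Definition inpP (N : nat) (j : inp) :=
  tree_size (enc_instance j.1.1 j.1.2 j.2) <= N.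

Definition iV (j : inp) := 'I_(nv j.1.1).
Definition iE (j : inp) := 'I_(ne j.1.1).
Definition eV (j : inp) (v : iV j) : tree R := eun R v.
(** An edge carries its index, for equality tests, together with its ends, safety bit and cost, so
    every attribute is a projection and no table is searched. *)
Definition eE (j : inp) (e : iE j) : tree R :=
  TCons (eun R e) (TCons (eV (src e : iV j)) (TCons (eV (dst e : iV j))
    (TCons (of_bool R (e \in safe j.1.1)) (TNum (cost e))))).

(** The connected input graph is feasible for p = 1 and q = 0, so [card_vertices] applies. The
    number of vertices is written in binary; only this inequality shows it to be linear in the input
    length. *)
Lemma nv_le_ne (I : instance R) : nv I <= (ne I).+1.
Proof.
have feas : feasible I 1 0 [set: 'I_(ne I)].
  move=> F' _; rewrite leqn0 cards_eq0 => /eqP-> B _.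
  rewrite ltnS leqn0 cards_eq0 => /eqP->; rewrite !setD0.
  exact: whole_connected.
have g : good (@src R I) (@dst R I) [in safe I] (root_vertex I) 1 1
    (enum [set: 'I_(ne I)]).
  by apply/(feasible_good 1 0 (A := setT)) => // e; rewrite mem_enum.
have := card_vertices (p := 1) (Q := 1) (fun e => cost e) isT isT g.
by rewrite !card_ord.
Qed.

Section Base.
Variables (J : Type) (P : nat -> J -> Prop) (b : J -> inp).
Hypothesis bP : forall N j, P N j -> inpP N (b j).

Lemma bnd_ne : bnd P (fun j => ne (b j).1.1).
Proof.
apply: bnd_size => N j /bP; rewrite /inpP /enc_instance /=.
have := @tree_size_elist 'I_(ne (b j).1.1) (@enc_edge R _) (enum 'I_(ne (b j).1.1)).
by rewrite -cardE card_ord /elist => h; move: h; lia.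
Qed.

Lemma bnd_nv : bnd P (fun j => nv (b j).1.1).
Proof.
apply: bnd_le (bnd_add (bnd_const _ 1) bnd_ne) _ => N j _.
exact: nv_le_ne.
Qed.

Lemma bnd_bits : bnd P (fun j => size (bits (b j).1.2)) /\
  bnd P (fun j => size (bits (b j).2)).
Proof.
split; apply: bnd_size => N j /bP; rewrite /inpP /enc_instance /=.
  have := tree_size_elist (of_bool R) (bits (b j).1.2).
  by rewrite -enc_natE; lia.
have := tree_size_elist (of_bool R) (bits (b j).2).
by rewrite -enc_natE; lia.
Qed.

Lemma bnd_enumE : bnd P (fun j => size (enum (iE (b j)))).
Proof. by apply: bnd_le bnd_ne _ => N j _; rewrite -cardE card_ord. Qed.

End Base.

Lemma size_pos_bits c : size (pos_bits c) <= nat_of_pos c.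
Proof.
have pos0 d : 0 < nat_of_pos d.
  by elim: d => //= d; rewrite NatTrec.doubleE double_gt0.
elim: c => //= c; rewrite NatTrec.doubleE -addnn; have := pos0 c; lia.
Qed.

Lemma size_bits k : size (bits k) <= k.
Proof.
rewrite -{2}[k]bin_of_natK /bits; case: bin_of_nat => //= c.
exact: size_pos_bits.
Qed.

Local Notation ectx := (fun j : inp => enc_instance j.1.1 j.1.2 j.2).

Let raw_edges : pt inpP ectx
  (fun j => elist (fun e : iE j => enc_edge e) (enum (iE j))).
Proof. exact: pt_hd (pt_tl (pt_tl (pt_tl (pt_ctx _ _)))). Qed.

Let idP N (j : inp) : inpP N j -> inpP N (id j). Proof. by []. Qed.

Lemma pt_ne : pt inpP ectx (fun j => eun R (ne j.1.1)).
Proof.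
apply: pt_ext (pt_size _ raw_edges) => [N j _|]; first by rewrite -cardE card_ord.
exact: (bnd_enumE idP).
Qed.

Lemma pt_p : pt inpP ectx (fun j => eun R (minn j.1.2 (ne j.1.1))).
Proof.
apply: (@pt_ext _ _ _ _ (fun j => eun R (minn (ne j.1.1) j.1.2))).
  by move=> N j _; rewrite minnC.
have [h _] := bnd_bits idP; apply: pt_decode h pt_ne _; first exact: (bnd_ne idP).
exact: pt_hd (pt_tl (pt_ctx _ _)).
Qed.

Lemma pt_q : pt inpP ectx (fun j => eun R (minn j.2 (ne j.1.1))).
Proof.
apply: (@pt_ext _ _ _ _ (fun j => eun R (minn (ne j.1.1) j.2))).
  by move=> N j _; rewrite minnC.
have [_ h] := bnd_bits idP; apply: pt_decode h pt_ne _; first exact: (bnd_ne idP).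
exact: pt_hd (pt_tl (pt_tl (pt_ctx _ _))).
Qed.

(** Edges are not numbered in the input, so the fold carries a counter besides the list of decoded
    edges. *)
Lemma pt_edges : pt inpP ectx (fun j => elist (@eE j) (enum (iE j))).
Proof.
pose f j (x : nat * seq (iE j)) (e : iE j) := (x.1.+1, e :: x.2).
have fE j l n (m : seq (iE j)) : foldl (@f j) (n, m) l = (n + size l, rev l ++ m).
  elim: l n m => [|e l IH] n m /=; first by rewrite addn0.
  by rewrite IH rev_cons cat_rcons addSnnS.
have h : pt inpP ectx (fun j => epair (eun R) (elist (@eE j))
    (foldl (@f j) (0, [::]) (enum (iE j)))).
  apply: (pt_foldl (X := iE) (eX := fun j (e : iE j) => enc_edge e)
    (A := fun j => (nat * seq (iE j))%type)
    (eA := fun j => epair (eun R) (elist (@eE j))) (f := f)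
    (a := fun j => (0, [::]))).
  - exact: (bnd_enumE idP).
  - exact: raw_edges.
  - by apply: pt_cons; apply: pt_nil.
  move=> c cw cx ca.
  have bP N (q : {j & ((nat * seq (iE j)) * iE j)%type}) :
      foldP inpP f (fun j => (0, [::])) (fun j => enum (iE j)) N q ->
      inpP N (tag q) by case.
  have pne := cw _ pt_ne.
  have vtx (v : forall q : {j & ((nat * seq (iE j)) * iE j)%type}, iV (tag q)) :
      pt (foldP inpP f (fun j => (0, [::])) (fun j => enum (iE j))) c
        (fun q => enc_nat R (v q)) ->
      pt (foldP inpP f (fun j => (0, [::])) (fun j => enum (iE j))) c
        (fun q => eV (v q)).
    (* Decoding with cap [ne] loses nothing, since v < nv <= ne + 1. *)
    move=> pv; apply: (@pt_ext _ _ _ _ (fun q => eun R (minn (ne (tag q).1.1) (v q)))).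
      move=> N q _; congr eun; apply/minn_idPr.
      exact: leq_trans (ltn_ord (v q)) (nv_le_ne _).
    apply: pt_decode pne pv; first exact: (bnd_ne bP).
    apply: bnd_le (bnd_nv bP) _ => N q _; apply: leq_trans (size_bits _) _.
    exact/ltnW/ltn_ord.
  apply: pt_cons; first exact: pt_unS (pt_hd ca).
  apply: pt_cons; last exact: pt_tl ca.
  apply: pt_cons.
    apply: pt_ext (pt_hd ca) => N [j [[n m] e]] [/= _ [l1 [l2 [lE]]]].
    rewrite fE add0n => -[-> _]; congr eun.
    have -> : nat_of_ord e = index e (enum 'I_(ne j.1.1)) by rewrite index_enum_ord.
    have ul : uniq (l1 ++ e :: l2) by rewrite -lE enum_uniq.
    have -> : enum 'I_(ne j.1.1) = l1 ++ e :: l2 := lE.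
    rewrite index_cat /= eqxx addn0; case: ifP => // el.
    by move: ul; rewrite cat_uniq /= el orTb /= andbF.
  apply: pt_cons; first exact: vtx (pt_hd cx).
  apply: pt_cons; first exact: vtx (pt_hd (pt_tl cx)).
  apply: pt_cons; first exact: pt_hd (pt_tl (pt_tl cx)).
  exact: pt_hd (pt_tl (pt_tl (pt_tl cx))).
apply: (@pt_ext _ _ _ _ (fun j => elist (@eE j) (rev (rev (enum (iE j)))))).
  by move=> N j _; rewrite revK.
apply: pt_rev; first by apply: bnd_le (bnd_enumE idP) _ => N j _; rewrite size_rev.
by apply: pt_ext (pt_tl h) => N j _; rewrite fE cats0.
Qed.

End Decode.

(** * Programs for the algorithm *)

Section Programs.
Variable R : realType.
Local Open Scope nat_scope.
Local Notation tree := (tree R).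
Local Notation inp := (inp R).

(** Everything computable in [ctx] is computable in [ctx'] along [h]. Each nested fold enlarges the
    context; these extensions compose, so a fact about an outer level can be used at any depth. *)
Definition ext (J : Type) (P : nat -> J -> Prop) (ctx : J -> tree)
    (J' : Type) (P' : nat -> J' -> Prop) (ctx' : J' -> tree) (h : J' -> J) :=
  (forall N q, P' N q -> P N (h q)) /\
  (forall r, pt P ctx r -> pt P' ctx' (fun q => r (h q))).

Lemma ext_comp J P ctx J' P' ctx' J'' P'' ctx'' (h : J' -> J) (h' : J'' -> J') :
  @ext J P ctx J' P' ctx' h -> @ext J' P' ctx' J'' P'' ctx'' h' ->
  ext P ctx P'' ctx'' (fun q => h (h' q)).
Proof.
move=> [h1 h2] [h3 h4]; split=> [N q /h3/h1 //|r /h2]; exact: (h4 (fun q => r (h q))).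
Qed.

(* Decidable equality, uniformly in the instance; [sz] measures the unary parts
   of a value, on which the running time of the test depends. *)
Definition eqpt (X : inp -> eqType) (eX : forall j, X j -> tree)
    (sz : forall j, X j -> nat) :=
  forall (J : Type) (P : nat -> J -> Prop) (ctx : J -> tree) (b : J -> inp)
    (x y : forall j, X (b j)),
  (forall N j, P N j -> inpP N (b j)) ->
  bnd P (fun j => sz (b j) (x j)) -> bnd P (fun j => sz (b j) (y j)) ->
  pt P ctx (fun j => eX (b j) (x j)) -> pt P ctx (fun j => eX (b j) (y j)) ->
  pt P ctx (fun j => of_bool R (x j == y j)).

Local Notation fV := (fun j : inp => 'I_(nv j.1.1) : eqType).
Local Notation fE := (fun j : inp => 'I_(ne j.1.1) : eqType).
Local Notation fX := (fun j : inp => ('I_(ne j.1.1) * nat)%type : eqType).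

Definition eX (j : inp) := epair (@eE R j) (eun R).

Lemma eqpt_V : @eqpt fV (@eV R) (fun _ _ => 0).
Proof.
move=> J P ctx b x y bP _ _ px py.
apply: (pt_eqn (m := fun j => nat_of_ord (x j)) (n := fun j => nat_of_ord (y j)))
  => //; apply: bnd_le (bnd_nv bP) _ => N j _; exact/ltnW/ltn_ord.
Qed.

Lemma eqpt_E : @eqpt fE (@eE R) (fun _ _ => 0).
Proof.
move=> J P ctx b x y bP _ _ px py.
apply: (pt_eqn (m := fun j => nat_of_ord (x j)) (n := fun j => nat_of_ord (y j)));
  last 2 first.
- exact: pt_hd px.
- exact: pt_hd py.
- apply: bnd_le (bnd_ne bP) _ => N j _; exact/ltnW/ltn_ord.
- apply: bnd_le (bnd_ne bP) _ => N j _; exact/ltnW/ltn_ord.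
Qed.

Lemma eqpt_X : @eqpt fX eX (fun _ x => x.2).
Proof.
move=> J P ctx b x y bP bx by_ px py.
apply: (@pt_ext _ _ _ _ (fun j => of_bool R
  (((x j).1 == (y j).1) && ((x j).2 == (y j).2)))).
  by move=> N j _; case: (x j) (y j) => [? ?] [? ?]; rewrite xpair_eqE.
apply: pt_and.
  apply: (eqpt_E (b := b) bP) (pt_hd px) (pt_hd py); exact: bnd_const.
exact: pt_eqn bx by_ (pt_tl px) (pt_tl py).
Qed.

Lemma pt_mem (X : inp -> eqType) (e : forall j, X j -> tree)
    (sz : forall j, X j -> nat) (J : Type) (P : nat -> J -> Prop)
    (ctx : J -> tree) (b : J -> inp) (x : forall j, X (b j))
    (l : forall j, seq (X (b j))) :
  eqpt e sz -> (forall N j, P N j -> inpP N (b j)) ->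
  bnd P (fun j => size (l j)) -> bnd P (fun j => sz (b j) (x j)) ->
  bnd (memP P l) (fun q => sz (b (tag q)) (tagged q)) ->
  pt P ctx (fun j => elist (@e (b j)) (l j)) ->
  pt P ctx (fun j => e (b j) (x j)) ->
  pt P ctx (fun j => of_bool R (x j \in l j)).
Proof.
move=> eqX bP lb xb lsz pl px.
apply: (@pt_ext _ _ _ _ (fun j => of_bool R (has (fun y => y == x j) (l j)))).
  by move=> N j _; rewrite -has_pred1.
apply: (pt_has (X := fun j => X (b j)) (eX := fun j => @e (b j))
  (b := fun j y => y == x j) lb pl) => c cw cx.
apply: (eqX _ _ _ (fun q => b (tag q)) (fun q => tagged q) (fun q => x (tag q))) => //.
- by move=> N q [/bP].
- by apply: (bnd_reindex (h := tag) _ xb) => N q [].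
- exact: (cw (fun j => e (b j) (x j))).
Qed.

Section MemV.
Variables (J : Type) (P : nat -> J -> Prop) (ctx : J -> tree) (b : J -> inp).
Hypothesis bP : forall N j, P N j -> inpP N (b j).

Lemma pt_memV (x : forall j, iV (b j)) (l : forall j, seq (iV (b j))) :
  bnd P (fun j => size (l j)) -> pt P ctx (fun j => elist (@eV R (b j)) (l j)) ->
  pt P ctx (fun j => eV (x j)) -> pt P ctx (fun j => of_bool R (x j \in l j)).
Proof.
move=> lb pl px; apply: (pt_mem (X := fV) (b := b) eqpt_V bP lb) pl px;
exact: bnd_const.
Qed.

Lemma pt_memE (x : forall j, iE (b j)) (l : forall j, seq (iE (b j))) :
  bnd P (fun j => size (l j)) -> pt P ctx (fun j => elist (@eE R (b j)) (l j)) ->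
  pt P ctx (fun j => eE (x j)) -> pt P ctx (fun j => of_bool R (x j \in l j)).
Proof.
move=> lb pl px; apply: (pt_mem (X := fE) (b := b) eqpt_E bP lb) pl px;
exact: bnd_const.
Qed.

End MemV.

(** Shows that the partial minima inside the fold of [pt_argmin] lie in the list, where the
    comparison is known to be computable. *)
Lemma argmin_mem (X : eqType) (C : pred X) (le : rel X) l x :
  argmin C le l = Some x -> x \in l.
Proof.
elim/last_ind: l x => // l y IH x; rewrite /argmin foldl_rcons -/(argmin C le l).
rewrite mem_rcons inE.
case: ifP => _ h; last by rewrite IH ?orbT.
move: h IH; case: argmin => [z|] h IH; last by case: h => ->; rewrite eqxx.
move: h; case: ifP => _ [zx]; last by rewrite zx eqxx.
by rewrite -zx IH ?orbT.
Qed.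

Section Argmin.
Variables (J : Type) (P : nat -> J -> Prop) (ctx : J -> tree).
Variables (X : J -> eqType) (e : forall j, X j -> tree).
Variables (l : forall j, seq (X j)) (C : forall j, pred (X j)).
Variable le : forall j, rel (X j).

(** The form in which programs take functions as parameters: computable in every extended context,
    at arguments from [l]. Membership in [l] supplies the size bounds that the computation of the
    function may require. *)
Definition pt_on1 (X' : J -> Type) (e' : forall j, X' j -> tree)
    (f : forall j, X j -> X' j) :=
  forall (J' : Type) (P' : nat -> J' -> Prop) (ctx' : J' -> tree) (h : J' -> J)
    (x : forall q, X (h q)),
  ext P ctx P' ctx' h -> (forall N q, P' N q -> x q \in l (h q)) ->
  pt P' ctx' (fun q => e (x q)) -> pt P' ctx' (fun q => e' (h q) (f (h q) (x q))).

Definition pt_on2 :=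
  forall (J' : Type) (P' : nat -> J' -> Prop) (ctx' : J' -> tree) (h : J' -> J)
    (x y : forall q, X (h q)),
  ext P ctx P' ctx' h -> (forall N q, P' N q -> x q \in l (h q)) ->
  (forall N q, P' N q -> y q \in l (h q)) ->
  pt P' ctx' (fun q => e (x q)) -> pt P' ctx' (fun q => e (y q)) ->
  pt P' ctx' (fun q => of_bool R (le (x q) (y q))).

Lemma pt_argmin :
  bnd P (fun j => size (l j)) -> pt P ctx (fun j => elist (@e j) (l j)) ->
  pt_on1 (fun=> of_bool R) C -> pt_on2 ->
  pt P ctx (fun j => eopt (@e j) (argmin (@C j) (@le j) (l j))).
Proof.
move=> lb pl hC hle; rewrite /argmin.
pose f j (o : option (X j)) x := if C x then
  if o is Some y then if le y x then o else Some x else Some x else o.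
apply: (pt_foldl (X := X) (eX := e) (A := fun j => option (X j))
  (eA := fun j => eopt (@e j)) (f := f) (a := fun=> None) lb pl (pt_nil _ _)).
move=> c cw cx ca.
set PP := foldP _ _ _ _ in cw cx ca *.
have ex : ext P ctx PP c tag by split=> // N q [].
have xl N q : PP N q -> (tagged q).2 \in l (tag q).
  by move=> [_ [l1 [l2 [-> _]]]]; rewrite mem_cat inE eqxx orbT.
have psome : pt PP c (fun q => eopt (@e (tag q)) (Some (tagged q).2)).
  by apply: pt_cons => //; apply: pt_nil.
apply: (@pt_ext _ _ _ _ (fun q => if C (tagged q).2 then
  (if (tagged q).1 is Some y then
     (if le y (tagged q).2 then eopt (@e (tag q)) (tagged q).1
      else eopt (@e (tag q)) (Some (tagged q).2))
   else eopt (@e (tag q)) (Some (tagged q).2)) else eopt (@e (tag q)) (tagged q).1)).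
  move=> N [j [o x]] _ /=; rewrite /f; case: ifP => //= _.
  by case: o => // y; case: ifP.
apply: pt_if => //; first exact: (hC _ _ _ tag (fun q => (tagged q).2)).
apply: (pt_option (X := fun q => X (tag q)) (eX := fun q => @e (tag q))
  (o := fun q => (tagged q).1)
  (rS := fun q y => if le y (tagged q).2 then eopt (@e (tag q)) (tagged q).1
      else eopt (@e (tag q)) (Some (tagged q).2))) => // c' cw' cx'.
apply: pt_if; [|exact: (cw' (fun q => eopt (@e (tag q)) (tagged q).1))
  |exact: (cw' (fun q => eopt (@e (tag q)) (Some (tagged q).2)))].
apply: (hle _ _ _ (fun z => tag (tag z)) (fun z => tagged z)
  (fun z => (tagged (tag z)).2)) => //.
- by apply: ext_comp ex _; split=> // N z [].
- move=> N z [[_ [l1 [l2 [lE ->]]]]]; rewrite lE => /argmin_mem ym.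
  by rewrite mem_cat ym.
- by move=> N z [/xl].
- exact: (cw' (fun q => e (tagged q).2)).
Qed.

End Argmin.

Lemma elist_map (X Y : Type) (e : Y -> tree) (f : X -> Y) l :
  elist e [seq f x | x <- l] = elist (fun x => e (f x)) l.
Proof. by rewrite /elist -map_comp. Qed.

Definition eT (j : inp) (X : Type) (e : X -> tree) :=
  epair (epair (@eV R j) (@eV R j)) e.

Section PtPrim.
Variables (J : Type) (P : nat -> J -> Prop) (ctx : J -> tree) (b : J -> inp).
Hypothesis bP : forall N j, P N j -> inpP N (b j).
Variables (X : J -> eqType) (e : forall j, X j -> tree).
Variables (s t : forall j, X j -> iV (b j)) (le : forall j, rel (X j)).
Variables (G : forall j, seq (X j)) (k : J -> nat).

Lemma pt_prim :
  bnd P (fun j => size (G j)) -> bnd P k ->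
  pt P ctx (fun j => elist (@e j) (G j)) -> pt P ctx (fun j => eun R (k j)) ->
  pt_on1 P ctx e G (fun j => @eV R (b j)) s ->
  pt_on1 P ctx e G (fun j => @eV R (b j)) t -> pt_on2 P ctx e G le ->
  pt P ctx (fun j => elist (@eT (b j) _ (@e j))
    (prim (@s j) (@t j) (@le j) (root_vertex (b j).1.1) (G j) (k j))).
Proof.
move=> Gb kb pG pk hs ht hle; rewrite /prim.
pose A j := seq (iV (b j) * iV (b j) * X j).
pose r j : iV (b j) := root_vertex (b j).1.1.
apply: (pt_iter (A := A) (eA := fun j => elist (@eT (b j) _ (@e j)))
  (f := fun j => prim_step (@s j) (@t j) (@le j) (r j) (G j)) (a := fun=> [::])
  kb pk (pt_nil _ _)) => c cw ca.
set PP := iterP _ _ _ _ in cw ca *.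
have ex : ext P ctx PP c tag by split=> // N q [].
have bP' N q : PP N q -> inpP N (b (tag q)) by case=> /bP.
have stb : bnd PP (fun q => size (tagged q)).
  apply: bnd_le (bnd_reindex (h := tag) _ kb) _; first by move=> N q [].
  move=> N q [_ [i ik ->]]; apply: leq_trans (ltnW ik); exact: size_prim.
have Gb' : bnd PP (fun q => size (G (tag q))).
  by apply: (bnd_reindex (h := tag) _ Gb) => N q [].
have vb : bnd PP (fun q => size (visited (r (tag q)) (tagged q))).
  apply: bnd_le (bnd_add (bnd_const _ 1) stb) _ => N q _.
  by rewrite /= size_map.
have pv : pt PP c (fun q => elist (@eV R (b (tag q))) (visited (r (tag q)) (tagged q))).
  (* The root is vertex 0, whose unary code is [TNil]. *)
  apply: (@pt_ext _ _ _ _ (fun q => TCons TNil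
    (elist (fun y : iV (b (tag q)) * iV (b (tag q)) * X (tag q) => eV y.1.2)
    (tagged q)))).
    by move=> N q _; rewrite /visited -(elist_map (@eV R (b (tag q)))).
  apply: pt_cons; first exact: pt_nil.
  apply: (pt_map (X := fun q => (iV (b (tag q)) * iV (b (tag q)) * X (tag q))%type)
    (eX := fun q => @eT (b (tag q)) _ (@e (tag q))) (l := fun q => tagged q)
    (g := fun q y => eV y.1.2) stb ca) => c' _ cx'.
  exact: pt_tl (pt_hd cx').
have hmem J' (P' : nat -> J' -> Prop) ctx' (h : J' -> {j & A j})
    (v : forall z, iV (b (tag (h z)))) : ext PP c P' ctx' h ->
    pt P' ctx' (fun z => eV (v z)) ->
    pt P' ctx' (fun z => of_bool R (v z \in visited (r (tag (h z))) (tagged (h z)))).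
  move=> [h1 h2] pvz; apply: (pt_memV (b := fun z => b (tag (h z)))) => //.
  - by move=> N z /h1/bP'.
  - exact: bnd_reindex vb.
  - exact: (h2 (fun q => elist (@eV R (b (tag q))) (visited (r (tag q)) (tagged q)))).
rewrite /prim_step.
have pa : pt PP c (fun q => eopt (@e (tag q))
    (argmin (crosses (@s (tag q)) (@t (tag q)) (visited (r (tag q)) (tagged q)))
       (@le (tag q)) (G (tag q)))).
  apply: (pt_argmin (X := fun q => X (tag q)) (e := fun q => @e (tag q))
    (l := fun q => G (tag q))
    (C := fun q => crosses (@s (tag q)) (@t (tag q)) (visited (r (tag q)) (tagged q)))
    (le := fun q => @le (tag q))) => //.
  - exact: cw pG.
  - move=> J' P' ctx' h x ex' xG px; rewrite /crosses; apply: pt_neqb.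
      apply: hmem => //; apply: (hs _ _ _ (fun z => tag (h z))) => //.
      exact: ext_comp ex ex'.
    apply: hmem => //; apply: (ht _ _ _ (fun z => tag (h z))) => //.
    exact: ext_comp ex ex'.
  - move=> J' P' ctx' h x y ex' xG yG px py.
    apply: (hle _ _ _ (fun z => tag (h z))) => //.
    exact: ext_comp ex ex'.
apply: (@pt_ext _ _ _ _ (fun q => if argmin
    (crosses (@s (tag q)) (@t (tag q)) (visited (r (tag q)) (tagged q)))
       (@le (tag q)) (G (tag q)) is Some x then
  TCons (@eT (b (tag q)) _ (@e (tag q))
     (orient (@s (tag q)) (@t (tag q)) (visited (r (tag q)) (tagged q)) x))
     (elist (@eT (b (tag q)) _ (@e (tag q))) (tagged q))
  else elist (@eT (b (tag q)) _ (@e (tag q))) (tagged q))).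
  by move=> N q _; case: argmin.
apply: (pt_option (X := fun q => X (tag q)) (eX := fun q => @e (tag q))
  (o := fun q => argmin
    (crosses (@s (tag q)) (@t (tag q)) (visited (r (tag q)) (tagged q)))
       (@le (tag q)) (G (tag q)))
  (rS := fun q x => TCons (@eT (b (tag q)) _ (@e (tag q))
     (orient (@s (tag q)) (@t (tag q)) (visited (r (tag q)) (tagged q)) x))
     (elist (@eT (b (tag q)) _ (@e (tag q))) (tagged q))) pa ca) => c' cw' cx'.
set PS := someP _ _ in cw' cx' *.
have ex' : ext PP c PS c' tag by split=> // N z [].
have xG N z : PS N z -> tagged z \in G (tag (tag z)).
  by move=> [_ /argmin_mem].
have ps : pt PS c' (fun z => eV (s (tagged z))).
  apply: (hs _ _ _ (fun z => tag (tag z)) (fun z => tagged z)) => //.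
  exact: ext_comp ex ex'.
have ptt : pt PS c' (fun z => eV (t (tagged z))).
  apply: (ht _ _ _ (fun z => tag (tag z)) (fun z => tagged z)) => //.
  exact: ext_comp ex ex'.
apply: pt_cons; last first.
  exact: (cw' (fun q => elist (@eT (b (tag q)) _ (@e (tag q))) (tagged q))).
apply: (@pt_ext _ _ _ _ (fun z =>
  if s (tagged z) \in visited (r (tag (tag z))) (tagged (tag z))
  then TCons (TCons (eV (s (tagged z))) (eV (t (tagged z)))) (e (tagged z))
  else TCons (TCons (eV (t (tagged z))) (eV (s (tagged z)))) (e (tagged z)))).
  by move=> N z _; rewrite /orient; case: ifP.
apply: pt_if; last 2 first.
- by apply: pt_cons => //; apply: pt_cons.
- by apply: pt_cons => //; apply: pt_cons.
exact: (hmem _ _ _ tag (fun z => s (tagged z))).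
Qed.

End PtPrim.
End Programs.

(** * Programs for tree packing, cut enumeration and removal of duplicates *)

Section CutPrograms.
Variable R : realType.
Local Open Scope nat_scope.
Local Notation tree := (tree R).
Local Notation inp := (inp R).
Local Notation ectx := (fun j : inp => enc_instance j.1.1 j.1.2 j.2).
Local Notation based P ctx b := (ext (@inpP R) ectx P ctx b).

Lemma flatten_trees_sub (V : finType) (X : eqType) (s t : X -> V) r G k N y :
  y \in flatten (trees s t r G k N) -> y.2 \in G.
Proof.
elim: N => //= N IH; rewrite mem_cat => /orP[yT|/IH//].
apply: (prim_sub (prim_okP _ _ _ _ _ _ k)); last exact: map_f yT.
  by move=> x z; apply: leq_total.
by move=> x z w; apply: leq_trans.
Qed.

Lemma size_flatten_trees (V : finType) (X : eqType) (s t : X -> V) r G k N :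
  size (flatten (trees s t r G k N)) <= N * k.
Proof.
elim: N => //= N IH; rewrite size_cat mulSn leq_add //; exact: size_prim.
Qed.

Section PtTrees.
Variables (J : Type) (P : nat -> J -> Prop) (ctx : J -> tree) (b : J -> inp).
Hypothesis B : based P ctx b.
Variables (G : forall j, seq ('I_(ne (b j).1.1) * nat)).
Variables (k n M : J -> nat).

(** [M] bounds the copy indices, which the equality test compares in unary. Edges of earlier trees
    belong to [G], so they obey the same bound. *)
Lemma pt_trees :
  bnd P (fun j => size (G j)) -> bnd P k -> bnd P n -> bnd P M ->
  (forall N j x, P N j -> x \in G j -> x.2 <= M j) ->
  pt P ctx (fun j => elist (@eX R (b j)) (G j)) ->
  pt P ctx (fun j => eun R (k j)) -> pt P ctx (fun j => eun R (n j)) ->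
  pt P ctx (fun j => elist (elist (@eT R (b j) _ (@eX R (b j))))
    (trees (fun x : 'I_(ne (b j).1.1) * nat => src x.1) (fun x => dst x.1)
       (root_vertex (b j).1.1) (G j) (k j) (n j))).
Proof.
move=> Gb kb nb Mb GM pG pk pn; rewrite /trees.
have [bP _] := B.
pose X j : eqType := ('I_(ne (b j).1.1) * nat)%type.
pose V j : finType := 'I_(nv (b j).1.1).
pose A j := seq (seq (V j * V j * X j)).
pose s j (x : X j) : V j := src x.1.
pose t j (x : X j) : V j := dst x.1.
pose nt j := next_tree (@s j) (@t j) (root_vertex (b j).1.1) (G j) (k j).
apply: (pt_iter (A := A) (eA := fun j => elist (elist (@eT R (b j) _ (@eX R (b j)))))
  (f := fun j (ts : A j) => nt j ts :: ts) (a := fun=> [::]) nb pn (pt_nil _ _)).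
move=> c cw ca; set PP := iterP _ _ _ _ in cw ca *.
have ex : ext P ctx PP c tag by split=> // N q [].
have tb : bnd PP (fun q => size (tagged q)).
  apply: bnd_le (bnd_reindex (h := tag) _ nb) _; first by move=> N q [].
  move=> N q [_ [i ik ->]]; apply: leq_trans (ltnW ik).
  by rewrite -/(trees _ _ _ _ _ _) size_trees.
have fb : bnd PP (fun q => size (flatten (tagged q))).
  apply: bnd_le (bnd_reindex (h := tag) _ (bnd_mul nb kb)) _; first by move=> N q [].
  move=> N q [_ [i ik ->]]; apply: leq_trans (size_flatten_trees _ _ _ _ _ _) _.
  by rewrite leq_mul2r (ltnW ik) orbT.
have pf : pt PP c (fun q => elist (@eT R (b (tag q)) _ (@eX R (b (tag q))))
    (flatten (tagged q))).
  exact: (pt_flatten (X := fun q => (V (tag q) * V (tag q) * X (tag q))%type)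
    (eX := fun q => @eT R (b (tag q)) _ (@eX R (b (tag q))))).
have hload J' (P' : nat -> J' -> Prop) ctx' (h : J' -> {j & A j})
    (x : forall z, X (tag (h z))) : ext PP c P' ctx' h ->
    (forall N z, P' N z -> x z \in G (tag (h z))) ->
    pt P' ctx' (fun z => @eX R (b (tag (h z))) (x z)) ->
    bnd P' (fun z => load (tagged (h z)) (x z)) /\
    pt P' ctx' (fun z => eun R (load (tagged (h z)) (x z))).
  move=> [h1 h2] xG px.
  have fb' : bnd P' (fun z => size (flatten (tagged (h z)))) by apply: bnd_reindex fb.
  split; first by apply: bnd_le fb' _ => N z _; apply: count_size.
  apply: (pt_count (X := fun z => (V (tag (h z)) * V (tag (h z)) * X (tag (h z)))%type)
    (eX := fun z => @eT R (b (tag (h z))) _ (@eX R (b (tag (h z)))))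
    (l := fun z => flatten (tagged (h z))) (b := fun z y => y.2 == x z)) => //.
    exact: (h2 (fun q => elist (@eT R (b (tag q)) _ (@eX R (b (tag q))))
      (flatten (tagged q)))).
  move=> c' cw' cx'.
  have hM : bnd P' (fun z => M (tag (h z))).
    by apply: (bnd_reindex (h := fun z => tag (h z)) _ Mb) => N z /h1[].
  apply: (eqpt_X (b := fun z => b (tag (h (tag z))))
    (x := fun z => (tagged z).2) (y := fun z => x (tag z))).
  - by move=> N z [/h1[/bP]].
  - apply: bnd_le (bnd_reindex (h := tag) _ hM) _; first by move=> N z [].
    move=> N z [Pz [l1 [l2 lE]]]; have [Pt [i _ tE]] := h1 _ _ Pz.
    apply: (GM N) => //; apply: (@flatten_trees_sub _ _ (@s _) (@t _)
      (root_vertex (b (tag (h (tag z)))).1.1) _ (k (tag (h (tag z)))) i).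
    by rewrite /trees -[iter _ _ _]tE lE mem_cat inE eqxx orbT.
  - apply: bnd_le (bnd_reindex (h := tag) _ hM) _; first by move=> N z [].
    move=> N z [Pz _]; apply: (GM N); last exact: xG Pz.
    by have [] := h1 _ _ Pz.
  - exact: pt_tl cx'.
  - exact: (cw' (fun z => @eX R (b (tag (h z))) (x z))).
apply: pt_cons => //; rewrite /nt /next_tree.
have bP' N q : PP N q -> inpP N (b (tag q)) by case=> /bP.
apply: (pt_prim (b := fun q => b (tag q)) bP' (X := fun q => X (tag q))
  (e := fun q => @eX R (b (tag q))) (s := fun q => @s (tag q))
  (t := fun q => @t (tag q))
  (le := fun q x y => load (tagged q) x <= load (tagged q) y)
  (G := fun q => G (tag q)) (k := fun q => k (tag q))).
- by apply: (bnd_reindex (h := tag) _ Gb) => N q [].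
- by apply: (bnd_reindex (h := tag) _ kb) => N q [].
- exact: cw pG.
- exact: cw pk.
- by move=> J' P' ctx' h x _ _ px; apply: pt_hd (pt_tl (pt_hd px)).
- by move=> J' P' ctx' h x _ _ px; apply: pt_hd (pt_tl (pt_tl (pt_hd px))).
- move=> J' P' ctx' h x y ex' xG yG px py.
  have [bx lx] := hload _ _ _ _ _ ex' xG px.
  have [by_ ly] := hload _ _ _ _ _ ex' yG py.
  exact: (pt_leq lx ly by_).
Qed.

End PtTrees.

Lemma enum_cuts_size (V X : eqType) b (st : seq (V * V * X)) :
  {in enum_cuts b st, forall z, size z.1 <= size st}.
Proof.
elim: st => [|y st IH] z; first by rewrite inE => /eqP->.
case/flattenP => l /mapP[[S c] /IH /= Sst ->]; rewrite /branch inE.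
case/orP=> [/eqP->|]; first by case: ifP => /=; lia.
by case: ifP => // _; rewrite mem_seq1 => /eqP-> /=; case: ifP => /=; lia.
Qed.

Lemma size_flatten_le (X Y : Type) (f : X -> seq Y) l n :
  (forall l1 x l2, l = l1 ++ x :: l2 -> size (f x) <= n) ->
  size (flatten [seq f x | x <- l]) <= size l * n.
Proof.
elim: l => //= x l IH h; rewrite size_cat mulSn leq_add ?(h [::] x l) //.
by apply: IH => l1 y l2 lE; apply: (h (x :: l1) y l2); rewrite lE.
Qed.

Definition eS (j : inp) := epair (elist (@eV R j)) (eun R).

Section PtEnumCuts.
Variables (J : Type) (P : nat -> J -> Prop) (ctx : J -> tree) (b : J -> inp).
Hypothesis B : based P ctx b.
Variables (X : J -> eqType) (e : forall j, X j -> tree).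
Variables (st : forall j, seq ('I_(nv (b j).1.1) * 'I_(nv (b j).1.1) * X j)).

(** The right fold becomes a left fold over the reversed tree. Every intermediate list is the
    enumeration for an initial part of the tree, so [size_enum_cuts] bounds it by a power with
    exponent 20. *)
Lemma pt_enum_cuts :
  bnd P (fun j => size (st j)) ->
  pt P ctx (fun j => elist (@eT R (b j) _ (@e j)) (st j)) ->
  pt P ctx (fun j => elist (eS (j := b j)) (enum_cuts 20 (st j))).
Proof.
move=> sb ps; have [bP _] := B.
pose V j : eqType := 'I_(nv (b j).1.1).
pose A j := seq (seq (V j) * nat).
pose f j (acc : A j) (y : V j * V j * X j) := flatten [seq branch y z | z <- acc].
have fE j l : foldl (@f j) [:: ([::], 20)] l = enum_cuts 20 (rev l).
  by rewrite -[l in LHS]revK foldl_rev.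
apply: (@pt_ext _ _ _ _ (fun j => elist (eS (j := b j))
  (foldl (@f j) [:: ([::], 20)] (rev (st j))))).
  by move=> N j _; rewrite fE revK.
apply: (pt_foldl (X := fun j => (V j * V j * X j)%type)
  (eX := fun j => @eT R (b j) _ (@e j)) (A := A) (eA := fun j => elist (eS (j := b j)))
  (f := f) (a := fun=> [:: ([::], 20)])).
- by apply: bnd_le sb _ => N j _; rewrite size_rev.
- exact: pt_rev.
- apply: pt_cons; last exact: pt_nil.
  apply: pt_cons; [exact: pt_nil | exact: (pt_const _ _ 20)].
move=> c cw cx ca; set PP := foldP _ _ _ _ in cw cx ca *.
have bP' N q : PP N q -> inpP N (b (tag q)) by case=> /bP.
have sb' : bnd PP (fun q => size (st (tag q))).
  by apply: (bnd_reindex (h := tag) _ sb) => N q [].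
have ab : bnd PP (fun q => size (tagged q).1).
  apply: bnd_le (bnd_exp 20 (bnd_add (bnd_const _ 1) sb')) _.
  move=> N q [_ [l1 [l2 [lE ->]]]]; rewrite fE.
  apply: leq_trans (size_enum_cuts _ _) _; apply: leq_expn2r.
  by have := congr1 size lE; rewrite size_cat !size_rev => ->; rewrite leq_addr.
have zb N q z : PP N q -> z \in (tagged q).1 -> size z.1 <= size (st (tag q)).
  move=> [_ [l1 [l2 [lE ->]]]]; rewrite fE => /enum_cuts_size /leq_trans; apply.
  by have := congr1 size lE; rewrite size_cat !size_rev => ->; rewrite leq_addr.
rewrite /f.
apply: (pt_flatten (X := fun q => (seq (V (tag q)) * nat)%type)
  (eX := fun q => eS (j := b (tag q)))
  (l := fun q => [seq branch (tagged q).2 z | z <- (tagged q).1])).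
- by apply: bnd_le ab _ => N q _; rewrite size_map.
- apply: bnd_le (bnd_mul ab (bnd_const _ 2)) _ => N q _.
  by apply: size_flatten_le => l1 z l2 _; rewrite /branch /=; case: ifP.
apply: (@pt_ext _ _ _ _ (fun q => elist (fun z => elist (eS (j := b (tag q)))
  (branch (tagged q).2 z)) (tagged q).1)).
  by move=> N q _; rewrite elist_map.
apply: (pt_map (X := fun q => (seq (V (tag q)) * nat)%type)
  (eX := fun q => eS (j := b (tag q)))
  (g := fun q z => elist (eS (j := b (tag q))) (branch (tagged q).2 z)) ab ca).
move=> c' cw' cz; set PM := memP _ _ in cw' cz *.
have py := cw' _ cx.
have pu := pt_hd (pt_hd py); have pv := pt_tl (pt_hd py).
have pS := pt_hd cz; have pb := pt_tl cz.
have pm : pt PM c' (fun z => of_bool R ((tagged (tag z)).2.1.1 \in (tagged z).1)).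
  have bPM N z : PM N z -> inpP N (b (tag (tag z))) by case=> /bP'.
  apply: (pt_memV (b := fun z => b (tag (tag z))) bPM
    (x := fun z => (tagged (tag z)).2.1.1) (l := fun z => (tagged z).1)) => //.
  apply: bnd_le (bnd_reindex (h := tag) _ sb') _; first by move=> N z [].
  move=> N z [Pz [l1 [l2 lE]]]; apply: (zb N) Pz _.
  by rewrite lE mem_cat inE eqxx orbT.
have pvS : pt PM c' (fun z => elist (@eV R (b (tag (tag z))))
    ((tagged (tag z)).2.1.2 :: (tagged z).1)) by apply: pt_cons.
apply: (@pt_ext _ _ _ _ (fun z =>
  TCons (TCons (if (tagged (tag z)).2.1.1 \in (tagged z).1 then
      elist (@eV R (b (tag (tag z)))) ((tagged (tag z)).2.1.2 :: (tagged z).1)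
      else elist (@eV R (b (tag (tag z)))) (tagged z).1) (eun R (tagged z).2))
   (if 0 < (tagged z).2 then TCons (TCons
      (if (tagged (tag z)).2.1.1 \in (tagged z).1 then
        elist (@eV R (b (tag (tag z)))) (tagged z).1
      else elist (@eV R (b (tag (tag z)))) ((tagged (tag z)).2.1.2 :: (tagged z).1))
      (eun R (tagged z).2.-1)) TNil else TNil))).
  by move=> N z _; rewrite /branch; do 2!case: ifP.
apply: pt_cons; first by apply: pt_cons => //; apply: pt_if.
apply: pt_if; [exact: pt_pos pb | | exact: pt_nil].
apply: pt_cons; last exact: pt_nil.
by apply: pt_cons; [apply: pt_if | apply: pt_unP].
Qed.

End PtEnumCuts.

Lemma size_delta (I : instance R) U :
  size (delta (@src R I) (@dst R I) U) <= ne I.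
Proof.
rewrite size_filter; apply: leq_trans (count_size _ _) _.
by rewrite -cardE card_ord.
Qed.

Lemma pt_delta (J : Type) (P : nat -> J -> Prop) (ctx : J -> tree) (b : J -> inp)
    (U : forall j, seq (iV (b j))) :
  based P ctx b -> bnd P (fun j => size (U j)) ->
  pt P ctx (fun j => elist (@eV R (b j)) (U j)) ->
  pt P ctx (fun j => elist (@eE R (b j))
    (delta (@src R (b j).1.1) (@dst R (b j).1.1) (U j))).
Proof.
move=> [bP bc] Ub pU; rewrite /delta.
apply: (pt_filter (X := fun j => iE (b j)) (eX := fun j => @eE R (b j))
  (l := fun j => enum (iE (b j)))
  (b := fun j => crosses (@src R (b j).1.1) (@dst R (b j).1.1) (U j))).
- exact: bnd_enumE.
- exact: bc (pt_edges R).
move=> c cw cx; rewrite /crosses; set PM := memP _ _ in cw cx *.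
have bP' N q : PM N q -> inpP N (b (tag q)) by case=> /bP.
have Ub' : bnd PM (fun q => size (U (tag q))).
  by apply: (bnd_reindex (h := tag) _ Ub) => N q [].
have pU' := cw _ pU.
apply: pt_neqb.
  apply: (pt_memV (b := fun q => b (tag q)) (x := fun q => src (tagged q))
    (l := fun q => U (tag q)) bP' Ub' pU').
  exact: pt_hd (pt_tl cx).
apply: (pt_memV (b := fun q => b (tag q)) (x := fun q => dst (tagged q))
  (l := fun q => U (tag q)) bP' Ub' pU').
exact: pt_hd (pt_tl (pt_tl cx)).
Qed.

(** Equality of lists in one pass: the elements of the second list are taken off the first one by
    one, and [None] records a mismatch. *)
Definition strip (T : eqType) (o : option (seq T)) (y : T) :=
  if o is Some l then if (0 < size l) && (head y l == y) then Some (behead l)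
                      else None
  else None.

Lemma stripP (T : eqType) (x y : seq T) :
  (if foldl (@strip T) (Some x) y is Some l then size l == 0 else false) = (x == y).
Proof.
elim: y x => [|y ys IH] [|x xs] //=.
  by elim: ys {IH}.
rewrite eqseq_cons; case: eqP => //= _; by elim: ys {IH}.
Qed.

Lemma eqpt_seqE : @eqpt R (fun j : inp => seq 'I_(ne j.1.1) : eqType)
  (fun j => elist (@eE R j)) (fun _ d => size d).
Proof.
move=> J P ctx b x y bP bx by_ px py.
pose E j : eqType := 'I_(ne (b j).1.1).
have pf : pt P ctx (fun j => eopt (elist (@eE R (b j)))
    (foldl (@strip (E j)) (Some (x j)) (y j))).
  apply: (pt_foldl (X := fun j => E j) (eX := fun j => @eE R (b j))
    (A := fun j => option (seq (E j))) (eA := fun j => eopt (elist (@eE R (b j))))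
    (f := fun j => @strip (E j)) (a := fun j => Some (x j)) by_ py).
    by apply: pt_cons => //; apply: pt_nil.
  move=> c cw cx ca; set PP := foldP _ _ _ _ in cw cx ca *.
  rewrite /strip.
  apply: (@pt_ext _ _ _ _ (fun q => if (tagged q).1 is Some l then
    if (0 < size l) && (head (tagged q).2 l == (tagged q).2)
    then TCons (elist (@eE R (b (tag q))) (behead l)) TNil else TNil else TNil)).
    by move=> N q _; case: (tagged q).1 => // l; case: ifP.
  apply: (pt_option (X := fun q => seq (E (tag q)))
    (eX := fun q => elist (@eE R (b (tag q)))) (o := fun q => (tagged q).1)
    (rS := fun q l => if (0 < size l) && (head (tagged q).2 l == (tagged q).2)
    then TCons (elist (@eE R (b (tag q))) (behead l)) TNil else TNil) ca
    (pt_nil _ _)) => c' cw' cl.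
  set PS := someP _ _ in cw' cl *.
  have bP' N z : PS N z -> inpP N (b (tag (tag z))) by move=> [[/bP]].
  have cx' : pt PS c' (fun z => @eE R (b (tag (tag z))) (tagged (tag z)).2).
    exact: (cw' (fun q => @eE R (b (tag q)) (tagged q).2)).
  apply: pt_if; last exact: pt_nil.
    apply: pt_and.
      apply: (pt_case_truthy cl).
        apply: (@pt_ext _ _ _ _ (fun=> of_bool R true)); last exact: pt_true.
        by move=> N z []; case: (tagged z).
      apply: (@pt_ext _ _ _ _ (fun=> of_bool R false)); last exact: pt_false.
      by move=> N z []; case: (tagged z).
    apply: (eqpt_E (b := fun z => b (tag (tag z)))
      (x := fun z => head (tagged (tag z)).2 (tagged z))
      (y := fun z => (tagged (tag z)).2) bP' _ _ _ cx'); try exact: bnd_const.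
    apply: (pt_case_truthy cl).
      have ch : pt (fun N z => PS N z /\ truthy (elist (@eE R (b (tag (tag z))))
          (tagged z))) c' (fun z => if elist (@eE R (b (tag (tag z)))) (tagged z)
          is TCons w _ then w else TNil).
        by apply: pt_restrict (pt_head cl) => N z [].
      by apply: pt_ext ch => N z []; case: (tagged z).
    apply: (@pt_ext _ _ _ _ (fun z => @eE R (b (tag (tag z))) (tagged (tag z)).2)).
      by move=> N z []; case: (tagged z).
    by apply: pt_restrict cx' => N z [].
  apply: pt_cons; last exact: pt_nil.
  by apply: pt_ext (pt_tail cl) => N z _; case: (tagged z).
apply: (@pt_ext _ _ _ _ (fun j =>
  if foldl (@strip (E j)) (Some (x j)) (y j) is Some l
  then of_bool R (size l == 0) else of_bool R false)).
  by move=> N j _; rewrite -(stripP (x j) (y j)); case: foldl.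
apply: (pt_option (X := fun j => seq (E j)) (eX := fun j => elist (@eE R (b j)))
  (o := fun j => foldl (@strip (E j)) (Some (x j)) (y j))
  (rS := fun j l => of_bool R (size l == 0)) pf (pt_false _ _)) => c cw cl.
apply: (pt_case_truthy cl).
  apply: (@pt_ext _ _ _ _ (fun=> of_bool R false)); last exact: pt_false.
  by move=> N z []; case: (tagged z).
apply: (@pt_ext _ _ _ _ (fun=> of_bool R true)); last exact: pt_true.
by move=> N z []; case: (tagged z).
Qed.

Lemma undup_foldr (T : eqType) (l : seq T) :
  undup l = foldr (fun x acc => if x \in acc then acc else x :: acc) [::] l.
Proof. by elim: l => //= x l <-; rewrite mem_undup. Qed.

Lemma pt_undup (J : Type) (P : nat -> J -> Prop) (ctx : J -> tree) (b : J -> inp)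
    (l : forall j, seq (seq 'I_(ne (b j).1.1))) :
  based P ctx b -> bnd P (fun j => size (l j)) ->
  (forall N j d, P N j -> d \in l j -> size d <= ne (b j).1.1) ->
  pt P ctx (fun j => elist (elist (@eE R (b j))) (l j)) ->
  pt P ctx (fun j => elist (elist (@eE R (b j))) (undup (l j))).
Proof.
move=> [bP bc] lb ld pl.
pose X j : eqType := seq 'I_(ne (b j).1.1).
pose f j (acc : seq (X j)) (x : X j) := if x \in acc then acc else x :: acc.
have fE j k : foldl (@f j) [::] k = undup (rev k).
  by rewrite undup_foldr -[k in LHS]revK foldl_rev.
apply: (@pt_ext _ _ _ _ (fun j => elist (elist (@eE R (b j)))
  (foldl (@f j) [::] (rev (l j))))).
  by move=> N j _; rewrite fE revK.
apply: (pt_foldl (X := X) (eX := fun j => elist (@eE R (b j)))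
  (A := fun j => seq (X j)) (eA := fun j => elist (elist (@eE R (b j))))
  (f := f) (a := fun=> [::])).
- by apply: bnd_le lb _ => N j _; rewrite size_rev.
- exact: pt_rev.
- exact: pt_nil.
move=> c cw cx ca; set PP := foldP _ _ _ _ in cw cx ca *.
have bP' N q : PP N q -> inpP N (b (tag q)) by case=> /bP.
have accl N q d : PP N q -> (d \in (tagged q).1) || (d == (tagged q).2) ->
    size d <= ne (b (tag q)).1.1.
  move=> [Pq [l1 [l2 [lE ->]]]]; rewrite fE mem_undup mem_rev => dl.
  apply: (ld N) Pq _; rewrite -mem_rev lE mem_cat inE.
  by case/orP: dl => ->; rewrite ?orbT.
apply: (@pt_ext _ _ _ _ (fun q => if (tagged q).2 \in (tagged q).1
  then elist (elist (@eE R (b (tag q)))) (tagged q).1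
  else TCons (elist (@eE R (b (tag q))) (tagged q).2)
    (elist (elist (@eE R (b (tag q)))) (tagged q).1))).
  by move=> N q _; rewrite /f; case: ifP.
apply: pt_if => //; last exact: pt_cons.
apply: (pt_mem (X := fun j : inp => seq 'I_(ne j.1.1) : eqType)
  (b := fun q => b (tag q)) (x := fun q => (tagged q).2)
  (l := fun q => (tagged q).1) eqpt_seqE bP') => //.
- apply: bnd_le (bnd_reindex (h := tag) _ lb) _; first by move=> N q [].
  move=> N q [_ [l1 [l2 [lE ->]]]]; rewrite fE.
  apply: leq_trans (size_undup _) _; rewrite size_rev -(size_rev (l _)) lE size_cat.
  exact: leq_addr.
- apply: bnd_le (bnd_ne bP') _ => N q Pq; apply: (accl N) Pq _.
  by rewrite eqxx orbT.
- apply: bnd_le (bnd_reindex (h := tag) _ (bnd_ne bP')) _; first by move=> N z [].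
  move=> N z [Pz [l1 [l2 lE]]]; apply: (accl N) Pz _.
  by rewrite lE mem_cat inE eqxx orbT.
Qed.

End CutPrograms.

(** * Programs for the copies, the cuts and the greedy cover of a phase *)

Section PhasePrograms.
Variable R : realType.
Local Open Scope nat_scope.
Local Notation tree := (tree R).
Local Notation inp := (inp R).
Local Notation ectx := (fun j : inp => enc_instance j.1.1 j.1.2 j.2).
Local Notation based P ctx b := (ext (@inpP R) ectx P ctx b).

Definition pcap (j : inp) := minn j.1.2 (ne j.1.1).
Definition qcap (j : inp) := minn j.2 (ne j.1.1).
Definition isafe (j : inp) : pred 'I_(ne j.1.1) := [in safe j.1.1].

Section Based.
Variables (J : Type) (P : nat -> J -> Prop) (ctx : J -> tree) (b : J -> inp).
Hypothesis B : based P ctx b.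
Local Notation m_ j := (ne (b j).1.1).

Let bP : forall N j, P N j -> inpP N (b j). Proof. by case: B. Qed.

Lemma based_edges : pt P ctx (fun j => elist (@eE R (b j)) (enum 'I_(m_ j))).
Proof. by case: B => _ bc; apply: bc (pt_edges R). Qed.

Lemma based_ne : pt P ctx (fun j => eun R #|'I_(m_ j)|).
Proof.
case: B => _ bc; apply: pt_ext (bc _ (pt_ne R)) => N j _.
by rewrite card_ord.
Qed.

Lemma based_p : pt P ctx (fun j => eun R (pcap (b j))).
Proof. by case: B => _ bc; apply: bc (pt_p R). Qed.

Lemma based_q : pt P ctx (fun j => eun R (qcap (b j))).
Proof. by case: B => _ bc; apply: bc (pt_q R). Qed.

Lemma bnd_card : bnd P (fun j => #|'I_(m_ j)|).
Proof. by apply: bnd_le (bnd_ne bP) _ => N j _; rewrite card_ord. Qed.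

Lemma bnd_p : bnd P (fun j => pcap (b j)).
Proof. by apply: bnd_le (bnd_ne bP) _ => N j _; rewrite geq_minr. Qed.

Lemma bnd_q : bnd P (fun j => qcap (b j)).
Proof. by apply: bnd_le (bnd_ne bP) _ => N j _; rewrite geq_minr. Qed.

Lemma pt_iota (n : J -> nat) : bnd P n -> pt P ctx (fun j => eun R (n j)) ->
  pt P ctx (fun j => elist (eun R) (iota 0 (n j))).
Proof.
move=> nb pn.
have iE k : iter k (fun l : seq nat => size l :: l) [::] = rev (iota 0 k).
  elim: k => //= k ->; rewrite size_rev size_iota -rev_rcons.
  by rewrite -cats1 -[in RHS]addn1 -[0 :: _]/(iota 0 k.+1) -addn1 iotaD.
apply: (@pt_ext _ _ _ _ (fun j => elist (eun R)
  (rev (iter (n j) (fun l : seq nat => size l :: l) [::])))).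
  by move=> N j _; rewrite iE revK.
apply: (pt_rev (X := fun=> nat) (eX := fun=> eun R)).
  by apply: bnd_le nb _ => N j _; rewrite iE size_rev size_iota.
apply: (pt_iter (A := fun=> seq nat) (eA := fun=> elist (eun R))
  (f := fun j l => size l :: l) (a := fun=> [::]) nb pn (pt_nil _ _)) => c cw ca.
apply: pt_cons => //; apply: (pt_size (X := fun=> nat) (eX := fun=> eun R)) ca.
apply: bnd_le (bnd_reindex (h := tag) _ nb) _; first by move=> N q [].
by move=> N q [_ [i ik ->]]; rewrite iE size_rev size_iota ltnW.
Qed.

End Based.

Lemma mult_le (I : instance R) p T0 e : mult [in safe I] p T0 e <= T0 + p.
Proof. by rewrite /mult; case: ifP => _; lia. Qed.

Lemma size_copies_le (I : instance R) p T0 (F : seq 'I_(ne I)) :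
  size (copies [in safe I] p T0 F) <= size F * (T0 + p).
Proof.
apply: size_flatten_le => l1 e l2 _; rewrite size_map size_iota.
exact: mult_le.
Qed.

Lemma copies_le (I : instance R) p T0 (F : seq 'I_(ne I)) x :
  x \in copies [in safe I] p T0 F -> x.2 <= T0 + p.
Proof.
case/flattenP => l /mapP[e _ ->] /mapP[i]; rewrite mem_iota add0n => ie -> /=.
by apply: leq_trans (ltnW ie) _; apply: mult_le.
Qed.

Lemma trees_size (V : finType) (X : eqType) (s t : X -> V) r G k N :
  {in trees s t r G k N, forall T, size T <= k}.
Proof.
elim: N => //= N IH T; rewrite inE => /orP[/eqP->|/IH//].
exact: size_prim.
Qed.

Section Phase.
Variables (J : Type) (P : nat -> J -> Prop) (ctx : J -> tree) (b : J -> inp).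
Hypothesis B : based P ctx b.
Local Notation n_ j := (nv (b j).1.1).
Local Notation m_ j := (ne (b j).1.1).
Local Notation src_ j := (@src R (b j).1.1).
Local Notation dst_ j := (@dst R (b j).1.1).
Local Notation p_ j := (pcap (b j)).
Local Notation safe_ j := (@isafe (b j)).
Local Notation root_ j := (root_vertex (b j).1.1).
Variables (T0 T : J -> nat) (F : forall j, seq 'I_(m_ j)).
Hypothesis T0b : bnd P T0.
Hypothesis Fb : bnd P (fun j => size (F j)).
Hypothesis pT0 : pt P ctx (fun j => eun R (T0 j)).
Hypothesis pF : pt P ctx (fun j => elist (@eE R (b j)) (F j)).

Let bP : forall N j, P N j -> inpP N (b j). Proof. by case: B. Qed.

Let T0pb : bnd P (fun j => T0 j + p_ j).
Proof. exact: bnd_add T0b (bnd_p B). Qed.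

Let Cb : bnd P (fun j => size (copies (safe_ j) (p_ j) (T0 j) (F j))).
Proof. by apply: bnd_le (bnd_mul Fb T0pb) _ => N j _; apply: size_copies_le. Qed.

Lemma pt_copies : pt P ctx (fun j => elist (@eX R (b j))
  (copies (safe_ j) (p_ j) (T0 j) (F j))).
Proof.
rewrite /copies.
apply: (pt_flatten (X := fun j => ('I_(m_ j) * nat)%type)
  (eX := fun j => @eX R (b j))
  (l := fun j => [seq [seq (e, i) | i <- iota 0 (mult (safe_ j) (p_ j) (T0 j) e)]
   | e <- F j])) => //.
  by apply: bnd_le Fb _ => N j _; rewrite size_map.
apply: (@pt_ext _ _ _ _ (fun j => elist (fun e => elist (fun i =>
    @eX R (b j) (e, i)) (iota 0 (mult (safe_ j) (p_ j) (T0 j) e))) (F j))).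
  move=> N j _; rewrite elist_map; congr enc_seq; apply: eq_map => e.
  by rewrite elist_map.
apply: (pt_map (X := fun j => 'I_(m_ j)) (eX := fun j => @eE R (b j))
  (g := fun j e => elist (fun i => @eX R (b j) (e, i))
    (iota 0 (mult (safe_ j) (p_ j) (T0 j) e))) Fb pF) => c cw cx.
set PM := memP _ _ in cw cx *.
have mb : bnd PM (fun q => mult (safe_ (tag q)) (p_ (tag q)) (T0 (tag q)) (tagged q)).
  apply: bnd_le (bnd_reindex (h := tag) _ T0pb) _; first by move=> N q [].
  by move=> N q _; apply: mult_le.
have pm : pt PM c (fun q =>
    eun R (mult (safe_ (tag q)) (p_ (tag q)) (T0 (tag q)) (tagged q))).
  apply: (@pt_ext _ _ _ _ (fun q => if tagged q \in safe (b (tag q)).1.1 then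
    eun R (maxn (T0 (tag q)) (p_ (tag q))) else eun R (p_ (tag q)))).
    by move=> N q _; rewrite /mult /isafe /=; case: ifP.
  have pp := cw _ (based_p B).
  apply: pt_if => //; first exact: pt_hd (pt_tl (pt_tl (pt_tl cx))).
  apply: pt_maxn pp; last exact: cw pT0.
  by apply: (bnd_reindex (h := tag) _ (bnd_p B)) => N q [].
apply: (pt_map (X := fun=> nat) (eX := fun=> eun R)
  (l := fun q => iota 0 (mult (safe_ (tag q)) (p_ (tag q)) (T0 (tag q)) (tagged q)))
  (g := fun q i => @eX R (b (tag q)) (tagged q, i))).
- by apply: bnd_le mb _ => N q _; rewrite size_iota.
- exact: pt_iota.
move=> c' cw' ci; apply: pt_cons => //.
exact: (cw' (fun q => @eE R (b (tag q)) (tagged q))).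
Qed.

Local Notation cop_ j := (copies (safe_ j) (p_ j) (T0 j) (F j)).
Local Notation forest_ j :=
  (forest (src_ j) (dst_ j) (safe_ j) (root_ j) (p_ j) (T0 j) (F j)).

Let nb : bnd P (fun j => p_ j * T0 j * size (cop_ j)).
Proof. exact: bnd_mul (bnd_mul (bnd_p B) T0b) Cb. Qed.

Lemma pt_forest : pt P ctx (fun j => elist (elist (@eT R (b j) _ (@eX R (b j))))
  (forest_ j)).
Proof.
rewrite /forest; apply: (pt_trees B (M := fun j => T0 j + p_ j)) => //.
- exact: (bnd_card B).
- by move=> N j x _; apply: copies_le.
- exact: pt_copies.
- exact: (based_ne B).
- have pb := bnd_p B; have pp := based_p B; have psz := pt_size Cb pt_copies.
  exact: (pt_muln (pt_muln pp pT0 pb T0b) psz (bnd_mul pb T0b) Cb).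
Qed.

Let fb : bnd P (fun j => size (forest_ j)).
Proof. by apply: bnd_le nb _ => N j _; rewrite size_trees. Qed.

Let tree_le j st : st \in forest_ j -> size st <= #|'I_(m_ j)|.
Proof. exact: trees_size. Qed.

Local Notation cuts_all j :=
  (all_cuts (src_ j) (dst_ j) (safe_ j) (root_ j) (p_ j) (T0 j) (F j)).

Let acb : bnd P (fun j => size (cuts_all j)).
Proof.
apply: bnd_le (bnd_mul fb (bnd_exp 20 (bnd_add (bnd_const _ 1) (bnd_card B)))) _.
move=> N j _; apply: size_flatten_le => l1 st l2 lE; rewrite size_map.
apply: leq_trans (size_enum_cuts _ _) _; apply: leq_expn2r; rewrite ltnS.
by apply: tree_le; rewrite lE mem_cat inE eqxx orbT.
Qed.

Lemma pt_all_cuts :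
  pt P ctx (fun j => elist (elist (@eE R (b j))) (cuts_all j)).
Proof.
rewrite /all_cuts.
apply: (pt_flatten (X := fun j => seq 'I_(m_ j)) (eX := fun j => elist (@eE R (b j)))
  (l := fun j => [seq [seq delta (src_ j) (dst_ j) z.1 | z <- enum_cuts 20 st]
   | st <- forest_ j])) => //.
  by apply: bnd_le fb _ => N j _; rewrite size_map.
apply: (@pt_ext _ _ _ _ (fun j => elist (fun st =>
   elist (fun z => elist (@eE R (b j)) (delta (src_ j) (dst_ j) z.1))
    (enum_cuts 20 st)) (forest_ j))).
  move=> N j _; rewrite elist_map; congr enc_seq; apply: eq_map => st.
  by rewrite elist_map.
pose X j : eqType := ('I_(m_ j) * nat)%type.
pose V j : eqType := 'I_(n_ j).
apply: (pt_map (X := fun j => seq (V j * V j * X j))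
  (eX := fun j => elist (@eT R (b j) _ (@eX R (b j))))
  (g := fun j st => elist (fun z => elist (@eE R (b j))
    (delta (src_ j) (dst_ j) z.1)) (enum_cuts 20 st)) fb pt_forest) => c cw cx.
set PM := memP _ _ in cw cx *.
have B' : based PM c (fun q => b (tag q)).
  by apply: ext_comp B _; split=> // N q [].
have sb : bnd PM (fun q => size (tagged q)).
  apply: bnd_le (bnd_card B') _ => N q [_ [l1 [l2 lE]]].
  by apply: tree_le; rewrite lE mem_cat inE eqxx orbT.
have pe := pt_enum_cuts B' (X := fun q => X (tag q)) sb cx.
apply: (pt_map (X := fun q => (seq (V (tag q)) * nat)%type)
  (eX := fun q => @eS R (b (tag q))) (l := fun q => enum_cuts 20 (tagged q))
  (g := fun q z => elist (@eE R (b (tag q)))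
    (delta (src_ (tag q)) (dst_ (tag q)) z.1)) _ pe).
  apply: bnd_le (bnd_exp 20 (bnd_add (bnd_const _ 1) sb)) _ => N q _.
  exact: size_enum_cuts.
move=> c' cw' cz; set PN := memP _ _ in cw' cz *.
have B'' : based PN c' (fun z => b (tag (tag z))).
  by apply: ext_comp B' _; split=> // N q [].
apply: (pt_delta (U := fun z => (tagged z).1) B'' _ (pt_hd cz)).
apply: bnd_le (bnd_reindex (h := tag) _ sb) _; first by move=> N z [].
move=> N z [_ [l1 [l2 lE]]]; apply: (@enum_cuts_size _ _ 20).
by rewrite lE mem_cat inE eqxx orbT.
Qed.

Let cut_le j d : d \in cuts_all j -> size d <= m_ j.
Proof.
by case/flattenP => l /mapP[st _ ->] /mapP[z _ ->]; apply: size_delta.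
Qed.

Hypothesis Tb : bnd P T.
Hypothesis pT : pt P ctx (fun j => eun R (T j)).

Lemma pt_in_count (J' : Type) (P' : nat -> J' -> Prop) (ctx' : J' -> tree)
    (h : J' -> inp) (H d : forall z, seq 'I_(ne (h z).1.1)) :
  based P' ctx' h -> bnd P' (fun z => size (H z)) -> bnd P' (fun z => size (d z)) ->
  pt P' ctx' (fun z => elist (@eE R (h z)) (H z)) ->
  pt P' ctx' (fun z => elist (@eE R (h z)) (d z)) ->
  pt P' ctx' (fun z => eun R (count [in H z] (d z))) /\
  pt P' ctx' (fun z => eun R (count [pred e | (e \in H z) && isafe e] (d z))).
Proof.
move=> [hP hc] Hb db pH pd.
have mem c (P2 := memP P' d) :
    (forall r, pt P' ctx' r -> pt P2 c (fun q => r (tag q))) ->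
    pt P2 c (fun q => @eE R (h (tag q)) (tagged q)) ->
    pt P2 c (fun q => of_bool R (tagged q \in H (tag q))).
  move=> cw cx; have hP2 N q : P2 N q -> inpP N (h (tag q)) by case=> /hP.
  apply: (pt_memE (b := fun q => h (tag q)) hP2 (x := fun q => tagged q)
    (l := fun q => H (tag q))) => //.
    by apply: (bnd_reindex (h := tag) _ Hb) => N q [].
  exact: (cw (fun z => elist (@eE R (h z)) (H z))).
split.
  exact: (pt_count (X := fun z => 'I_(ne (h z).1.1)) (eX := fun z => @eE R (h z))
    (b := fun z => [in H z]) db pd).
apply: (pt_count (X := fun z => 'I_(ne (h z).1.1)) (eX := fun z => @eE R (h z))
  (b := fun z => [pred e | (e \in H z) && isafe e]) db pd) => c cw cx.
apply: pt_and; first exact: mem.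
exact: pt_hd (pt_tl (pt_tl (pt_tl cx))).
Qed.

Lemma pt_cuts : pt P ctx (fun j => elist (elist (@eE R (b j)))
  (cuts (src_ j) (dst_ j) (safe_ j) (root_ j) (p_ j) (T0 j) (T j) (F j))).
Proof.
rewrite /cuts; apply: (pt_undup B).
- by apply: bnd_le acb _ => N j _; rewrite size_filter count_size.
- by move=> N j d _; rewrite mem_filter => /andP[_]; apply: cut_le.
apply: (pt_filter (X := fun j => seq 'I_(m_ j)) (eX := fun j => elist (@eE R (b j)))
  (b := fun j => deficient (safe_ j) (p_ j) (T j) (F j)) acb pt_all_cuts).
move=> c cw cx; set PM := memP _ _ in cw cx *; rewrite /deficient.
have B' : based PM c (fun q => b (tag q)).
  by apply: ext_comp B _; split=> // N q [].
have [bP' _] := B'.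
have db : bnd PM (fun q => size (tagged q)).
  apply: bnd_le (bnd_ne bP') _ => N q [_ [l1 [l2 lE]]]; apply: cut_le.
  by rewrite lE mem_cat inE eqxx orbT.
have Fb' : bnd PM (fun q => size (F (tag q))).
  by apply: (bnd_reindex (h := tag) _ Fb) => N q [].
have [c1 c2] := pt_in_count B' Fb' db (cw _ pF) cx.
apply: pt_and; first exact: pt_pos (pt_size db cx).
apply: pt_and; first exact: (pt_leq (pt_unS c2) (based_p B') (bnd_p B')).
apply: (pt_leq (pt_unS c1) (cw _ pT)).
by apply: (bnd_reindex (h := tag) _ Tb) => N q [].
Qed.

Lemma bnd_cuts : bnd P (fun j => size
  (cuts (src_ j) (dst_ j) (safe_ j) (root_ j) (p_ j) (T0 j) (T j) (F j))).
Proof.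
apply: bnd_le acb _ => N j _; apply: leq_trans (size_undup _) _.
by rewrite size_filter count_size.
Qed.

Variable D : forall j, seq (seq 'I_(m_ j)).
Hypothesis Db : bnd P (fun j => size (D j)).
Hypothesis Dd : forall j d, d \in D j -> size d <= m_ j.
Hypothesis pD : pt P ctx (fun j => elist (elist (@eE R (b j))) (D j)).

Lemma pt_gain (J' : Type) (P' : nat -> J' -> Prop) (ctx' : J' -> tree)
    (h : J' -> J) (H : forall z, seq 'I_(m_ (h z))) (e : forall z, 'I_(m_ (h z))) :
  ext P ctx P' ctx' h -> bnd P' (fun z => size (H z)) ->
  pt P' ctx' (fun z => elist (@eE R (b (h z))) (H z)) ->
  pt P' ctx' (fun z => @eE R (b (h z)) (e z)) ->
  pt P' ctx' (fun z => eun R (gain (D (h z)) (T (h z)) (H z) (e z))).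
Proof.
move=> ex Hb pH pe; have [h1 h2] := ex; rewrite /gain.
apply: (pt_count (X := fun z => seq 'I_(m_ (h z)))
  (eX := fun z => elist (@eE R (b (h z)))) (l := fun z => D (h z))
  (b := fun z d => (e z \in d) && unsat (T (h z)) (H z) d)).
- exact: bnd_reindex Db.
- exact: (h2 (fun j => elist (elist (@eE R (b j))) (D j))).
move=> c cw cx; set PM := memP _ _ in cw cx *.
have exM : ext P' ctx' PM c tag by split=> // N q [].
have B' : based PM c (fun q => b (h (tag q))).
  exact: ext_comp (ext_comp B ex) exM.
have [bP' _] := B'.
have db : bnd PM (fun q => size (tagged q)).
  apply: bnd_le (bnd_ne bP') _ => N q [_ [l1 [l2 lE]]]; apply: Dd.
  by rewrite lE mem_cat inE eqxx orbT.
have Hb' : bnd PM (fun q => size (H (tag q))).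
  by apply: (bnd_reindex (h := tag) _ Hb) => N q [].
have [c1 _] := pt_in_count B' Hb' db (cw _ pH) cx.
apply: pt_and.
  apply: (pt_memE (b := fun q => b (h (tag q))) bP' (x := fun q => e (tag q))
    (l := fun q => tagged q)) => //.
  exact: (cw (fun z => @eE R (b (h z)) (e z))).
apply: (pt_leq (pt_unS c1)); first exact: (cw _ (h2 _ pT)).
by apply: (bnd_reindex (h := fun q => h (tag q)) _ Tb) => N q [/h1].
Qed.

Lemma pt_greedy : pt P ctx (fun j => elist (@eE R (b j))
  (greedy (@cost R (b j).1.1) (D j) (T j) #|'I_(m_ j)| (F j))).
Proof.
rewrite /greedy.
apply: (pt_iter (A := fun j => seq 'I_(m_ j)) (eA := fun j => elist (@eE R (b j)))
  (f := fun j => greedy_step (@cost R (b j).1.1) (D j) (T j)) (a := F)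
  (bnd_card B) (based_ne B) pF) => c cw ca.
set PP := iterP _ _ _ _ in cw ca *.
have ex : ext P ctx PP c tag by split=> // N q [].
have B' : based PP c (fun q => b (tag q)) by apply: ext_comp B ex.
have [bP' _] := B'.
have Hb : bnd PP (fun q => size (tagged q)).
  apply: bnd_le (bnd_reindex (h := tag) _ (bnd_add (bnd_card B) Fb)) _.
    by move=> N q [].
  move=> N q [_ [i ik ->]]; apply: leq_trans (size_greedy _ _ _ _ _) _.
  by rewrite leq_add2r ltnW.
have cov J' (P' : nat -> J' -> Prop) ctx' (h : J' -> {j & seq 'I_(m_ j)})
    (e : forall z, 'I_(m_ (tag (h z)))) : ext PP c P' ctx' h ->
    pt P' ctx' (fun z => @eE R (b (tag (h z))) (e z)) ->
    pt P' ctx' (fun z => eun R (gain (D (tag (h z))) (T (tag (h z)))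
      (tagged (h z)) (e z))) /\
    bnd P' (fun z => gain (D (tag (h z))) (T (tag (h z))) (tagged (h z)) (e z)).
  move=> ex' pe; have [h1 h2] := ex'; split.
    apply: (pt_gain (h := fun z => tag (h z)) (H := fun z => tagged (h z))) => //.
    - exact: ext_comp ex ex'.
    - exact: bnd_reindex Hb.
    - exact: (h2 (fun q => elist (@eE R (b (tag q))) (tagged q))).
  apply: bnd_le (bnd_reindex (h := fun z => tag (h z)) _ Db) _.
    by move=> N z /h1[].
  by move=> N z _; apply: count_size.
rewrite /greedy_step.
pose C (q : {j & seq 'I_(m_ j)}) : pred 'I_(m_ (tag q)) :=
  candidate (D (tag q)) (T (tag q)) (tagged q).
pose L (q : {j & seq 'I_(m_ j)}) : rel 'I_(m_ (tag q)) :=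
  cheaper (@cost R (b (tag q)).1.1) (D (tag q)) (T (tag q)) (tagged q).
have pa : pt PP c (fun q => eopt (@eE R (b (tag q)))
    (argmin (C q) (L q) (enum 'I_(m_ (tag q))))).
  apply: (pt_argmin (X := fun q => 'I_(m_ (tag q)) : eqType)
    (e := fun q => @eE R (b (tag q))) (l := fun q => enum 'I_(m_ (tag q)))
    (C := C) (le := L)).
  - exact: bnd_enumE bP'.
  - exact: based_edges B'.
  - move=> J' P' ctx' h x ex' _ px; rewrite /C /candidate.
    have [h1 h2] := ex'; have [pc _] := cov _ _ _ _ _ ex' px.
    apply: pt_and; last exact: pt_pos.
    have bPz N z : P' N z -> inpP N (b (tag (h z))) by move=> /h1/bP'.
    apply: pt_not; apply: (pt_memE (b := fun z => b (tag (h z))) bPz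
      (x := x) (l := fun z => tagged (h z))) => //.
      exact: bnd_reindex Hb.
    exact: (h2 (fun q => elist (@eE R (b (tag q))) (tagged q))).
  - move=> J' P' ctx' h x y ex' _ _ px py; rewrite /L /cheaper.
    have [pcx cxb] := cov _ _ _ _ _ ex' px.
    have [pcy cyb] := cov _ _ _ _ _ ex' py.
    apply: pt_le.
      exact: (pt_scale cyb (pt_tl (pt_tl (pt_tl (pt_tl px)))) pcy).
    exact: (pt_scale cxb (pt_tl (pt_tl (pt_tl (pt_tl py)))) pcx).
apply: (@pt_ext _ _ _ _ (fun q => if argmin (C q) (L q) (enum 'I_(m_ (tag q)))
  is Some x then TCons (@eE R (b (tag q)) x) (elist (@eE R (b (tag q))) (tagged q))
  else elist (@eE R (b (tag q))) (tagged q))).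
  by move=> N q _; rewrite -/(C q) -/(L q); case: argmin.
apply: (pt_option (X := fun q => 'I_(m_ (tag q))) (eX := fun q => @eE R (b (tag q)))
  (o := fun q => argmin (C q) (L q) (enum 'I_(m_ (tag q))))
  (rS := fun q x => TCons (@eE R (b (tag q)) x)
    (elist (@eE R (b (tag q))) (tagged q))) pa ca) => c' cw' cx'.
apply: pt_cons => //.
exact: (cw' (fun q => elist (@eE R (b (tag q))) (tagged q))).
Qed.

End Phase.

Lemma size_cuts_le (j : inp) T0 T (F : seq 'I_(ne j.1.1)) :
  {in cuts (@src R j.1.1) (@dst R j.1.1) (@isafe j) (root_vertex j.1.1) (pcap j)
    T0 T F, forall d, size d <= ne j.1.1}.
Proof.
move=> d; rewrite mem_undup mem_filter => /andP[_].
by case/flattenP => l /mapP[st _ ->] /mapP[z _ ->]; apply: size_delta.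
Qed.

End PhasePrograms.

(** * Programs for the rounds and the output *)

Section AlgorithmPrograms.
Variable R : realType.
Local Open Scope nat_scope.
Local Notation tree := (tree R).
Local Notation inp := (inp R).
Local Notation ectx := (fun j : inp => enc_instance j.1.1 j.1.2 j.2).
Local Notation based P ctx b := (ext (@inpP R) ectx P ctx b).

Section Algorithm.
Variables (J : Type) (P : nat -> J -> Prop) (ctx : J -> tree) (b : J -> inp).
Hypothesis B : based P ctx b.
Local Notation m_ j := (ne (b j).1.1).
Local Notation src_ j := (@src R (b j).1.1).
Local Notation dst_ j := (@dst R (b j).1.1).
Local Notation p_ j := (pcap (b j)).
Local Notation safe_ j := (@isafe R (b j)).
Local Notation cost_ j := (@cost R (b j).1.1).
Local Notation root_ j := (root_vertex (b j).1.1).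

Lemma pt_phase (T0 T : J -> nat) (F : forall j, seq 'I_(m_ j)) :
  bnd P T0 -> bnd P T -> bnd P (fun j => size (F j)) ->
  pt P ctx (fun j => eun R (T0 j)) -> pt P ctx (fun j => eun R (T j)) ->
  pt P ctx (fun j => elist (@eE R (b j)) (F j)) ->
  pt P ctx (fun j => elist (@eE R (b j)) (phase (src_ j) (dst_ j) (safe_ j)
    (cost_ j) (root_ j) (p_ j) (T0 j) (T j) (F j))).
Proof.
move=> T0b Tb Fb pT0 pT pF; rewrite /phase.
apply: (pt_greedy B Fb pF Tb pT).
- exact: (bnd_cuts B).
- by move=> j d; apply: size_cuts_le.
- exact: (pt_cuts B).
Qed.

Lemma pt_next_target (T : J -> nat) :
  bnd P T -> pt P ctx (fun j => eun R (T j)) ->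
  pt P ctx (fun j => eun R (next_target (p_ j) (T j))).
Proof.
move=> Tb pT; rewrite /next_target; have pb := bnd_p B; have pp := based_p B.
apply: (@pt_ext _ _ _ _ (fun j => if T j < p_ j then
  eun R (minn (T j + T j) (p_ j)) else eun R (T j).+1)).
  by move=> N j _; rewrite mul2n -addnn; case: ifP.
apply: pt_if; last exact: pt_unS.
  exact: (pt_leq (pt_unS pT) pp pb).
exact: (pt_minn pb (pt_addn pT pT Tb) pp).
Qed.

Lemma pt_mst : pt P ctx (fun j => elist (@eE R (b j))
  (mst (src_ j) (dst_ j) (cost_ j) (root_ j))).
Proof.
rewrite /mst; have [bP _] := B.
pose E j : eqType := 'I_(m_ j).
pose V j : eqType := 'I_(nv (b j).1.1).
pose st j : seq (V j * V j * E j) := prim (src_ j) (dst_ j)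
  (fun e f => (cost_ j e <= cost_ j f)%R) (root_ j) (enum 'I_(m_ j)) #|'I_(m_ j)|.
apply: (@pt_ext _ _ _ _ (fun j => elist (fun y : V j * V j * E j =>
  @eE R (b j) y.2) (st j))).
  by move=> N j _; rewrite elist_map.
apply: (pt_map (X := fun j => (V j * V j * E j)%type)
  (eX := fun j => @eT R (b j) _ (@eE R (b j))) (l := st)
  (g := fun j y => @eE R (b j) y.2)).
- by apply: bnd_le (bnd_card B) _ => N j _; apply: size_prim.
- apply: (pt_prim (b := b) bP (X := E) (e := fun j => @eE R (b j))
    (s := fun j => src_ j) (t := fun j => dst_ j)
    (le := fun j e f => (cost_ j e <= cost_ j f)%R)
    (G := fun j => enum 'I_(m_ j)) (k := fun j => #|'I_(m_ j)|)).
  + exact: bnd_enumE bP.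
  + exact: bnd_card B.
  + exact: based_edges B.
  + exact: based_ne B.
  + by move=> J' P' ctx' h x _ _ px; apply: pt_hd (pt_tl px).
  + by move=> J' P' ctx' h x _ _ px; apply: pt_hd (pt_tl (pt_tl px)).
  + move=> J' P' ctx' h x y _ _ _ px py; apply: pt_le.
      exact: pt_tl (pt_tl (pt_tl (pt_tl px))).
    exact: pt_tl (pt_tl (pt_tl (pt_tl py))).
by move=> c _ cx; apply: pt_tl cx.
Qed.

End Algorithm.

Lemma size_mst (I : instance R) :
  size (mst (@src R I) (@dst R I) (@cost R I) (root_vertex I)) <= #|'I_(ne I)|.
Proof. by rewrite size_map; apply: size_prim. Qed.

(** [rounds_spec] presupposes a feasible competitor, whereas the running time is claimed for every
    input in [inpP]. These bounds hold without feasibility. *)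
Lemma rounds_bound (I : instance R) p Q i : p <= Q ->
  let x := iter i (round (@src R I) (@dst R I) [in safe I] (@cost R I)
    (root_vertex I) p Q)
    (1, mst (@src R I) (@dst R I) (@cost R I) (root_vertex I)) in
  x.1 <= Q.+1 /\ size x.2 <= i.+1 * #|'I_(ne I)|.
Proof.
move=> pQ; elim: i => [|i] /=; first by rewrite mul1n size_mst.
set x := iter i _ _ => -[x1 x2]; rewrite /round; case: ifP => xQ /=.
  split; first by rewrite /next_target; move: x.1 xQ pQ => y; case: (ltnP y p); lia.
  rewrite mulSn; apply: leq_trans (size_greedy _ _ _ _ _) _.
  by rewrite leq_add2l.
by split=> //; rewrite mulSn (leq_trans x2) ?leq_addl.
Qed.

Lemma pt_solve : pt (@inpP R) ectx
  (fun j => elist (@eE R j) (solve j.1.1 j.1.2 j.2)).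
Proof.
have B : based (@inpP R) ectx id by split.
have pb := bnd_p B; have qb := bnd_q B.
pose Q j := @pcap R j + @qcap R j.
have Qb : bnd (@inpP R) Q by apply: bnd_add.
have pQ : pt (@inpP R) ectx (fun j => eun R (Q j)).
  exact: (pt_addn (based_p B) (based_q B) qb).
pose A (j : inp) := (nat * seq 'I_(ne j.1.1))%type.
pose a (j : inp) : A j := (1, mst (@src R j.1.1) (@dst R j.1.1) (@cost R j.1.1)
  (root_vertex j.1.1)).
pose f (j : inp) : A j -> A j := round (@src R j.1.1) (@dst R j.1.1) (@isafe R j)
  (@cost R j.1.1) (root_vertex j.1.1) (pcap j) (Q j).
have h : pt (@inpP R) ectx (fun j => epair (eun R) (elist (@eE R j))
    (iter (Q j) (@f j) (a j))).
  apply: (pt_iter (A := A) (eA := fun j => epair (eun R) (elist (@eE R j)))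
    (f := f) (a := a) Qb pQ).
    by apply: pt_cons; [exact: (pt_const _ _ 1) | exact: (pt_mst B)].
  move=> c cw ca; set PP := iterP _ _ _ _ in cw ca *.
  have B' : based PP c tag by split=> // N q [].
  have rb N q : PP N q -> (tagged q).1 <= (Q (tag q)).+1 /\
      size (tagged q).2 <= (Q (tag q)).+1 * #|'I_(ne (tag q).1.1)|.
    move=> [_ [i iQ ->]].
    have [] := rounds_bound (tag q).1.1 i (leq_addr (qcap (tag q)) (pcap (tag q))).
    move=> -> le2; split=> //; apply: leq_trans le2 _.
    by rewrite leq_mul2r ltnS (ltnW iQ) orbT.
  have Qb' : bnd PP (fun q => Q (tag q)).
    by apply: (bnd_reindex (h := tag) _ Qb) => N q [].
  have Q1 := bnd_add (bnd_const PP 1) Qb'.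
  have xb : bnd PP (fun q => (tagged q).1).
    by apply: bnd_le Q1 _ => N q /rb[].
  have Fb : bnd PP (fun q => size (tagged q).2).
    by apply: bnd_le (bnd_mul Q1 (bnd_card B')) _ => N q /rb[].
  have nb : bnd PP (fun q => next_target (pcap (tag q)) (tagged q).1).
    apply: bnd_le (bnd_add (bnd_add (bnd_p B') (bnd_const PP 1)) xb) _ => N q _.
    by rewrite /next_target; case: ifP; lia.
  have px := pt_hd ca; have pF := pt_tl ca; have pQ' := cw _ pQ.
  have pn := pt_next_target B' xb px.
  have pph := pt_phase B' xb nb Fb px pn pF.
  apply: (@pt_ext _ _ _ _ (fun q => if (tagged q).1 < Q (tag q) then
    TCons (eun R (next_target (pcap (tag q)) (tagged q).1))
      (elist (@eE R (tag q)) (phase (@src R (tag q).1.1) (@dst R (tag q).1.1)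
        (@isafe R (tag q)) (@cost R (tag q).1.1) (root_vertex (tag q).1.1)
        (pcap (tag q)) (tagged q).1 (next_target (pcap (tag q)) (tagged q).1)
        (tagged q).2))
    else epair (eun R) (elist (@eE R (tag q))) (tagged q))).
    by move=> N q _; rewrite /f /round; case: ifP.
  apply: pt_if => //; first exact: (pt_leq (pt_unS px) pQ' Qb').
  exact: pt_cons.
exact: pt_tl h.
Qed.

Lemma pt_output : pt (@inpP R) ectx
  (fun j => enc_edge_set R [set e in solve j.1.1 j.1.2 j.2]).
Proof.
have B : based (@inpP R) ectx id by split.
have bP N (j : inp) : inpP N j -> inpP N (id j) by [].
rewrite /enc_edge_set.
apply: (pt_map (X := fun j : inp => 'I_(ne j.1.1)) (eX := fun j => @eE R j)
  (g := fun j e => of_bool R (e \in [set e in solve j.1.1 j.1.2 j.2]))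
  (bnd_enumE bP) (based_edges B)) => c cw cx.
apply: (@pt_ext _ _ _ _ (fun q => of_bool R
  (tagged q \in solve (tag q).1.1 (tag q).1.2 (tag q).2))).
  by move=> N q _; rewrite inE.
set PM := memP _ _ in cw cx *.
have bPM N q : PM N q -> inpP N (tag q) by case.
apply: (pt_memE (b := fun q : {j : inp & 'I_(ne j.1.1)} => tag q) bPM
  (x := fun q => tagged q)
  (l := fun q => solve (tag q).1.1 (tag q).1.2 (tag q).2)) => //; last first.
  exact: cw pt_solve.
have [bq qq] := (bnd_reindex (h := tag) bPM (bnd_add (bnd_p B) (bnd_q B)),
  bnd_reindex (h := tag) bPM (bnd_card B)).
apply: bnd_le (bnd_mul (bnd_add (bnd_const PM 1) bq) qq) _ => N q _.
by have [] := rounds_bound (tag q).1.1 (pcap (tag q) + qcap (tag q))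
  (leq_addr (qcap (tag q)) (pcap (tag q))).
Qed.

End AlgorithmPrograms.

Theorem theorem5 (R : realType) :
  exists (A : cmd) (a k : nat) (C : R),
  forall (I : instance R) (p q : nat),
    (1 <= p)%N ->
    (exists F0 : {set 'I_(ne I)}, feasible I p q F0) ->
    exists (t : nat) (F : {set 'I_(ne I)}),
      [/\ computes_in A (enc_instance I p q) t (enc_edge_set R F),
          (t <= a * tree_size (enc_instance I p q) ^ k)%N,
          feasible I p q F &
          forall F' : {set 'I_(ne I)}, feasible I p q F' ->
            total_cost I F <=
              C * ((maxn q 1)%:R * ln ((nv I)%:R : R)) * total_cost I F'].
Proof.
have [c _ [T [a [k TP]] cP]] := pt_output R.
(* Run at 0, the program leaves its result in variable 1, which is copied to the output variable.
   The factor 2^k turns a bound in N + 1 into one in N, as N >= 1, and the 2 pays for the copy. *)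
exists (Seq (c 0%N) (Assign 0 (Var 1))), ((a + 2) * 2 ^ k)%N, k, (approx_ratio R).
move=> I p q p0 feas; set N := tree_size (enc_instance I p q).
have N0 : (0 < N)%N by [].
pose s0 := update (fun=> TNil) 0 (enc_instance I p q) : store R.
have [t [s [ex tT s1 _]]] := cP N (I, p, q) 0%N s0 (leqnn _) (updateE _ _ _).
have [sf sc] := solve_spec p0 feas.
exists (t + 2)%N, [set e in solve I p q]; split=> //.
  exists (update s 0 (s 1%N)); last by rewrite updateE s1.
  by apply: ExecSeq ex _; apply: ExecAssign.
have le1 : (N.+1 ^ k <= 2 ^ k * N ^ k)%N.
  by rewrite -expnMn; apply: leq_expn2r; lia.
have k0 : (0 < 2 ^ k * N ^ k)%N by rewrite muln_gt0 !expn_gt0 N0.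
have := leq_trans tT (TP N); have := leq_mul (leqnn a) le1.
by rewrite -mulnA; nia.
Qed.
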